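(* Suppose Assumptions A1–A4 and A5(i) hold. If $L/N\to0$, $T/N\to0$ and $T/(N/L)^{20}\to0$ as $N,T\to\infty$, then for each $1\le l\le L$, $$\sqrt{NT}\,\big(\tilde\gamma_l-H_\Gamma^\top\gamma_l\big)\xrightarrow{D}\mathcal N\big(0,\ \boldsymbol H^\top\Sigma_f^{-1}\Sigma_{xf,l}\Sigma_f^{-1}\boldsymbol H\big),$$ where $\tilde\gamma_l^\top$ is the $l$-th row of $\tilde\Gamma$, $\gamma_l^\top$ is the $l$-th row of $\Gamma$, and $\boldsymbol H$ is the probability limit of $H_\Gamma$ (equivalently of $H_F^{-1}$).
   Context: Setup. $K$ (number of factors) is fixed; $N,T\to\infty$ and $L=L_{N,T}<N$ may grow. For a full-column-rank matrix $A$, $P_A=A(A^\top A)^{-1}A^\top$. For $t=1,\dots,T$, $X_t\in\mathbb R^{N\times L}$ is a random matrix of firm characteristics with rows $x_{it}^\top$, and $Q_t=X_t^\top X_t/N$. Excess returns $R_{t+1}=(r_{1,t+1},\dots,r_{N,t+1})^\top$ satisfy $R_{t+1}=\alpha_{O,t}+\alpha_{I,t}+B_tf_{t+1}+E_{t+1}$, where $B_t=X_t\Gamma$ (rows $B_{it}^\top$), $\Gamma\in\mathbb R^{L\times K}$ has rows $\gamma_l^\top$, $f_{t+1}\in\mathbb R^K$, $E_{t+1}=(\epsilon_{1,t+1},\dots,\epsilon_{N,t+1})^\top$, $\alpha_{I,t}=(I_N-P_{B_t})X_t\eta$ with $\eta\in\mathbb R^L$, and $\alpha_{O,t}=B^o_t\delta_{o,t}$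 with $\delta_{o,t}=\zeta+\xi_t\in\mathbb R^{N-L}$, $B^o_t=X^o_t(X_t^{o\top}X^o_t/N)^{-1/2}$, $X^o_t=(I_N-P_{X_t})\Omega$ for a fixed full-column-rank $\Omega\in\mathbb R^{N\times(N-L)}$ such that $X^o_t$ has full column rank. $B^o_{t,jq}$ is the $(j,q)$ entry of $B^o_t$ and $B^o_{t,i}\in\mathbb R^{N-L}$ is its $i$-th row (as a column). Write $a_{it}=\eta^\top x_{it}$, $\breve f_{t+1}=f_{t+1}-(\Gamma^\top X_t^\top X_t\Gamma)^{-1}\Gamma^\top X_t^\top X_t\eta$, $\bar{\breve f}=T^{-1}\sum_t\breve f_{t+1}$, $f^d_{t+1}=\breve f_{t+1}-\bar{\breve f}$, $F^d=[f^d_2,\dots,f^d_{T+1}]$, $Q^f=T^{-1}\sum_t f^d_{t+1}f^{d\top}_{t+1}$, $Q^B_t=N^{-1}\sum_iB_{it}B_{it}^\top$, $Q^{a,B}_t=N^{-1}\sum_ia_{it}B_{it}^\top$, $D_t=\{q\le N-L:\xi_{t,q}\neq0\}$. Estimators. $\ddot R_{t+1}=(X_t^\top X_t)^{-1}X_t^\top R_{t+1}$, $\bar{\ddot R}=T^{-1}\sum_t\ddot R_{t+1}$, $\ddot R^d$ is the $L\times T$ matrix with columns $\ddot R_{t+1}-\bar{\ddot R}$. $\tilde\Gamma\in\mathbb R^{L\times K}$ is the matrix of the top-$K$ left singular vectors of $\ddot R^d$; $\tilde F^d=(\tilde\Gamma^\top\tilde\Gamma)^{-1}\tilde\Gamma^\top\ddot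 R^d$ with columns $\tilde f^d_{t+1}$; $H_F=(\tilde\Gamma^\top\tilde\Gamma)^{-1}\tilde\Gamma^\top\Gamma$, $H_\Gamma=F^d\tilde F^{d\top}(\tilde F^d\tilde F^{d\top})^{-1}$. $\tilde\eta=(I_L-P_{\tilde\Gamma})\bar{\ddot R}$, $\tilde\alpha_{I,t}=(I_N-P_{X_t\tilde\Gamma})X_t\tilde\eta$ (entries $\tilde\alpha_{I,it}$), $\tilde f_{t+1}=(\tilde\Gamma^\top\tilde\Gamma)^{-1}\tilde\Gamma^\top\ddot R_{t+1}+(\tilde\Gamma^\top X_t^\top X_t\tilde\Gamma)^{-1}\tilde\Gamma^\top X_t^\top X_t\tilde\eta$. Outside alpha: $\tilde\delta_{o,t}=(B_t^{o\top}B^o_t)^{-1}B_t^{o\top}R_{t+1}$, $\tilde\zeta=T^{-1}\sum_t\tilde\delta_{o,t}$, $\rho_t=C_\rho\sigma_{t+1}\sqrt{\log(NT)/N}$ for a sufficiently large constant $C_\rho$, $\tilde\xi_{t,q}=(\tilde\delta_{o,t,q}-\tilde\zeta_q)\mathbf 1\{|\tilde\delta_{o,t,q}-\tilde\zeta_q|\ge\rho_t\}$, $\hat\zeta=\tilde\zeta-T^{-1}\sum_t\tilde\xi_t$, $\hat\xi_{t,q}=(\tilde\delta_{o,t,q}-\hat\zeta_q)\mathbf 1\{\tilde\xi_{t,q}\ne0\}$, $\hat\alpha_{O,t}=B^o_t(\hat\zeta+\hat\xi_t)$. Residuals $\hat\epsilon_{i,t+1}=r_{i,t+1}-\hat\alpha_{O,it}-\tilde\alpha_{I,it}-x_{it}^\top\tilde\Gamma\tilde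 f_{t+1}$, $\hat\sigma^2_{t+1}=N^{-1}\sum_i\hat\epsilon_{i,t+1}^2$, and the debiased estimator $\hat\Gamma=\tilde\Gamma-\big(\sum_t\hat\sigma^2_{t+1}(X_t^\top X_t)^{-1}\big)\tilde\Gamma(\tilde\Gamma^\top\tilde\Gamma)^{-1}(\tilde F^d\tilde F^{d\top})^{-1}$ with rows $\hat\gamma_l^\top$; $\hat\eta=(I_L-P_{\hat\Gamma})\bar{\ddot R}$, $\hat\alpha_{I,t}=(I_N-P_{X_t\hat\Gamma})X_t\hat\eta$. Assumptions (constants $c_1,c_2,C$ positive, not depending on $N,T$). A1: $E[x_{it,l}^2]\le C$; with probability approaching one, all eigenvalues of $Q_t$ lie in $(c_1,c_2)$. A2: eigenvalues of $\Gamma^\top\Gamma$ lie in $(c_1,c_2)$; $E\|f_t\|^4\le C$; $T^{-1}F^dF^{d\top}\to_p\Sigma_f$ positive definite; the eigenvalues of $(\Gamma^\top\Gamma)\Sigma_f$ are distinct; $E\|B_{it}\|^2\le C$; $\eta^\top\Gamma=0$ and $\|\eta\|\le C$. A3: conditional on $(x_{it},f_{t+1})_{i,t}$: $E\epsilon_{i,t+1}=0$, $E\epsilon_{i,t+1}^2=\sigma^2_{t+1}$ (with $\sigma_{t+1}$ bounded away from $0$ and $\infty$), $E\exp(s\epsilon_{i,t+1})\le\exp(Cs^2\sigma^2_{t+1})$ for all $s\in\mathbb R$, the $\epsilon$'s are independent across $i$, and $\max_{i,t}\sum_s|\mathrm{Cov}(\epsilon_{it},\epsilon_{is})|\le C$.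 A4: for every $t$ and $q$, $T^{-1}\sum_{s=1}^T|\xi_{s,q}|=o\big(\sigma_{t+1}\sqrt{\log(NT)}/\sqrt N\big)$; $\sigma_{t+1}\sqrt{\log(NT)}/(|\xi_{t,q}|\sqrt N)\to0$ for $q\in D_t$; and $(\log N/N)|D_t|\to0$. A5: conditional on $(x_{it},f_{t+1})_{i\le N,t\le T}$: (i) $\frac1{\sqrt{NT}}\sum_{i,t}(e_l^\top Q_t^{-1}x_{it})f^d_{t+1}\epsilon_{i,t+1}\xrightarrow{D}\mathcal N(0,\Sigma_{xf,l})$ for a positive definite $\Sigma_{xf,l}$; (ii) $\frac1{\sqrt{NTL}}\sum_{j,s}g_{it,js}\epsilon_{j,s+1}\xrightarrow{D}\mathcal N(0,\sigma^2_{I,it})$, where $g_{it,js}=\big[1-(Q^{a,B}_t(Q^B_t)^{-1}+\bar{\breve f}^\top)(Q^f)^{-1}f^d_{s+1}\big](x_{it}^\top Q_t^{-1}x_{js}-B_{it}^\top(Q^B_t)^{-1}B_{js})-\big(B_{it}^\top(Q^B_t)^{-1}(Q^f)^{-1}f^d_{s+1}\big)(a_{js}-Q^{a,B}_t(Q^B_t)^{-1}B_{js})$; (iii) $\frac1{\sqrt N}\sum_jB^o_{t,jq}\epsilon_{j,t+1}\xrightarrow{D}\mathcal N(0,\sigma^2_{\delta,qt})$; (iv) $\sigma_{o,it}^{-1}\big(\frac1{NT}\sum_{j,s}B^{o\top}_{t,i}B^o_{s,j}\epsilon_{j,s+1}+\frac1N\sum_j(\sum_{q\in D_t}B^o_{t,iq}B^o_{t,jq})\epsilon_{j,t+1}\big)\xrightarrow{D}\mathcal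 N(0,1)$, for positive constants $\sigma_{I,it},\sigma_{\delta,qt},\sigma_{o,it}$; $e_l$ is the $l$-th standard basis vector.
   Formalization: The existence of the probability limit H of H_Γ is assumed: the assumptions do not give it, since singular vectors have arbitrary signs and Γ'Γ need not converge as N,T grow, leaving H undefined. The parenthetical equivalent description of H as the limit of H_F^{-1} is not stated. *)

(* Defs.v *)
From HB Require Import structures.
From mathcomp Require Import all_boot all_order all_algebra.
From mathcomp Require Import all_classical all_reals all_analysis.
Import Order.TTheory GRing.Theory Num.Theory numFieldTopology.Exports.

Set Implicit Arguments.
Unset Strict Implicit.
Unset Printing Implicit Defensive.

Local Open Scope classical_set_scope.
Local Open Scope ring_scope.

Section LinAlg.
Variable R : realType.

Definition projmx m n (A : 'M[R]_(m, n)) : 'M[R]_m :=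
  A *m invmx (A^T *m A) *m A^T.

Definition full_col_rank m n (A : 'M[R]_(m, n)) : Prop := \rank A = n.

Definition eigs_in n (A : 'M[R]_n) (a b : R) : Prop :=
  forall x, eigenvalue A x -> a < x < b.

Definition distinct_eigs n (A : 'M[R]_n) : Prop :=
  exists e : 'I_n -> R, injective e /\ forall k, eigenvalue A (e k).

Definition posdef n (S : 'M[R]_n) : Prop :=
  S^T = S /\ forall v : 'cV[R]_n, v != 0 -> 0 < (v^T *m S *m v) 0 0.

(* M^{-1/2}: the symmetric positive definite S with S S M = I
   (chosen classically; 0 if no such S exists) *)
Definition isqrtmx n (M : 'M[R]_n) : 'M[R]_n :=
  xget 0 [set S : 'M[R]_n | posdef S /\ S *m S *m M = 1%:M].

Definition selmx m k : 'M[R]_(m, k) := \matrix_(i, j) ((i : nat) == j)%:R.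

Definition topk_left_sv m p k (M : 'M[R]_(m, p)) (G : 'M[R]_(m, k)) : Prop :=
  exists (U : 'M[R]_m) (V : 'M[R]_p) (S : 'M[R]_(m, p)),
    [/\ U^T *m U = 1%:M, V^T *m V = 1%:M & M = U *m S *m V^T] /\
    [/\ forall (i : 'I_m) (j : 'I_p), (i : nat) != j -> S i j = 0,
        forall (i : 'I_m) (j : 'I_p), (i : nat) = j -> 0 <= S i j,
        forall (i i' : 'I_m) (j j' : 'I_p),
          (i : nat) = j -> (i' : nat) = j' -> (i <= i')%N ->
                          S i' j' <= S i j
      & G = U *m selmx m k].

(* l-th row (0-based, as a column vector) of A; zero if l >= m *)
Definition rowv m k (A : 'M[R]_(m, k)) (l : nat) : 'cV[R]_k :=
  \col_j (\sum_(i < m | (i : nat) == l) A i j).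

Definition coordv m (v : 'cV[R]_m) (l : nat) : R :=
  \sum_(i < m | (i : nat) == l) v i 0.

Definition sqnorm m (v : 'cV[R]_m) : R := \sum_i v i 0 ^+ 2.

End LinAlg.

(* Time index t : 'I_T stands for t+1 in the paper (t = 1..T).          *)
Section Model.
Variables (R : realType) (N L T K : nat).
Variables (X : 'I_T -> 'M[R]_(N, L)) (Gam : 'M[R]_(L, K)) (eta : 'cV[R]_L)
  (Om : 'M[R]_(N, N - L)) (zeta : 'cV[R]_(N - L)) (xi : 'I_T -> 'cV[R]_(N - L))
  (f : 'I_T -> 'cV[R]_K) (E : 'I_T -> 'cV[R]_N).

Definition Qmx t : 'M[R]_L := (N%:R)^-1 *: ((X t)^T *m X t).
Definition Bmx t : 'M[R]_(N, K) := X t *m Gam.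
Definition Xomx t : 'M[R]_(N, N - L) := (1%:M - projmx (X t)) *m Om.
Definition Bomx t : 'M[R]_(N, N - L) :=
  Xomx t *m isqrtmx ((N%:R)^-1 *: ((Xomx t)^T *m Xomx t)).
Definition alphaI t : 'cV[R]_N := (1%:M - projmx (Bmx t)) *m X t *m eta.
Definition alphaO t : 'cV[R]_N := Bomx t *m (zeta + xi t).
Definition Ret t : 'cV[R]_N := alphaO t + alphaI t + Bmx t *m f t + E t.

Definition ddotR t : 'cV[R]_L := invmx ((X t)^T *m X t) *m (X t)^T *m Ret t.
Definition ddotRbar : 'cV[R]_L := (T%:R)^-1 *: \sum_t ddotR t.
Definition ddotRd : 'M[R]_(L, T) := \matrix_(i, t) (ddotR t - ddotRbar) i 0.

Definition brevef t : 'cV[R]_K :=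
  f t - invmx (Gam^T *m (X t)^T *m X t *m Gam) *m Gam^T *m (X t)^T *m X t *m eta.
Definition brevefbar : 'cV[R]_K := (T%:R)^-1 *: \sum_t brevef t.
Definition Fdmx : 'M[R]_(K, T) := \matrix_(k, t) (brevef t - brevefbar) k 0.

Definition tFdmx (tG : 'M[R]_(L, K)) : 'M[R]_(K, T) :=
  invmx (tG^T *m tG) *m tG^T *m ddotRd.
Definition HGam (tG : 'M[R]_(L, K)) : 'M[R]_K :=
  Fdmx *m (tFdmx tG)^T *m invmx (tFdmx tG *m (tFdmx tG)^T).

Definition gamma_stat (tG : 'M[R]_(L, K)) (l : nat) : 'cV[R]_K :=
  Num.sqrt ((N * T)%:R) *: (rowv tG l - (HGam tG)^T *m rowv Gam l).

Definition xf_stat (l : nat) : 'cV[R]_K :=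
  (Num.sqrt ((N * T)%:R))^-1 *:
    \sum_(i < N) \sum_(t < T)
      (coordv (invmx (Qmx t) *m (row i (X t))^T) l * E t i 0) *: col t Fdmx.

End Model.

Section Prob.
Variables (R : realType) (d : measure_display) (Om : measurableType d)
  (P : probability Om R).

Definition conv_prob (Y : nat -> Om -> R) (c : R) : Prop :=
  forall e : R, 0 < e ->
    (fun n => P [set w | e < `|Y n w - c|]) @ \oo --> 0%E.

Definition conv_prob_mx m p (Y : nat -> Om -> 'M[R]_(m, p)) (C : 'M[R]_(m, p))
  : Prop := forall i j, conv_prob (fun n w => Y n w i j) (C i j).

Definition Gmeasurable (G : set (set Om)) (Y : Om -> R) : Prop :=
  forall a : R, G [set w | Y w <= a].

Definition cexp_version (G : set (set Om)) (Xr Y : Om -> R) : Prop :=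
  [/\ Gmeasurable G Y, P.-integrable setT (fun w => (Y w)%:E)
    & forall A, G A -> (\int[P]_(w in A) (Y w)%:E = \int[P]_(w in A) (Xr w)%:E)%E].

Definition cond_indep (I : finType) (G : set (set Om)) (F : I -> set (set Om))
  : Prop :=
  forall (J : {set I}) (A : I -> set Om) (p : I -> Om -> R),
    (forall i, i \in J -> F i (A i)) ->
    (forall i, i \in J -> cexp_version G (\1_(A i)) (p i)) ->
    cexp_version G (\1_(\bigcap_(i in [set i | i \in J]) A i))
                   (fun w => \prod_(i in J) p i w).

End Prob.

(* Expectation of h(Z_0, ..., Z_{k-1}) for i.i.d. standard normals,
   as an iterated integral against the standard normal law *)
Fixpoint iter_gauss (R : realType) (k : nat) (h : (nat -> R) -> R) : R :=
  match k with
  | 0 => h (fun _ => 0)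
  | k'.+1 => Rintegral (normal_prob (0 : R) 1) setT
               (fun x => iter_gauss k' (fun z => h (fun j => if j == k' then x else z j)))
  end.

(* E g(A Z) with Z ~ N(0, I_K), i.e. E g(Y) for Y ~ N(0, A A^T) *)
Definition gaussE (R : realType) K (A : 'M[R]_K) (g : 'cV[R]_K -> R) : R :=
  iter_gauss K (fun z => g (A *m \col_i z i)).

Definition bounded_cont (R : realType) K (g : 'cV[R]_K -> R) : Prop :=
  continuous g /\ exists M : R, forall v, `|g v| <= M.

Definition conv_dist_normal (R : realType) (d : measure_display)
  (Om : measurableType d) (P : probability Om R) K
  (S : nat -> Om -> 'cV[R]_K) (Sigma : 'M[R]_K) : Prop :=
  exists A : 'M[R]_K, A *m A^T = Sigma /\
    forall g, bounded_cont g ->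
      (fun n => Rintegral P setT (fun w => g (S n w))) @ \oo --> gaussE A g.

Definition cond_conv_dist_normal (R : realType) (d : measure_display)
  (Om : measurableType d) (P : probability Om R) K
  (G : nat -> set (set Om)) (S : nat -> Om -> 'cV[R]_K) (Sigma : 'M[R]_K) : Prop :=
  exists A : 'M[R]_K, A *m A^T = Sigma /\
    forall g, bounded_cont g ->
      forall Y : nat -> Om -> R,
        (forall n, cexp_version P (G n) (fun w => g (S n w)) (Y n)) ->
        conv_prob P Y (gaussE A g).

(* Main.v *)
(* On the event that every [Q_t] has its eigenvalues in [(c1, c2)], the
   regressions remove the outside alpha and leave [Rd = Gamma Fd + Ed], where
   the columns of [Ed] are the demeaned vectors [(X_t' X_t)^-1 X_t' E_t].  With
   [D] the diagonal matrix of the top squared singular values of [Rd], the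
   relation [Rd Rd' tG = tG D] gives
     [tgamma_l - H_Gamma' gamma_l
        = D^-1 tG' Gamma (Fd Ed' e_l) + D^-1 tG' Ed Ed' e_l].
   The first term is [(D/T)^-1 tG' Gamma] times the statistic of A5(i), up to
   the scaling [sqrt (N T)], and the definition of [H_Gamma] shows that this
   matrix tends to [H' Sf^-1].  In the second term [tG] is replaced by
   [Gamma H_Gamma] plus an error of order [sqrt (L/(N T)) + sqrt L / N]; since
   [Gamma' (X_t' X_t)^-1 X_t' E_t] is of order [N^(-1/2)], what remains after
   scaling is of order [sqrt (T/N) + L/N].
   All stochastic bounds come from the inequality
   [E (sum_it w_it eps_it)^2 <= C E (sum_it w_it^2)] for weights that are
   measurable with respect to characteristics and factors; it needs only
   independence across units and the bound on conditional autocovariances. *)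

From HB Require Import structures.
From mathcomp Require Import all_boot all_order all_algebra.
From mathcomp Require Import finmap.
From mathcomp Require Import all_classical all_reals all_analysis.
From mathcomp Require Import measurable_realfun ring lra.
Require Import Defs.
Import Order.TTheory GRing.Theory Num.Theory numFieldTopology.Exports.
Import numFieldNormedType.Exports HBNNSimple.

Set Implicit Arguments.
Unset Strict Implicit.
Unset Printing Implicit Defensive.

Local Open Scope classical_set_scope.
Local Open Scope ring_scope.

(** * Frobenius norm and Rayleigh quotients *)

Section Frobenius.
Variable R : realType.

(** Two difficulties shape the development. Convergence in distribution is stated through integrals
    of [g (S n w)], so every statistic has to be measurable, including the returns, which contain an
    inverse square root picked by choice; its measurability rests on the closedness of a set of
    positive definite squares. Moreover the given central limit theorem is conditional and the
    conclusion is not, so the conditional limit is integrated out before Slutsky's lemma is applied.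
    Replacing [tG] by [Gam *m HG] is circular: the error [Del] reappears in its own bound,
    multiplied by [Ed *m Ed^T], and is absorbed because [Ed] is small. Randomness is confined to
    eight events, each failing with probability at most [dl / 8]; on their intersection the
    remainder is bounded deterministically. The Frobenius norm is used throughout: its square is a
    sum of squared entries, which is what the moment inequality controls, and the identity of size
    [L] contributes the factor [L] in the rates. *)

Lemma cauchy_schwarz (I : finType) (a b : I -> R) :
  (\sum_i a i * b i) ^+ 2 <= (\sum_i a i ^+ 2) * (\sum_i b i ^+ 2).
Proof.
have lagrange : \sum_i \sum_j (a i * b j - a j * b i) ^+ 2 =
    ((\sum_i a i ^+ 2) * (\sum_i b i ^+ 2) - (\sum_i a i * b i) ^+ 2) *+ 2.
  rewrite mulrnBl mulr2n [X in _ = _ - X]mulr2n expr2.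
  rewrite {2}[(\sum_i a i ^+ 2) * _]mulrC !mulr_suml -!big_split -sumrB /=.
  apply: eq_bigr => i _; rewrite !mulr_sumr -!big_split -sumrB /=.
  by apply: eq_bigr => j _; ring.
rewrite -subr_ge0 -(pmulrn_lge0 _ (ltn0Sn 1)) -lagrange.
by apply: sumr_ge0 => i _; apply: sumr_ge0 => j _; apply: sqr_ge0.
Qed.

Definition frob2 m n (A : 'M[R]_(m, n)) : R := \sum_i \sum_j A i j ^+ 2.
Definition frob m n (A : 'M[R]_(m, n)) : R := Num.sqrt (frob2 A).

Lemma frob2_ge0 m n (A : 'M[R]_(m, n)) : 0 <= frob2 A.
Proof. by apply: sumr_ge0 => i _; apply: sumr_ge0 => j _; apply: sqr_ge0. Qed.

Lemma frob_ge0 m n (A : 'M[R]_(m, n)) : 0 <= frob A.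
Proof. exact: sqrtr_ge0. Qed.

Lemma sqr_frob m n (A : 'M[R]_(m, n)) : frob A ^+ 2 = frob2 A.
Proof. by rewrite sqr_sqrtr// frob2_ge0. Qed.

Lemma frob2_pair m n (A : 'M[R]_(m, n)) :
  frob2 A = \sum_(p : 'I_m * 'I_n) A p.1 p.2 ^+ 2.
Proof. by rewrite /frob2 pair_bigA. Qed.

Lemma frob2T m n (A : 'M[R]_(m, n)) : frob2 A^T = frob2 A.
Proof.
rewrite /frob2 exchange_big; apply: eq_bigr => i _; apply: eq_bigr => j _.
by rewrite mxE.
Qed.

Lemma frobT m n (A : 'M[R]_(m, n)) : frob A^T = frob A.
Proof. by rewrite /frob frob2T. Qed.

Lemma frob2Z m n a (A : 'M[R]_(m, n)) : frob2 (a *: A) = a ^+ 2 * frob2 A.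
Proof.
rewrite /frob2 mulr_sumr; apply: eq_bigr => i _; rewrite mulr_sumr.
by apply: eq_bigr => j _; rewrite mxE exprMn.
Qed.

Lemma frobZ m n a (A : 'M[R]_(m, n)) : frob (a *: A) = `|a| * frob A.
Proof. by rewrite /frob frob2Z sqrtrM ?sqr_ge0// sqrtr_sqr. Qed.

Lemma frobN m n (A : 'M[R]_(m, n)) : frob (- A) = frob A.
Proof. by rewrite -scaleN1r frobZ normrN1 mul1r. Qed.

Lemma frob0 m n : frob (0 : 'M[R]_(m, n)) = 0.
Proof. by rewrite -[X in frob X](scale0r 0) frobZ normr0 mul0r. Qed.

Lemma frob2M m n p (A : 'M[R]_(m, n)) (B : 'M[R]_(n, p)) :
  frob2 (A *m B) <= frob2 A * frob2 B.
Proof.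
rewrite -(frob2T B) {1 2}/frob2 mulr_suml; apply: ler_sum => i _.
rewrite mulr_sumr; apply: ler_sum => j _; rewrite mxE.
apply: le_trans (cauchy_schwarz _ _) _; rewrite le_eqVlt; apply/orP; left; apply/eqP; congr (_ * _).
by apply: eq_bigr => k _; rewrite mxE.
Qed.

Lemma frobM m n p (A : 'M[R]_(m, n)) (B : 'M[R]_(n, p)) :
  frob (A *m B) <= frob A * frob B.
Proof. by rewrite /frob -sqrtrM ?frob2_ge0// ler_wsqrtr// frob2M. Qed.

Lemma frobD m n (A B : 'M[R]_(m, n)) : frob (A + B) <= frob A + frob B.
Proof.
rewrite -(@ler_pXn2r _ 2)// ?nnegrE ?addr_ge0 ?frob_ge0//.
rewrite sqrrD !sqr_frob.
have -> : frob2 (A + B) =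
    frob2 A + (\sum_(p : 'I_m * 'I_n) A p.1 p.2 * B p.1 p.2) *+ 2 + frob2 B.
  rewrite !frob2_pair -sumrMnl -!big_split /=.
  by apply: eq_bigr => p _; rewrite !mxE sqrrD.
rewrite lerD2r lerD2l lerMn2r /=.
apply: le_trans (ler_norm _) _.
rewrite -(@ler_pXn2r _ 2)// ?nnegrE ?mulr_ge0 ?frob_ge0//.
rewrite real_normK ?num_real// exprMn !sqr_frob !frob2_pair.
exact: cauchy_schwarz.
Qed.

Lemma frobB m n (A B : 'M[R]_(m, n)) : frob (A - B) <= frob A + frob B.
Proof. by rewrite -(frobN B) frobD. Qed.

Lemma entry_le_frob m n (A : 'M[R]_(m, n)) i j : `|A i j| <= frob A.
Proof.
rewrite -(@ler_pXn2r _ 2)// ?nnegrE ?frob_ge0// sqr_frob real_normK ?num_real//.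
rewrite /frob2 (bigD1 i)//= (bigD1 j)//= -addrA lerDl addr_ge0//.
  by apply: sumr_ge0 => k _; apply: sqr_ge0.
by apply: sumr_ge0 => k _; apply: sumr_ge0 => k' _; apply: sqr_ge0.
Qed.

Lemma frob_le_sum m n (A : 'M[R]_(m, n)) : frob A <= \sum_i \sum_j `|A i j|.
Proof.
rewrite -(@ler_pXn2r _ 2)// ?nnegrE ?frob_ge0//; last first.
  by apply: sumr_ge0 => i _; apply: sumr_ge0.
rewrite sqr_frob pair_bigA frob2_pair /= expr2 mulr_suml.
apply: ler_sum => p _; rewrite -real_normK ?num_real// expr2 ler_wpM2l//.
by rewrite (bigD1 p)//= lerDl sumr_ge0.
Qed.

(** The divisor is a successor so that the conclusion is strict and the division makes sense for
    matrices without entries. *)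
Lemma frob_lt_entries m n (A : 'M[R]_(m, n)) (e : R) : 0 < e ->
  (forall i j, `|A i j| <= e / ((m * n).+1)%:R) -> frob A < e.
Proof.
move=> e0 Ae; apply: le_lt_trans (frob_le_sum A) _.
apply: (@le_lt_trans _ _ (\sum_(i < m) \sum_(j < n) e / (m * n).+1%:R)).
  by apply: ler_sum => i _; apply: ler_sum => j _; exact: Ae.
rewrite big_const iter_addr_0 card_ord big_const iter_addr_0 card_ord.
rewrite -mulrnA mulnC -[X in X < _]mulr_natr -[X in X < _]mulrA gtr_pMr//.
by rewrite mulrC ltr_pdivrMr// mul1r ltr_nat.
Qed.

Lemma sqnorm_frob n (v : 'cV[R]_n) : sqnorm v = frob2 v.
Proof. by rewrite /sqnorm /frob2; apply: eq_bigr => i _; rewrite big_ord1. Qed.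

Lemma sqnorm_mx n (v : 'cV[R]_n) : sqnorm v = (v^T *m v) 0 0.
Proof. by rewrite /sqnorm mxE; apply: eq_bigr => i _; rewrite mxE expr2. Qed.

Lemma sqnorm_ge0 n (v : 'cV[R]_n) : 0 <= sqnorm v.
Proof. by apply: sumr_ge0 => i _; apply: sqr_ge0. Qed.

Lemma sqnorm_eq0 n (v : 'cV[R]_n) : (sqnorm v == 0) = (v == 0).
Proof.
apply/eqP/eqP => [|->]; last by rewrite /sqnorm big1// => i _; rewrite mxE expr0n.
move=> v0; apply/matrixP => i j; rewrite ord1 !mxE; apply/eqP.
rewrite -sqrf_eq0; apply/eqP.
by apply: (psumr_eq0P _ v0) => // k _; apply: sqr_ge0.
Qed.

Lemma sqnorm_gt0 n (v : 'cV[R]_n) : (0 < sqnorm v) = (v != 0).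
Proof. by rewrite lt_neqAle sqnorm_ge0 andbT eq_sym sqnorm_eq0. Qed.

Lemma sqnormZ n a (v : 'cV[R]_n) : sqnorm (a *: v) = a ^+ 2 * sqnorm v.
Proof. by rewrite !sqnorm_frob frob2Z. Qed.

End Frobenius.

Section Rayleigh.
Variable R : realType.

Definition qform n (M : 'M[R]_n) (v : 'cV[R]_n) : R := (v^T *m M *m v) 0 0.

Lemma qformZ n (M : 'M[R]_n) a v : qform M (a *: v) = a ^+ 2 * qform M v.
Proof.
rewrite /qform [(a *: v)^T]linearZ -scalemxAr -!scalemxAl scalerA mxE expr2.
by [].
Qed.

Lemma qformE n (M : 'M[R]_n) v :
  qform M v = \sum_i \sum_j v i 0 * M i j * v j 0.
Proof.
rewrite /qform mxE exchange_big; apply: eq_bigr => j _.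
by rewrite mxE mulr_suml; apply: eq_bigr => i _; rewrite mxE.
Qed.

Lemma qformB n (M M' : 'M[R]_n) v : qform (M - M') v = qform M v - qform M' v.
Proof. by rewrite /qform mulmxBr mulmxBl !mxE. Qed.

Lemma qform_scalar n (a : R) (v : 'cV[R]_n) : qform a%:M v = a * sqnorm v.
Proof. by rewrite /qform mul_mx_scalar -scalemxAl mxE sqnorm_mx. Qed.

Lemma qform_symD n (M : 'M[R]_n) v w : M^T = M ->
  qform M (v + w) = qform M v + (w^T *m M *m v) 0 0 *+ 2 + qform M w.
Proof.
move=> Ms; rewrite /qform [(v + w)^T]linearD mulmxDr !mulmxDl.
rewrite [LHS]mxE [X in X + _ = _]mxE [X in _ + X = _]mxE.
have -> : (v^T *m M *m w) 0 0 = (w^T *m M *m v) 0 0.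
  rewrite -[LHS](mxE trmx_key (fun i j => (v^T *m M *m w) j i)).
  by rewrite -/(trmx _) !trmx_mul trmxK Ms mulmxA.
by rewrite mulr2n; ring.
Qed.

Lemma qform_continuous n (M : 'M[R]_n) :
  continuous (fun v : 'rV[R]_n => qform M v^T).
Proof.
rewrite (_ : (fun v : 'rV[R]_n => _) =
   fun v : 'rV[R]_n => \sum_i \sum_j v 0 i * M i j * v 0 j); last first.
  by apply/funext => v; rewrite qformE; under eq_bigr do
    (under eq_bigr do rewrite !mxE).
apply: continuous_big => [|i _]; first exact: add_continuous.
apply: continuous_big => [|j _ v]; first exact: add_continuous.
apply: (@cvgM _ _ (nbhs v)); last exact: coord_continuous.
by apply: (@cvgM _ _ (nbhs v)); [exact: coord_continuous|exact: cvg_cst].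
Qed.

Lemma sqnorm_continuous n : continuous (fun v : 'rV[R]_n => sqnorm v^T).
Proof.
rewrite (_ : (fun v : 'rV[R]_n => _) = fun v : 'rV[R]_n => qform 1%:M v^T).
  exact: qform_continuous.
by apply/funext => v; rewrite qform_scalar mul1r.
Qed.

(** The form attains its minimum on the compact unit sphere, and homogeneity carries the bound to
    all vectors. The dimension is a successor because the sphere is empty in dimension zero. *)
Lemma qform_min n (M : 'M[R]_n.+1) : exists v0 : 'cV[R]_n.+1,
  sqnorm v0 = 1 /\ forall v, qform M v0 * sqnorm v <= qform M v.
Proof.
pose S : set 'rV[R]_n.+1 := [set v | sqnorm v^T = 1].
have S0 : S !=set0.
  exists (delta_mx 0 0); rewrite /S /= /sqnorm (bigD1 0)//= big1 ?addr0.
    by rewrite !mxE eqxx expr1n.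
  by move=> i i0; rewrite !mxE (negbTE i0) andbF expr0n.
have cS : compact S.
  apply: bounded_closed_compact.
    exists 1; split => // x x1 v; rewrite /S /= => v1.
    apply: le_trans _ (ltW x1).
    rewrite /Num.norm/= mx_normrE; apply: bigmax_le => // -[i j] _ /=.
    rewrite -(@ler_pXn2r _ 2)// ?nnegrE// expr1n -v1 real_normK ?num_real//.
    rewrite ord1 /sqnorm (bigD1 j)//= mxE lerDl.
    by apply: sumr_ge0 => k _; apply: sqr_ge0.
  apply: (@closed_comp _ _ (fun v : 'rV[R]_n.+1 => sqnorm v^T) [set 1]).
    by move=> v _; exact: sqnorm_continuous.
  exact: closed_eq.
have [v vS vmin] : exists2 c, c \in S &
    forall t, t \in S -> qform M c^T <= qform M t^T.
  apply: EVT_min_rV => //; apply: continuous_subspaceT.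
  exact: qform_continuous.
exists v^T; rewrite inE in vS; split => // w.
have [->|w0] := eqVneq w 0.
  rewrite -(scale0r 0) sqnormZ qformZ expr0n /= mul0r mulr0 mul0r.
  by [].
have wpos : 0 < sqnorm w by rewrite sqnorm_gt0.
have := vmin (((Num.sqrt (sqnorm w))^-1 *: w)^T); rewrite trmxK inE /S /= trmxK.
rewrite sqnormZ exprVn sqr_sqrtr ?sqnorm_ge0// mulVf ?gt_eqF//.
move/(_ erefl); rewrite qformZ exprVn sqr_sqrtr ?sqnorm_ge0// mulrC.
by rewrite ler_pdivlMr.
Qed.

(** [eigs_in] constrains only the eigenvalues that exist over the reals, so one must be exhibited.
    At a minimiser [v0] of the Rayleigh quotient, [A = M - a%:M] is positive semidefinite and its
    form vanishes at [v0]; moving from [v0] along [A *m v0] keeps the form nonnegative only if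
    [A *m v0 = 0]. *)
Lemma qform_min_eigen n (M : 'M[R]_n.+1) : M^T = M ->
  exists2 a, eigenvalue M a & forall v, a * sqnorm v <= qform M v.
Proof.
move=> Ms; have [v0 [v01 v0min]] := qform_min M.
set a := qform M v0 in v0min; exists a => //.
pose A := M - a%:M.
have As : A^T = A by rewrite /A linearB /= Ms tr_scalar_mx.
have A0 v : 0 <= qform A v by rewrite qformB qform_scalar subr_ge0.
have Av0 : qform A v0 = 0 by rewrite qformB qform_scalar v01 mulr1 subrr.
have key : A *m v0 = 0.
  apply/eqP; rewrite -sqnorm_eq0; apply/eqP/le_anti; rewrite sqnorm_ge0 andbT.
  set s := sqnorm _; set q := qform A (A *m v0).
  have q0 : 0 <= q by exact: A0.
  have ineq t : 0 <= t * s *+ 2 + t ^+ 2 * q.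
    have := A0 (v0 + t *: (A *m v0)).
    rewrite qform_symD// Av0 add0r qformZ -/q.
    rewrite linearZ /= -!scalemxAl -(mulmxA _ A v0) [X in X *+ 2]mxE.
    by rewrite -sqnorm_mx -/s.
  rewrite leNgt; apply/negP => s0.
  (* The parabola of [ineq] has slope [2 s] at the origin. For [q > 0] its minimum, at
     [t = - s / q], is [- s ^+ 2 / q]; for [q = 0] it is a line, negative at [-1]. *)
  have [q00|qn0] := eqVneq q 0.
    by have := ineq (-1); rewrite q00 mulr0 addr0 mulN1r mulNrn oppr_ge0 pmulrn_lle0// leNgt s0.
  have qp : 0 < q by rewrite lt_neqAle eq_sym qn0.
  have := ineq (- s / q).
  have -> : - s / q * s *+ 2 + (- s / q) ^+ 2 * q = - (s ^+ 2 / q).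
    by rewrite mulr2n; field; rewrite gt_eqF.
  by rewrite oppr_ge0 leNgt divr_gt0// exprn_gt0.
apply/eigenvalueP; exists v0^T; last first.
  by rewrite -(inj_eq trmx_inj) trmxK trmx0 -sqnorm_eq0 v01 oner_eq0.
apply: trmx_inj; rewrite trmx_mul trmxK Ms linearZ /= trmxK.
by apply/eqP; rewrite -subr_eq0 -mul_scalar_mx -mulmxBl -/A key.
Qed.

(** The extreme values of the Rayleigh quotient are eigenvalues: the lower bound uses the minimum
    for [M], the upper bound the minimum for [- M]. *)
Lemma eigs_in_qform n (M : 'M[R]_n) a b v : M^T = M -> eigs_in M a b ->
  v != 0 -> a * sqnorm v < qform M v < b * sqnorm v.
Proof.
case: n M v => [|n] M v Ms ev v0.
  by case/eqP: v0; apply/matrixP => -[].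
have vp : 0 < sqnorm v by rewrite sqnorm_gt0.
have [x xe xmin] := qform_min_eigen Ms.
have [|y ye ymin] := @qform_min_eigen _ (- M); first by rewrite linearN /= Ms.
have yb : - y < b.
  have /ev/andP[_ //] : eigenvalue M (- y).
  case/eigenvalueP: ye => u uM u0; apply/eigenvalueP; exists u => //.
  by rewrite scaleNr -uM mulmxN opprK.
have /andP[ax _] := ev _ xe.
apply/andP; split.
  by apply: lt_le_trans (xmin v); rewrite ltr_pM2r.
have := ymin v; rewrite -[- M]sub0r qformB.
have -> : qform 0 v = 0 by rewrite /qform mulmx0 mul0mx mxE.
rewrite sub0r lerNr => /le_lt_trans; apply.
by rewrite -mulNr ltr_pM2r.
Qed.

Lemma eigs_in_qform_le n (M : 'M[R]_n) a b v : M^T = M -> eigs_in M a b ->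
  a * sqnorm v <= qform M v <= b * sqnorm v.
Proof.
move=> Ms ev; have [->|v0] := eqVneq v 0; last first.
  by have /andP[/ltW -> /ltW ->] := eigs_in_qform Ms ev v0.
by rewrite -(scale0r 0) sqnormZ qformZ expr0n /= !mul0r !mulr0 lexx.
Qed.

Lemma posdef_lower_bound n (M : 'M[R]_n) : posdef M ->
  exists2 c, 0 < c & forall v, c * sqnorm v <= qform M v.
Proof.
case: n M => [|n] M [Ms Mp].
  exists 1 => // v; have -> : v = 0 by apply/matrixP => -[].
  by rewrite -(scale0r 0) sqnormZ qformZ expr0n /= !mul0r mulr0.
have [v0 [v01 vmin]] := qform_min M.
by exists (qform M v0) => //; apply: Mp; rewrite -sqnorm_eq0 v01 oner_eq0.
Qed.

Lemma qform_unitmx n (M : 'M[R]_n) : (forall v, v != 0 -> qform M v != 0) ->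
  M \in unitmx.
Proof.
move=> Mn; rewrite -row_free_unit -kermx_eq0; apply/eqP/row_matrixP => i.
rewrite row0; apply/eqP; apply: contraT => u0.
have /Mn /eqP[] : (row i (kermx M))^T != 0.
  by apply: contraNneq u0 => u0; rewrite -[row _ _]trmxK u0 trmx0.
by rewrite /qform trmxK -row_mul mulmx_ker row0 mul0mx mxE.
Qed.

Definition mxdot m n (A B : 'M[R]_(m, n)) : R := \sum_i \sum_j A i j * B i j.

Lemma mxdot_trace m n (A B : 'M[R]_(m, n)) : mxdot A B = \tr (A^T *m B).
Proof.
rewrite /mxdot exchange_big /mxtrace; apply: eq_bigr => j _.
by rewrite mxE; apply: eq_bigr => i _; rewrite mxE.
Qed.

Lemma mxdot_le m n (A B : 'M[R]_(m, n)) : mxdot A B <= frob A * frob B.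
Proof.
apply: le_trans (ler_norm _) _.
rewrite -(@ler_pXn2r _ 2)// ?nnegrE ?mulr_ge0 ?frob_ge0//.
rewrite real_normK ?num_real// exprMn !sqr_frob !frob2_pair /mxdot pair_bigA.
exact: cauchy_schwarz.
Qed.

Lemma trace_qform m n (S : 'M[R]_m) (A : 'M[R]_(m, n)) mu :
  (forall v, mu * sqnorm v <= qform S v) ->
  mu * frob2 A <= \tr (A^T *m S *m A).
Proof.
move=> Smu; rewrite /mxtrace -frob2T {1}/frob2 mulr_sumr.
apply: ler_sum => j _; apply: le_trans (_ : qform S (col j A) <= _).
  apply: le_trans (Smu _); rewrite le_eqVlt; apply/orP; left; apply/eqP.
  by congr (_ * _); apply: eq_bigr => i _; rewrite !mxE.
rewrite /qform tr_col -row_mul !mxE le_eqVlt; apply/orP; left; apply/eqP.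
by apply: eq_bigr => k _; rewrite !mxE; congr (_ * _); apply: eq_bigr => k' _; rewrite !mxE.
Qed.

Lemma qform_le_frob n (M : 'M[R]_n) v : `|qform M v| <= frob M * sqnorm v.
Proof.
have -> : qform M v = mxdot v (M *m v).
  by rewrite mxdot_trace /qform !mulmxA /mxtrace big_ord1.
rewrite ler_norml; apply/andP; split.
  rewrite lerNl; have -> : - mxdot v (M *m v) = mxdot v (- (M *m v)).
    rewrite /mxdot -sumrN; apply: eq_bigr => i _; rewrite -sumrN.
    by apply: eq_bigr => j _; rewrite [in RHS]mxE mulrN.
  apply: le_trans (mxdot_le _ _) _; rewrite frobN.
  apply: le_trans (_ : frob v * (frob M * frob v) <= _).
    by rewrite ler_wpM2l ?frob_ge0 ?frobM.
  by rewrite mulrCA -expr2 sqr_frob sqnorm_frob.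
apply: le_trans (mxdot_le _ _) _.
apply: le_trans (_ : frob v * (frob M * frob v) <= _).
  by rewrite ler_wpM2l ?frob_ge0 ?frobM.
by rewrite mulrCA -expr2 sqr_frob sqnorm_frob.
Qed.

End Rayleigh.

(** * Measurability of matrix-valued maps *)

Section MeasurableMatrix.
Variable R : realType.

Lemma measurable_inv : measurable_fun setT (fun x : R => x^-1).
Proof.
rewrite -(setUv [set (0 : R)]); apply/measurable_funU => //.
  exact: measurableC.
split; first by apply: measurable_fun_set1.
apply: open_continuous_measurable_fun => [|x /set_mem /= x0].
  exact/closed_openC/closed_eq.
by apply: inv_continuous; apply/eqP.
Qed.

Lemma open_frobP m n (O : set 'M[R]_(m, n)) :
  (forall A, O A -> exists2 e, 0 < e & forall B, frob (B - A) < e -> O B) ->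
  open O.
Proof.
move=> OO; rewrite openE => A /OO[e e0 Oe]; apply/nbhs_ballP.
exists (e / (m * n).+1%:R) => /=; first by rewrite divr_gt0.
move=> B [_ AB]; apply: Oe; apply: frob_lt_entries => // i j.
by rewrite !mxE distrC ltW//; exact: AB.
Qed.

Variables (d : measure_display) (T : measurableType d).

(** Sublevel sets generate the Borel field. The lemma also serves on types that carry a
    sub-sigma-field, where sublevel sets are what the generators and [Gmeasurable] provide. *)
Lemma measurable_fun_le_cst (f : T -> R) :
  (forall a, measurable [set w | f w <= a]) -> measurable_fun setT f.
Proof.
move=> fa; apply: (measurability _ (RGenOInfty.measurableE R)).
move=> /= _ [_ [a ->] <-]; rewrite setTI -[X in measurable X]setCK.
apply: measurableC; rewrite (_ : ~` _ = [set w | f w <= a])//.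
apply/seteqP; split => w /=; rewrite in_itv /= andbT.
  by move=> /negP; rewrite -leNgt.
by move=> ?; apply/negP; rewrite -leNgt.
Qed.

Lemma measurable_le_cst (f : T -> R) a :
  measurable_fun setT f -> measurable [set w | f w <= a].
Proof.
move=> mf; rewrite -[X in measurable X]setTI.
exact: (measurable_fun_ler mf (measurable_cst a) measurableT (Y := [set true])).
Qed.

Lemma measurable_lt_cst (f : T -> R) a :
  measurable_fun setT f -> measurable [set w | f w < a].
Proof.
move=> mf; rewrite -[X in measurable X]setTI.
exact: (measurable_fun_ltr mf (measurable_cst a) measurableT (Y := [set true])).
Qed.

(** Entrywise, so that it makes sense over any sigma-field on the source without fixing one on
    matrices. *)
Definition mfmx m n (Y : T -> 'M[R]_(m, n)) : Prop :=
  forall i j, measurable_fun setT (fun w => Y w i j).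

Lemma mfmx_cst m n (A : 'M[R]_(m, n)) : mfmx (fun _ => A).
Proof. by move=> i j; exact: measurable_cst. Qed.

Lemma mfmx_entries m n (F : T -> 'I_m -> 'I_n -> R) :
  (forall i j, measurable_fun setT (fun w => F w i j)) ->
  mfmx (fun w => \matrix_(i, j) F w i j).
Proof. by move=> mF i j; under eq_fun do rewrite mxE; exact: mF. Qed.

Lemma mfmx_tr m n (Y : T -> 'M[R]_(m, n)) : mfmx Y -> mfmx (fun w => (Y w)^T).
Proof. by move=> mY i j; under eq_fun do rewrite mxE; exact: mY. Qed.

Lemma mfmx_add m n (Y Z : T -> 'M[R]_(m, n)) :
  mfmx Y -> mfmx Z -> mfmx (fun w => Y w + Z w).
Proof.
by move=> mY mZ i j; under eq_fun do rewrite mxE; exact: measurable_funD.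
Qed.

Lemma mfmx_scale m n (a : T -> R) (Y : T -> 'M[R]_(m, n)) :
  measurable_fun setT a -> mfmx Y -> mfmx (fun w => a w *: Y w).
Proof.
by move=> ma mY i j; under eq_fun do rewrite mxE; exact: measurable_funM.
Qed.

Lemma mfmx_opp m n (Y : T -> 'M[R]_(m, n)) : mfmx Y -> mfmx (fun w => - Y w).
Proof.
move=> mY i j; under eq_fun do rewrite mxE.
by apply: measurableT_comp => //; exact: mY.
Qed.

Lemma mfmx_sub m n (Y Z : T -> 'M[R]_(m, n)) :
  mfmx Y -> mfmx Z -> mfmx (fun w => Y w - Z w).
Proof. by move=> mY mZ; apply: mfmx_add => //; exact: mfmx_opp. Qed.

Lemma mfmx_mul m n p (Y : T -> 'M[R]_(m, n)) (Z : T -> 'M[R]_(n, p)) :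
  mfmx Y -> mfmx Z -> mfmx (fun w => Y w *m Z w).
Proof.
move=> mY mZ i j; under eq_fun do rewrite mxE.
by apply: measurable_sum => k; exact: measurable_funM.
Qed.

Lemma mfmx_sum m n (I : Type) (s : seq I) (Y : I -> T -> 'M[R]_(m, n)) :
  (forall k, mfmx (Y k)) -> mfmx (fun w => \sum_(k <- s) Y k w).
Proof.
move=> mY i j; under eq_fun do rewrite summxE.
by apply: measurable_sum => k; exact: mY.
Qed.

Lemma mfmx_det n (Y : T -> 'M[R]_n) : mfmx Y ->
  measurable_fun setT (fun w => \det (Y w)).
Proof.
move=> mY; apply: measurable_sum => s; apply: measurable_funM => //.
by apply: measurable_prod => i _; exact: mY.
Qed.

Lemma mfmx_inv n (Y : T -> 'M[R]_n) : mfmx Y -> mfmx (fun w => invmx (Y w)).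
Proof.
move=> mY i j.
(* [invmx] returns its argument on singular matrices, hence the first branch; the second is Cramer's
   rule. *)
rewrite (_ : (fun w => _) = fun w => if \det (Y w) == 0 then Y w i j else
    (\det (Y w))^-1 * cofactor (Y w) j i); last first.
  apply/funext => w; rewrite /invmx unitmxE unitfE.
  by case: eqP => //= _; rewrite !mxE.
apply: measurable_fun_ifT; last 2 first.
- exact: mY.
- apply: measurable_funM.
    exact: (measurableT_comp measurable_inv (mfmx_det mY)).
  rewrite /cofactor; apply: measurable_funM => //.
  by apply: mfmx_det => k k'; under eq_fun do rewrite !mxE; exact: mY.
apply: measurable_fun_eqr => //; exact: mfmx_det.
Qed.

(** An open set of matrices is a countable union of entrywise balls with rational centres and radii
    [1 / (k + 1)], and the preimage of such a ball is a finite intersection of measurable sets. *)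
Lemma mfmx_open m n (Y : T -> 'M[R]_(m, n)) (O : set 'M[R]_(m, n)) :
  mfmx Y -> open O -> measurable (Y @^-1` O).
Proof.
move=> mY oO.
pose c (q : 'M[rat]_(m, n)) : 'M[R]_(m, n) := map_mx ratr q.
pose F (p : 'M[rat]_(m, n) * nat) : set T :=
  if `[< ball (c p.1) p.2.+1%:R^-1 `<=` O >]
  then [set w | forall i j, `|c p.1 i j - Y w i j| < p.2.+1%:R^-1] else set0.
suff -> : Y @^-1` O = \bigcup_p F p.
  apply: countable_bigcupT_measurable => [|p]; first exact: countableP.
  rewrite /F; case: asboolP => // _.
  rewrite (_ : [set w | _] = \bigcap_(i in [set: 'I_m]) \bigcap_(j in [set: 'I_n])
     [set w | `|c p.1 i j - Y w i j| < p.2.+1%:R^-1]); last first.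
    by apply/seteqP; split => [w H i _ j _|w H i j]; [exact: H|exact: H].
  apply: fin_bigcap_measurable => // i _; apply: fin_bigcap_measurable => // j _.
  apply: measurable_lt_cst; apply: measurableT_comp => //.
  by apply: measurable_funB => //; exact: mY.
apply/seteqP; split => [w Ow|w [p _]]; last first.
  rewrite /F; case: asboolP => [Op H|_ []].
  by apply: Op; split => // i j; exact: H.
have /nbhs_ballP[e e0 Oe] := oO _ Ow.
have [k ke] : exists k, k.+1%:R^-1 < e / 2.
  exists (Num.truncn (e / 2)^-1); rewrite invf_plt ?posrE ?divr_gt0//.
  by rewrite truncnS_gt.
have [q qY] : exists q : 'M[rat]_(m, n), forall i j,
    `|c q i j - Y w i j| < k.+1%:R^-1.
  have /= Hq i j : exists q : rat, `|ratr q - Y w i j| < k.+1%:R^-1.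
    have [|q] := @rat_in_itvoo R (Y w i j - k.+1%:R^-1) (Y w i j + k.+1%:R^-1).
      by rewrite ltrD2l gtrN// invr_gt0.
    by rewrite in_itv /= => H; exists q; rewrite distrC ltr_distlC.
  exists (\matrix_(i, j) xget 0 [set q : rat | `|ratr q - Y w i j| < k.+1%:R^-1]).
  move=> i j; rewrite !mxE; case: xgetP => [q -> //|].
  by have [q qq] := Hq i j => /(_ q).
exists (q, k) => //; rewrite /F; case: asboolP => //=; case=> B [_ qB].
apply: Oe; split => // i j; rewrite /ball /=.
rewrite (le_lt_trans (ler_distD (c q i j) _ _))// (splitr e) ltrD//.
  by rewrite distrC (lt_trans (qY i j)).
by rewrite (lt_trans _ ke)//; exact: qB.
Qed.

Lemma mfmx_closed m n (Y : T -> 'M[R]_(m, n)) (F : set 'M[R]_(m, n)) :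
  mfmx Y -> closed F -> measurable (Y @^-1` F).
Proof.
move=> mY cF; rewrite -[F]setCK preimage_setC; apply: measurableC.
exact: (mfmx_open mY (closed_openC cF)).
Qed.

Lemma mfmx_continuous m n (Y : T -> 'M[R]_(m, n)) (g : 'M[R]_(m, n) -> R) :
  mfmx Y -> continuous g -> measurable_fun setT (fun w => g (Y w)).
Proof.
move=> mY /continuousP cg; apply: (measurability _ (RGenOpens.measurableE R)).
move=> /= _ [_ [a [b ->]] <-]; rewrite setTI.
have oO : open (g @^-1` `]a, b[) by apply: cg; exact: interval_open.
exact: (mfmx_open mY oO).
Qed.

Lemma mfmx_frob m n (Y : T -> 'M[R]_(m, n)) : mfmx Y ->
  measurable_fun setT (fun w => frob2 (Y w)).
Proof.
move=> mY; apply: measurable_sum => i; apply: measurable_sum => j.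
by apply: measurable_funX; exact: mY.
Qed.

End MeasurableMatrix.

(** * Square roots of positive definite matrices: stability, closedness, measurability *)

Section MeasurableRoot.
Variable R : realType.

(** With [D = S - S'], the difference of the squares is [S D + D S']. Its inner product with [D] is
    at least [2 mu] times the squared norm of [D], and Cauchy-Schwarz lets one factor [frob D] be
    divided out. *)
Lemma sqrtmx_lipschitz n (S S' : 'M[R]_n) mu : S^T = S -> S'^T = S' -> 0 < mu ->
  (forall v, mu * sqnorm v <= qform S v) ->
  (forall v, mu * sqnorm v <= qform S' v) ->
  frob (S - S') <= frob (S *m S - S' *m S') / mu.
Proof.
move=> Ss Ss' mu0 Smu Smu'; set D := S - S'.
have Ds : D^T = D by rewrite /D linearB /= Ss Ss'.
have -> : S *m S - S' *m S' = S *m D + D *m S'.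
  by rewrite /D mulmxBr mulmxBl addrA subrK.
set E := _ + _.
have : mu * frob2 D + mu * frob2 D <= frob D * frob E.
  apply: le_trans (mxdot_le D E); rewrite mxdot_trace Ds mulmxDr linearD /=.
  apply: lerD; first by rewrite -{2}Ds mulmxA; apply: trace_qform.
  by rewrite mxtrace_mulC -{2}Ds; exact: trace_qform.
have [D0|Dn0] := eqVneq (frob D) 0.
  by rewrite D0 divr_ge0 ?frob_ge0// ltW.
have Dp : 0 < frob D by rewrite lt_neqAle eq_sym Dn0 frob_ge0.
rewrite -sqr_frob => H; rewrite ler_pdivlMr//.
rewrite -(ler_pM2l Dp); apply: le_trans H.
rewrite mulrA -expr2 mulrC lerDl mulr_ge0 ?sqr_ge0//; exact: ltW.
Qed.

Lemma qform_continuous_mx n (v : 'cV[R]_n) :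
  continuous (fun M : 'M[R]_n => qform M v).
Proof.
rewrite (_ : (fun M : 'M[R]_n => _) =
   fun M : 'M[R]_n => \sum_i \sum_j v i 0 * M i j * v j 0); last first.
  by apply/funext => M; rewrite qformE.
apply: continuous_big => [|i _]; first exact: add_continuous.
apply: continuous_big => [|j _ M]; first exact: add_continuous.
apply: (@cvgM _ _ (nbhs M)); last exact: cvg_cst.
by apply: (@cvgM _ _ (nbhs M)); [exact: cvg_cst|exact: coord_continuous].
Qed.

Lemma mulmx_entry_continuous n i j :
  continuous (fun M : 'M[R]_n => (M *m M) i j).
Proof.
rewrite (_ : (fun M : 'M[R]_n => _) = fun M : 'M[R]_n => \sum_k M i k * M k j).
  apply: continuous_big => [|k _ M]; first exact: add_continuous.
  by apply: (@cvgM _ _ (nbhs M)); exact: coord_continuous.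
by apply/funext => M; rewrite mxE.
Qed.

(** Roots whose squares approach [P] form a Cauchy sequence by [sqrtmx_lipschitz], because they
    share the lower bound [mu]; their limit inherits symmetry, this bound and membership in [C], and
    its square is [P]. *)
Lemma sqrtmx_closed n (mu : R) (C : set 'M[R]_n) : 0 < mu -> closed C ->
  closed [set P : 'M[R]_n | exists S : 'M[R]_n, [/\ S^T = S,
    forall v, mu * sqnorm v <= qform S v, S *m S = P & C S]].
Proof.
move=> mu0 cC; set F := [set P | _]; rewrite -[F]setCK; apply: open_closedC.
apply: open_frobP => P FP; apply: contrapT => nP; apply: FP.
have near_F k : exists S : 'M[R]_n, [/\ S^T = S,
    forall v, mu * sqnorm v <= qform S v, frob (S *m S - P) < k.+1%:R^-1 & C S].
  apply: contrapT => nS; apply: nP; exists k.+1%:R^-1; first by rewrite invr_gt0.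
  by move=> B BP [S [Ss Smu SB CS]]; apply: nS; exists S; rewrite SB.
have [S HS] := choice near_F.
have SL k l : frob (S k - S l) <= (k.+1%:R^-1 + l.+1%:R^-1) / mu.
  have [Ss Smu SP _] := HS k; have [Ss' Smu' SP' _] := HS l.
  apply: le_trans (sqrtmx_lipschitz Ss Ss' mu0 Smu Smu') _.
  rewrite ler_pM2r ?invr_gt0//.
  have -> : S k *m S k - S l *m S l = (S k *m S k - P) - (S l *m S l - P).
    by rewrite opprB addrA subrK.
  by apply: le_trans (frobB _ _) _; apply: lerD; apply: ltW.
have cS i j : cvgn (fun k => S k i j).
  apply/cauchy_cvgP/cauchy_ballP => e e0; near_simpl.
  near=> k l => /=.
  rewrite /ball /= -[S k i j - _](mxE addmx_key (fun i j => S k i j - S l i j)).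
  have -> : (\matrix[addmx_key]_(i, j) (S k i j - S l i j)) i j = (S k - S l) i j.
    by rewrite !mxE.
  apply: le_lt_trans (entry_le_frob _ _ _) _; apply: le_lt_trans (SL _ _) _.
  rewrite ltr_pdivrMr// [_ * mu](splitr (e * mu)); apply: ltrD.
    near: k; exists (Num.truncn (e * mu / 2)^-1) => // k /= kn.
    rewrite invf_plt ?posrE ?divr_gt0 ?mulr_gt0//.
    by rewrite (lt_le_trans (truncnS_gt _))// ler_nat.
  near: l; exists (Num.truncn (e * mu / 2)^-1) => // k /= kn.
  rewrite invf_plt ?posrE ?divr_gt0 ?mulr_gt0//.
  by rewrite (lt_le_trans (truncnS_gt _))// ler_nat.
pose S0 : 'M[R]_n := \matrix_(i, j) limn (fun k => S k i j).
have SS0 : S @ \oo --> S0.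
  apply/cvg_ballP => e e0.
  have H i j : \forall k \near \oo, ball (S0 i j) e (S k i j).
    by rewrite /S0 mxE; apply: (cvg_ball (cS i j)).
  have {}H : \forall k \near \oo, forall i j, ball (S0 i j) e (S k i j).
    apply: filter_forall => i; apply: filter_forall => j; exact: H.
  by apply: filterS H => k H; split.
exists S0; split.
- apply/matrixP => i j; rewrite !mxE.
  have -> // : (fun k => S k j i) = (fun k => S k i j).
  by apply/funext => k; have [Ss _ _ _] := HS k; rewrite -[in LHS]Ss mxE.
- move=> v; apply: (@cvgr_to_ge _ \oo _ _ (fun k => qform (S k) v) (qform S0 v)).
    exact: (@continuous_cvg nat _ _ \oo _ S (fun M => qform M v) S0
      (@qform_continuous_mx n v S0) SS0).
  by near=> k; have [_ + _ _] := HS k; exact.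
- apply/matrixP => i j.
  have H1 : (S k *m S k) i j @[k --> \oo] --> (S0 *m S0) i j.
    exact: (@continuous_cvg nat _ _ \oo _ S (fun M : 'M[R]_n => (M *m M) i j) S0
      (@mulmx_entry_continuous n i j S0) SS0).
  have H2 : (S k *m S k) i j @[k --> \oo] --> P i j.
    apply/cvgrPdist_lt => e e0; near=> k; rewrite distrC.
    have -> : (S k *m S k) i j - P i j = (S k *m S k - P) i j by rewrite !mxE.
    apply: le_lt_trans (entry_le_frob _ _ _) _.
    have [_ _ SP _] := HS k; apply: lt_trans SP _.
    near: k; exists (Num.truncn e^-1) => // k /= kn.
    rewrite invf_plt ?posrE//.
    by rewrite (lt_le_trans (truncnS_gt _))// ler_nat.
  by apply: (cvg_unique _ H1 H2).
- apply: (@closed_cvg _ _ \oo _ S C cC _ S0 SS0).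
  by near=> k; have [] := HS k.
Unshelve. all: by end_near. Qed.

(** Positive definite roots are unique, so the choice made by [isqrtmx] is immaterial whenever a
    root exists. *)
Lemma isqrtmxP n (M S : 'M[R]_n) : posdef S -> S *m S *m M = 1%:M ->
  isqrtmx M = S.
Proof.
move=> Sp SM; rewrite /isqrtmx; case: xgetP => [S' _ [Sp' SM']|/(_ S)[]//].
have SS : S *m S = S' *m S'.
  have [_ Mu] := mulmx1_unit SM.
  by rewrite -[LHS](mulmxK Mu) SM -[RHS](mulmxK Mu) SM'.
have [c c0 Sc] := posdef_lower_bound Sp.
have [c' c0' Sc'] := posdef_lower_bound Sp'.
apply/eqP; rewrite -subr_eq0; apply/eqP/matrixP => i j; rewrite [RHS]mxE.
apply/eqP; rewrite -normr_le0; apply: le_trans (entry_le_frob _ _ _) _.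
have m0 : 0 < Num.min c c' by rewrite lt_min c0.
have := sqrtmx_lipschitz (proj1 Sp') (proj1 Sp) m0.
rewrite SS subrr frob0 mul0r; apply => v.
  by apply: le_trans (Sc' v); rewrite ler_wpM2r ?sqnorm_ge0// ge_min lexx orbT.
by apply: le_trans (Sc v); rewrite ler_wpM2r ?sqnorm_ge0// ge_min lexx.
Qed.

Variables (d : measure_display) (T : measurableType d).

(* Needed because the outside alpha drops out of [ddotRd] only where the Gram
   matrices are invertible. *)
Lemma mfmx_isqrtmx n (M : T -> 'M[R]_n) : mfmx M ->
  mfmx (fun w => isqrtmx (M w)).
Proof.
move=> mM i j; pose P w := invmx (M w).
have mP : mfmx P by exact: mfmx_inv.
(* With the fixed bound [1 / (k + 1)] the condition is closed in the matrix; the union over [k]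
   exhausts the positive definite roots of [invmx (M w)]. *)
pose F (k : nat) (C : set 'M[R]_n) := [set P : 'M[R]_n |
  exists S : 'M[R]_n, [/\ S^T = S,
    forall v, k.+1%:R^-1 * sqnorm v <= qform S v, S *m S = P & C S]].
have mF C : closed C -> measurable (\bigcup_k (P @^-1` F k C)).
  move=> cC; apply: bigcupT_measurable => k; apply: mfmx_closed => //.
  by apply: sqrtmx_closed; rewrite ?invr_gt0.
have FE C w : (\bigcup_k (P @^-1` F k C)) w <->
    exists S, [/\ posdef S, S *m S *m M w = 1%:M & C S].
  split.
    move=> [k _ [S [Ss Sk SP CS]]]; exists S; split => //.
      split => // v v0; apply: lt_le_trans (Sk v).
      by rewrite mulr_gt0 ?invr_gt0// sqnorm_gt0.
    have Su : S \in unitmx.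
      apply: qform_unitmx => v v0; rewrite gt_eqF//; apply: lt_le_trans (Sk v).
      by rewrite mulr_gt0 ?invr_gt0// sqnorm_gt0.
    have : invmx (M w) \in unitmx by rewrite -/(P w) -SP unitmx_mul Su.
    by rewrite unitmx_inv => Mu; rewrite SP mulVmx.
  move=> [S [Sp SM CS]]; have [c c0 Sc] := posdef_lower_bound Sp.
  exists (Num.truncn c^-1) => //; exists S; split => //; first by case: Sp.
    move=> v; apply: le_trans (Sc v); rewrite ler_wpM2r ?sqnorm_ge0// ltW//.
    by rewrite invf_plt ?posrE// truncnS_gt.
  have [_ Mu] := mulmx1_unit SM.
  by rewrite /P -[LHS](mulmxK Mu) SM mul1mx.
apply: measurable_fun_le_cst => a.
pose C0 : set 'M[R]_n := [set S | S i j <= a].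
have cC0 : closed C0.
  apply: (@closed_comp _ _ (fun S : 'M[R]_n => S i j) [set x | x <= a]).
    by move=> S _; exact: coord_continuous.
  exact: closed_le.
(* Where no root exists, [isqrtmx] takes its default value 0, whose entries are at most [a] exactly
   when [0 <= a]. *)
rewrite (_ : [set w | _] = (\bigcup_k (P @^-1` F k C0)) `|`
    (if 0 <= a then ~` (\bigcup_k (P @^-1` F k setT)) else set0)).
  apply: measurableU; first exact: mF.
  by case: ifP => // _; apply: measurableC; apply: mF; exact: closedT.
apply/seteqP; split => [w /= wa|w [/FE[S [Sp SM SC]]|]].
- have [[S [Sp SM _]]|nS] := pselect (exists S, [/\ posdef S, S *m S *m M w = 1%:M & setT S]).
    by left; apply/FE; exists S; split => //; rewrite /C0 /= -(isqrtmxP Sp SM).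
  have E0 : isqrtmx (M w) = 0.
    by rewrite /isqrtmx; case: xgetP => [S _ [Sp SM]|//]; case: nS; exists S.
  by right; rewrite E0 mxE in wa; rewrite wa => /FE.
- by rewrite /= (isqrtmxP Sp SM).
- case: ifP => // a0 nF; rewrite /=.
  rewrite /isqrtmx; case: xgetP => [S _ [Sp SM]|_]; last by rewrite mxE.
  by case: nF; apply/FE; exists S.
Qed.

End MeasurableRoot.

(** * Conditional expectations *)

Section ConditionalExpectation.
Variables (R : realType) (d : measure_display) (Om : measurableType d)
  (P : probability Om R).

Definition Ex (f : Om -> R) : R := (\int[P]_w f w)%R.
Definition rintegrable (f : Om -> R) : Prop := P.-integrable setT (EFin \o f).

Lemma rintegrable_measurable (f : Om -> R) : rintegrable f -> measurable_fun setT f.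
Proof. by move=> /measurable_int /measurable_EFinP. Qed.

Lemma rintegrable_le (f g : Om -> R) : measurable_fun setT f -> rintegrable g ->
  (forall w, `|f w| <= `|g w|) -> rintegrable f.
Proof.
move=> mf ig fg; apply: (le_integrable measurableT) ig; first exact/measurable_EFinP.
by move=> w _; rewrite /= lee_fin.
Qed.

Lemma rintegrable_bounded (f : Om -> R) M : measurable_fun setT f ->
  (forall w, `|f w| <= M) -> rintegrable f.
Proof.
move=> mf fM; apply: measurable_bounded_integrable => //.
  by apply: le_lt_trans (probability_le1 P measurableT) _; rewrite ltry.
by exists M; split; [exact: num_real|move=> x Mx w _; exact: le_trans (ltW Mx)].
Qed.

Lemma rintegrableD f g : rintegrable f -> rintegrable g ->
  rintegrable (fun w => f w + g w).
Proof.
move=> iF ig; rewrite /rintegrable.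
rewrite (_ : EFin \o _ = ((EFin \o f) \+ (EFin \o g))%E)//.
exact: integrableD.
Qed.

Lemma rintegrableZ a f : rintegrable f -> rintegrable (fun w => a * f w).
Proof.
move=> iF; rewrite /rintegrable.
rewrite (_ : EFin \o _ = (fun w => a%:E * (f w)%:E)%E)//.
exact: integrableZl.
Qed.

Lemma rintegrableN f : rintegrable f -> rintegrable (fun w => - f w).
Proof.
move=> iF; have := rintegrableZ (-1) iF.
by under eq_fun do rewrite mulN1r.
Qed.

Lemma rintegrableB f g : rintegrable f -> rintegrable g ->
  rintegrable (fun w => f w - g w).
Proof. by move=> iF ig; apply: rintegrableD => //; exact: rintegrableN. Qed.

Lemma rintegrable_cst a : rintegrable (fun _ => a).
Proof. by apply: (@rintegrable_bounded _ `|a|). Qed.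

Lemma rintegrable_sum (I : Type) (s : seq I) (f : I -> Om -> R) :
  (forall i, rintegrable (f i)) -> rintegrable (fun w => \sum_(i <- s) f i w).
Proof.
move=> iF; elim: s => [|i s IH].
  by under eq_fun do rewrite big_nil; exact: rintegrable_cst.
by under eq_fun do rewrite big_cons; exact: rintegrableD.
Qed.

Lemma rintegrableMb (h f : Om -> R) M : measurable_fun setT h -> (forall w, `|h w| <= M) ->
  rintegrable f -> rintegrable (fun w => h w * f w).
Proof.
move=> mh hM iF; apply: (@rintegrable_le _ (fun w => M * f w)).
- by apply: measurable_funM => //; exact: rintegrable_measurable.
- exact: rintegrableZ.
- move=> w; rewrite !normrM ler_wpM2r//; exact: le_trans (hM w) (ler_norm _).
Qed.

Lemma ExD f g : rintegrable f -> rintegrable g ->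
  Ex (fun w => f w + g w) = Ex f + Ex g.
Proof. by move=> iF ig; rewrite /Ex RintegralD. Qed.

Lemma ExB f g : rintegrable f -> rintegrable g ->
  Ex (fun w => f w - g w) = Ex f - Ex g.
Proof. by move=> iF ig; rewrite /Ex RintegralB. Qed.

Lemma ExZ a f : rintegrable f -> Ex (fun w => a * f w) = a * Ex f.
Proof. by move=> iF; rewrite /Ex RintegralZl. Qed.

Lemma Ex_cst a : Ex (fun _ => a) = a.
Proof.
have PT : fine (P setT) = 1 by rewrite (probability_setT P).
by rewrite /Ex Rintegral_cst// -[RHS]mulr1; congr (_ * _).
Qed.

Lemma Ex_sum (I : Type) (s : seq I) (f : I -> Om -> R) :
  (forall i, rintegrable (f i)) ->
  Ex (fun w => \sum_(i <- s) f i w) = \sum_(i <- s) Ex (f i).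
Proof.
move=> iF; elim: s => [|i s IH].
  by under eq_fun do rewrite big_nil; rewrite Ex_cst big_nil.
under eq_fun do rewrite big_cons.
by rewrite ExD ?IH ?big_cons//; exact: rintegrable_sum.
Qed.

Lemma Ex_le f g : rintegrable f -> rintegrable g -> (forall w, f w <= g w) ->
  Ex f <= Ex g.
Proof. by move=> iF ig fg; apply: le_Rintegral. Qed.

(** Replacing [f] by the minimum of [f] and [g] changes it on a null set only and turns the almost
    sure inequality into a pointwise one. *)
Lemma Ex_ae_le f g : rintegrable f -> rintegrable g ->
  {ae P, forall w, f w <= g w} -> Ex f <= Ex g.
Proof.
move=> iF ig fg; pose h w := Num.min (f w) (g w).
have ih : rintegrable h.
  apply: (@rintegrable_le _ (fun w => `|f w| + `|g w|)).
  - by apply: measurable_minr; exact: rintegrable_measurable.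
  - by apply: rintegrableD; exact: integrable_norm.
  - move=> w; rewrite [X in _ <= X]ger0_norm ?addr_ge0// /h.
    by case: (ltP (f w) (g w)) => _; rewrite (lerDl, lerDr).
have -> : Ex f = Ex h.
  rewrite /Ex /Rintegral; congr fine; apply: ae_eq_integral => //.
  - exact: (measurable_int P).
  - exact: (measurable_int P).
  - by apply: filterS fg => w fg _ /=; rewrite /h (min_idPl fg).
by apply: Ex_le => // w; rewrite /h ge_min lexx orbT.
Qed.

Lemma Ex_ge0 f : (forall w, 0 <= f w) -> 0 <= Ex f.
Proof. by move=> f0; apply: Rintegral_ge0. Qed.

Lemma Ex_norm f : rintegrable f -> `|Ex f| <= Ex (fun w => `|f w|).
Proof. by move=> iF; apply: le_normr_Rintegral. Qed.

Lemma integral_indic_mul A f : measurable A ->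
  (\int[P]_(w in A) (f w)%:E = \int[P]_w (\1_A w * f w)%:E)%E.
Proof.
move=> mA; rewrite integral_mkcond; apply: eq_integral => w _.
by rewrite /patch indicE; case: (w \in A); rewrite ?mul1r ?mul0r.
Qed.

Lemma Ex_indic A : measurable A -> ((Ex (\1_A))%:E = P A)%E.
Proof.
move=> mA; rewrite /Ex /Rintegral integral_indic// setIT fineK//.
exact: fin_num_measure.
Qed.

Lemma markov_le (f : Om -> R) (M : R) : measurable_fun setT f -> (forall w, 0 <= f w) ->
  rintegrable f -> 0 < M -> (P [set w | (M < f w)%R] <= (Ex f / M)%:E)%E.
Proof.
move=> mf f0 iF M0.
have mA : measurable [set w | M < f w].
  rewrite (_ : [set w | _] = ~` [set w | f w <= M]).
    by apply: measurableC; exact: measurable_le_cst.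
  by apply/seteqP; split => w /=; [move=> H; apply/negP; rewrite -ltNge|move=> /negP; rewrite -ltNge].
rewrite -Ex_indic// lee_fin ler_pdivlMr// mulrC -ExZ.
  apply: Ex_le => // [|w]; first apply: rintegrableZ.
    by apply: (@rintegrable_bounded _ 1) => [|w]; rewrite ?indicE ?normr_nat//; case: (_ \in _).
  rewrite indicE; have [/set_mem/ltW|_] := boolP (w \in _); by rewrite ?mulr1// mulr0.
by apply: (@rintegrable_bounded _ 1) => [|w]; rewrite ?indicE ?normr_nat//; case: (_ \in _).
Qed.

Lemma indic_le1 (A : set Om) w : `|\1_A w : R| <= 1.
Proof. by rewrite indicE normr_nat; case: (_ \in _). Qed.

Section SubSigmaAlgebra.
Variables (gen : set (set Om)).
Hypothesis hgen : gen `<=` measurable.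
Local Notation G := (<<s gen >>).
Local Notation S := (g_sigma_algebraType gen).

Lemma sub_sigma_measurable : G `<=` measurable.
Proof. exact: (smallest_sub (@sigma_algebra_measurable _ Om)). Qed.

Lemma sub_sigma_measurable_fun (f : Om -> R) :
  measurable_fun setT (f : S -> R) -> measurable_fun setT f.
Proof.
move=> mf _ B mB; apply: sub_sigma_measurable.
by have := mf (@measurableT _ S) B mB.
Qed.

Lemma gmeasurableP (f : Om -> R) :
  Gmeasurable G f <-> measurable_fun setT (f : S -> R).
Proof.
split => [Gf|mf a]; first exact: (@measurable_fun_le_cst R _ S).
exact: (@measurable_le_cst R _ S f a mf).
Qed.

(** Orthogonality passes from indicators to simple functions, and from these to [f] by dominated
    convergence under [|f psi|]. The function [f] may be unbounded, as it is when the positive or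
    negative part of an error takes its place. *)
Lemma sub_sigma_orthogonal_ge0 (f psi : Om -> R) :
  measurable_fun setT (f : S -> R) -> (forall w, 0 <= f w) ->
  rintegrable psi -> rintegrable (fun w => f w * psi w) ->
  (forall A, G A -> Ex (fun w => \1_A w * psi w) = 0) ->
  Ex (fun w => f w * psi w) = 0.
Proof.
move=> mf f0 ipsi ifpsi psi0.
have mEf : measurable_fun setT (EFin \o f : S -> \bar R) by exact/measurable_EFinP.
pose f_ n : S -> R := nnsfun_approx (@measurableT _ S) mEf n.
have f0' (x : S) : setT x -> (0%R <= (EFin \o f) x)%E by move=> _; rewrite lee_fin.
have cf w : f_ n w @[n --> \oo] --> f w.
  have := cvg_nnsfun_approx measurableT mEf f0' (x := w) I.
  by move/fine_cvgP => [_].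
have le_f n w : f_ n w <= f w.
  apply: (@cvgr_to_ge _ \oo _ _ (f_ ^~ w) (f w)); first exact: cf.
  near=> m; have nm : (n <= m)%N by near: m; exists n.
  by have /lefP := nd_nnsfun_approx measurableT mEf nm; exact.
have f_0 n w : 0 <= f_ n w by exact: fun_ge0.
have mf_ n : measurable_fun setT (f_ n : Om -> R).
  by apply: sub_sigma_measurable_fun; exact: measurable_funP.
have mpsi := rintegrable_measurable ipsi.
have zero n : Ex (fun w => f_ n w * psi w) = 0.
  have fE w : f_ n w = \sum_(y <- fset_set (range (f_ n)))
      y * \1_((f_ n) @^-1` [set y]) w.
    by rewrite {1}/f_ fimfunE fsbig_finite.
  under eq_fun do rewrite fE mulr_suml.
  have Gy y : G ((f_ n) @^-1` [set y]).
    by rewrite -[X in G X]setTI; exact: (@measurable_funP _ _ S _ setT (nnsfun_approx _ mEf n)).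
  have iy y : rintegrable (fun w => \1_((f_ n) @^-1` [set y]) w * psi w).
    apply: (@rintegrableMb _ _ 1) => // [|w]; last exact: indic_le1.
    by apply: measurable_indic; apply: sub_sigma_measurable.
  rewrite Ex_sum => [|y].
    rewrite big1// => y _; under eq_fun do rewrite -mulrA.
    by rewrite ExZ// psi0// mulr0.
  by under eq_fun do rewrite -mulrA; exact: rintegrableZ.
have mfpsi n : measurable_fun setT (EFin \o (fun w : Om => f_ n w * psi w)).
  by apply/measurable_EFinP; exact: measurable_funM (mf_ n) mpsi.
have [] := @dominated_convergence _ _ _ P setT measurableT
  (fun n => EFin \o (fun w : Om => f_ n w * psi w)) (EFin \o (fun w : Om => f w * psi w))
  (EFin \o (fun w => `|f w * psi w|)) mfpsi.
- exact: (measurable_int P).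
- apply/aeW => w _ /=; apply: cvg_EFin; first exact: nearW.
  by apply: (@cvgM _ _ \oo); [exact: cf|exact: cvg_cst].
- exact: integrable_norm.
- apply/aeW => w n _ /=; rewrite lee_fin !normrM ler_wpM2r//.
  by rewrite !ger0_norm//; exact: le_f.
move=> _ _ /= cvg0; rewrite /Ex /Rintegral.
suff -> : (\int[P]_w (f w * psi w)%:E = 0)%E by [].
have zn n : (\int[P]_w (f_ n w * psi w)%:E = 0)%E.
  have := zero n; rewrite /Ex /Rintegral => z.
  rewrite -[LHS]fineK ?z//; apply: integrable_fin_num => //.
  apply: (@rintegrable_le _ (fun w : Om => f w * psi w)) => //.
    exact: measurable_funM (mf_ n) mpsi.
  by move=> w; rewrite !normrM ler_wpM2r// !ger0_norm//; exact: le_f.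
have cz : (\int[P]_w (f_ n w * psi w)%:E)%E @[n --> \oo] --> (0%E : \bar R).
  by rewrite (_ : (fun n => _) = fun=> 0%E); [exact: cvg_cst|apply/funext].
by apply: (cvg_unique _ cvg0 cz).
Unshelve. all: by end_near. Qed.

Lemma sub_sigma_orthogonal (f psi : Om -> R) :
  measurable_fun setT (f : S -> R) ->
  rintegrable psi -> rintegrable (fun w => f w * psi w) ->
  (forall A, G A -> Ex (fun w => \1_A w * psi w) = 0) ->
  Ex (fun w => f w * psi w) = 0.
Proof.
move=> mf ipsi ifpsi psi0.
have mpsi := rintegrable_measurable ipsi.
have mp : measurable_fun setT (f^\+ : S -> R) by exact: measurable_funrpos.
have mn : measurable_fun setT (f^\- : S -> R) by exact: measurable_funrneg.
have ip : rintegrable (fun w => f^\+ w * psi w).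
  apply: rintegrable_le ifpsi _ => [|w].
    by apply: measurable_funM => //; exact: sub_sigma_measurable_fun.
  rewrite !normrM ler_wpM2r// /funrpos ger0_norm ?le_max ?lexx ?orbT//.
  by rewrite ge_max ler_norm normr_ge0.
have im : rintegrable (fun w => f^\- w * psi w).
  apply: rintegrable_le ifpsi _ => [|w].
    by apply: measurable_funM => //; exact: sub_sigma_measurable_fun.
  rewrite !normrM ler_wpM2r// /funrneg ger0_norm ?le_max ?lexx ?orbT//.
  by rewrite ge_max -normrN ler_norm normr_ge0.
have -> : (fun w => f w * psi w) = (fun w => f^\+ w * psi w - f^\- w * psi w).
  apply/funext => w; rewrite -mulrBl; congr (_ * _).
  by rewrite [LHS](congr1 (fun h => h w) (esym (funrposBneg f))).
rewrite ExB// (sub_sigma_orthogonal_ge0 mp (funrpos_ge0 f) ipsi ip psi0).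
by rewrite (sub_sigma_orthogonal_ge0 mn (funrneg_ge0 f) ipsi im psi0) subrr.
Qed.

Lemma cexp_version_Ex (X Y : Om -> R) A : rintegrable X ->
  cexp_version P G X Y -> G A ->
  Ex (fun w => \1_A w * X w) = Ex (fun w => \1_A w * Y w).
Proof.
move=> iX [_ _ XY] GA; have mA := sub_sigma_measurable GA.
by rewrite /Ex /Rintegral -!integral_indic_mul// XY.
Qed.

Lemma cexp_pullout (X Y h : Om -> R) M : rintegrable X ->
  cexp_version P G X Y -> measurable_fun setT (h : S -> R) ->
  (forall w, `|h w| <= M) ->
  Ex (fun w => h w * X w) = Ex (fun w => h w * Y w).
Proof.
move=> iX XY mh hM; have [_ iY _] := XY.
have mh' := sub_sigma_measurable_fun mh.
apply/eqP; rewrite -subr_eq0 -ExB; last 2 first.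
- exact: rintegrableMb hM iX.
- exact: rintegrableMb hM iY.
apply/eqP; under eq_fun do rewrite -mulrBr.
apply: sub_sigma_orthogonal => //.
- exact: rintegrableB.
- by apply: rintegrableMb hM _ => //; exact: rintegrableB.
- move=> A GA; under eq_fun do rewrite mulrBr.
  have mA : measurable_fun setT (\1_A : Om -> R).
    by apply: measurable_indic; apply: sub_sigma_measurable.
  rewrite ExB ?(cexp_version_Ex iX XY GA) ?subrr//.
    by apply: (@rintegrableMb _ _ 1) => // w; exact: indic_le1.
  by apply: (@rintegrableMb _ _ 1) => // w; exact: indic_le1.
Qed.

(** Radon-Nikodym on the sub-sigma-field: the identity map [phi] to the coarser space pushes [P] to
    [mu] and the signed measure with density [X] to [nu]; the derivative of [nu] with respect to
    [mu] is measurable for the coarser field. *)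
Lemma cexp_exists (X : Om -> R) : rintegrable X ->
  exists Y, cexp_version P G X Y.
Proof.
move=> iX; pose phi : Om -> S := idfun.
have mphi : measurable_fun setT phi.
  by move=> _ B mB; rewrite setTI; exact: sub_sigma_measurable.
pose X1 : {mfun Om >-> S} := HB.pack phi (isMeasurableFun.Build _ _ _ _ phi mphi).
pose mu : probability S R := distribution P X1.
pose nu : {charge set S -> \bar R} :=
  @measure_function_pushforward__canonical__charge_Charge _ _ _ _ phi R
    (induced_charge iX) mphi.
have numu : nu `<< mu.
  apply: (dominates_pushforward mphi); apply/null_content_dominatesP => A mA A0.
  apply: (@null_set_integral _ _ _ P A) => //.
  by apply: (@measurable_funS _ _ _ _ setT) => //; exact: measurable_int iX.
pose Y0 : S -> \bar R := Radon_Nikodym nu mu.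
have Yfin x : Y0 x \is a fin_num by exact: Radon_Nikodym_fin_num.
have iY : mu.-integrable setT Y0 by exact: Radon_Nikodym_integrable.
have mY : measurable_fun setT Y0 by exact: (measurable_int mu).
have YE : EFin \o (fun w : Om => fine (Y0 w)) = Y0 \o phi.
  by apply/funext => w /=; rewrite fineK.
have iYP : P.-integrable setT (Y0 \o phi).
  apply/integrableP; split; first exact: measurableT_comp.
  have /integrableP[_] := iY; rewrite ge0_integral_distribution//.
  exact: measurableT_comp.
exists (fun w => fine (Y0 w)); split.
- apply/gmeasurableP; exact: measurableT_comp.
- by move: iYP; rewrite -YE.
- move=> A GA; transitivity (nu A); last by [].
  rewrite (Radon_Nikodym_integral numu)//.
  rewrite (integral_pushforward mphi)//; last first.
    by apply: (integrableS measurableT) iYP => //; exact: (sub_sigma_measurable GA).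
  by apply: eq_integral => w _ /=; rewrite fineK.
Qed.

End SubSigmaAlgebra.
End ConditionalExpectation.

(** * Second moments of weighted error sums *)

Section WeightedSums.
Variables (R : realType) (d : measure_display) (Om : measurableType d)
  (P : probability Om R) (gen : set (set Om)).
Hypothesis hgen : gen `<=` measurable.
Local Notation G := (<<s gen >>).
Local Notation S := (g_sigma_algebraType gen).
Local Notation Ex := (Ex P).
Local Notation rintegrable := (rintegrable P).

Lemma rintegrable_mul_sq (f g : Om -> R) : measurable_fun setT f ->
  measurable_fun setT g -> rintegrable (fun w => f w ^+ 2) ->
  rintegrable (fun w => g w ^+ 2) -> rintegrable (fun w => f w * g w).
Proof.
move=> mf mg i1 i2; apply: (@rintegrable_le _ _ _ _ _ (fun w => f w ^+ 2 + g w ^+ 2)).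
- exact: measurable_funM.
- exact: rintegrableD.
- move=> w; rewrite [X in _ <= X]ger0_norm ?addr_ge0 ?sqr_ge0// ler_norml.
  apply/andP; split; rewrite -subr_ge0.
    have -> : f w * g w - - (f w ^+ 2 + g w ^+ 2) =
      ((f w + g w) ^+ 2 + (f w ^+ 2 + g w ^+ 2)) / 2 by field.
    by rewrite divr_ge0// !addr_ge0 ?sqr_ge0.
  have -> : f w ^+ 2 + g w ^+ 2 - f w * g w =
      ((f w - g w) ^+ 2 + (f w ^+ 2 + g w ^+ 2)) / 2 by field.
  by rewrite divr_ge0// !addr_ge0 ?sqr_ge0.
Qed.

(** The pull-out property is used with pointwise bounds, so a conditional probability is needed that
    is bounded everywhere and not only almost surely. It is obtained by clipping an arbitrary
    version to the unit interval. *)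
Lemma cexp_indic_bounded (B : set Om) : measurable B ->
  exists p, [/\ cexp_version P G (\1_B) p, measurable_fun setT (p : S -> R) &
    forall w, `|p w| <= 1].
Proof.
move=> mB.
have iB : rintegrable (\1_B).
  by apply: (@rintegrable_bounded _ _ _ _ _ 1) => // w; exact: indic_le1.
have [q qv] := cexp_exists hgen iB.
have [/gmeasurableP mq iq _] := qv.
have iq' : rintegrable q by [].
pose p w := Num.max 0 (Num.min (q w) 1).
have mp : measurable_fun setT (p : S -> R).
  by apply: measurable_maxr => //; exact: measurable_minr.
have p01 w : 0 <= p w <= 1.
  by rewrite /p le_max lexx /= ge_max ler01 /= ge_min lexx orbT.
have p1 w : `|p w| <= 1 by have /andP[? ?] := p01 w; rewrite ger0_norm.
have ip : rintegrable p.
  apply: (@rintegrable_bounded _ _ _ _ _ 1) => //.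
  exact: (sub_sigma_measurable_fun hgen).
exists p; split => //; split; [exact/gmeasurableP|exact: ip|move=> A GA].
have mA := sub_sigma_measurable hgen GA.
rewrite (integral_indic_mul P p mA) (integral_indic_mul P \1_B mA).
have iA (f : Om -> R) : rintegrable f -> rintegrable (fun w => \1_A w * f w).
  by move=> iF; apply: (@rintegrableMb _ _ _ _ _ _ 1) => // w; exact: indic_le1.
have fin (f : Om -> R) : rintegrable f ->
    (\int[P]_w (\1_A w * f w)%:E)%E = (Ex (fun w => \1_A w * f w))%:E.
  move=> iF; rewrite /Ex /Rintegral fineK//; apply: integrable_fin_num => //.
  exact: iA.
rewrite !fin//; congr EFin.
(* Clipping changes [q] only on the sets [q > 1] and [q < 0], and testing the
   defining identity on those sets shows that they carry no mass. *)
pose A1 := [set w | 1 < q w]; pose A0 := [set w | q w < 0].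
have GA1 : G A1.
  have := @measurable_le_cst R _ S q 1 mq => /(@measurableC _ S).
  rewrite (_ : ~` _ = A1)//; apply/seteqP; split => w /=.
    by move/negP; rewrite -ltNge.
  by move=> qw; apply/negP; rewrite -ltNge.
have GA0 : G A0 by exact: (@measurable_lt_cst R _ S q 0 mq).
have zero1 : Ex (fun w => \1_A1 w * (q w - 1)) = 0.
  apply/le_anti/andP; split; last first.
    apply: Ex_ge0 => w; rewrite indicE; case: (boolP (w \in A1)) => [/set_mem|_].
      by rewrite /A1 /= mul1r subr_ge0 => /ltW.
    by rewrite mul0r.
  have -> : (fun w => \1_A1 w * (q w - 1)) =
      (fun w => \1_A1 w * q w - \1_A1 w * 1).
    by apply/funext => w; rewrite mulrBr.
  have i1 (f : Om -> R) : rintegrable f -> rintegrable (fun w => \1_A1 w * f w).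
    move=> iF; apply: (@rintegrableMb _ _ _ _ _ _ 1) => // [|w]; last exact: indic_le1.
    by apply: measurable_indic; exact: (sub_sigma_measurable hgen).
  have ic : rintegrable (fun _ => 1) by exact: rintegrable_cst.
  rewrite ExB; [|exact: i1|exact: (i1 (fun _ => 1))].
  rewrite -(cexp_version_Ex hgen iB qv GA1) subr_le0.
  apply: Ex_le; [exact: i1|exact: (i1 (fun _ => 1))|move=> w].
  by rewrite ler_wpM2l// indicE//; case: (w \in B).
have zero0 : Ex (fun w => \1_A0 w * (- q w)) = 0.
  have i0 (f : Om -> R) : rintegrable f -> rintegrable (fun w => \1_A0 w * f w).
    move=> iF; apply: (@rintegrableMb _ _ _ _ _ _ 1) => // [|w]; last exact: indic_le1.
    by apply: measurable_indic; exact: (sub_sigma_measurable hgen).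
  apply/le_anti/andP; split; last first.
    apply: Ex_ge0 => w; rewrite indicE; case: (boolP (w \in A0)) => [/set_mem|_].
      by rewrite /A0 /= mul1r oppr_ge0 => /ltW.
    by rewrite mul0r.
  have -> : (fun w => \1_A0 w * (- q w)) = (fun w => -1 * (\1_A0 w * q w)).
    by apply/funext => w; rewrite mulrN mulN1r.
  rewrite ExZ; last exact: i0.
  rewrite -(cexp_version_Ex hgen iB qv GA0) mulN1r oppr_le0.
  by apply: Ex_ge0 => w; rewrite mulr_ge0// indicE ler0n.
have -> : Ex (fun w => \1_A w * \1_B w) = Ex (fun w => \1_A w * q w).
  exact: (cexp_version_Ex hgen iB qv GA).
apply/eqP; rewrite -subr_eq0 -ExB; [|exact: iA|exact: iA].
rewrite -normr_le0; apply: le_trans (Ex_norm _) _.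
  by apply: rintegrableB; exact: iA.
have iA1 : rintegrable (fun w => \1_A1 w * (q w - 1)).
  apply: (@rintegrableMb _ _ _ _ _ _ 1) => [|w|]; [|exact: indic_le1|].
    by apply: measurable_indic; exact: (sub_sigma_measurable hgen).
  by apply: rintegrableB => //; exact: rintegrable_cst.
have iA0 : rintegrable (fun w => \1_A0 w * - q w).
  apply: (@rintegrableMb _ _ _ _ _ _ 1) => [|w|]; [|exact: indic_le1|].
    by apply: measurable_indic; exact: (sub_sigma_measurable hgen).
  exact: rintegrableN.
have -> : 0 = Ex (fun w => \1_A1 w * (q w - 1) + \1_A0 w * (- q w)).
  by rewrite ExD// zero1 zero0 addr0.
apply: Ex_le; [|exact: rintegrableD|move=> w].
  by apply: integrable_norm; apply: rintegrableB; exact: iA.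
rewrite -mulrBr normrM.
apply: le_trans (_ : `|p w - q w| <= _).
  by rewrite ler_piMl// indic_le1.
have in1 : (w \in A1) = (1 < q w).
  by apply/idP/idP => [/set_mem//|?]; exact/mem_set.
have in0 : (w \in A0) = (q w < 0).
  by apply/idP/idP => [/set_mem//|?]; exact/mem_set.
rewrite !indicE in1 in0 /p.
case: (ltP 1 (q w)) => q1.
  rewrite (max_idPr ler01) ltNge (le_trans ler01 (ltW q1)) /=.
  by rewrite mul1r mul0r addr0 distrC ger0_norm// subr_ge0 ltW.
rewrite mul0r add0r; case: (ltP (q w) 0) => q0.
  by rewrite mul1r sub0r normrN ltr0_norm.
by rewrite subrr normr0 mul0r.
Qed.

Variables (N T : nat) (e : 'I_N -> 'I_T -> Om -> R) (C : R).
Local Notation Fu i :=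
  [set A | exists t (a : R), A = [set w | e i t w <= a]].
Hypothesis me : forall i t, measurable_fun setT (e i t).
Hypothesis ie : forall i t, rintegrable (e i t).
Hypothesis ie2 : forall i t, rintegrable (fun w => e i t w ^+ 2).
Hypothesis e_mean0 : forall i t, cexp_version P G (e i t) (fun _ => 0).
Hypothesis e_indep : cond_indep P G (fun i => <<s Fu i >>).
Hypothesis e_cov : forall i t (c : 'I_T -> Om -> R),
  (forall s, cexp_version P G (fun w => e i t w * e i s w) (c s)) ->
  {ae P, forall w, \sum_s `|c s w| <= C}.

Lemma Fu_measurable i : Fu i `<=` measurable.
Proof. by move=> A [t [a ->]]; exact: measurable_le_cst. Qed.

Lemma e_Fu_measurable i t :
  measurable_fun setT (e i t : g_sigma_algebraType (Fu i) -> R).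
Proof.
apply: (@measurable_fun_le_cst R _ (g_sigma_algebraType (Fu i))) => a.
by apply: sub_sigma_algebra; exists t, a.
Qed.

Lemma rintegrable_ee i t j s : rintegrable (fun w => e i t w * e j s w).
Proof. exact: rintegrable_mul_sq. Qed.

(** Conditional independence gives [\1_A] the same mean against [\1_B * \1_D] and against
    [p * \1_D]: both are the mean of [\1_D * (q * p)], with [q] a conditional probability of [A]. *)
Lemma indep_indic i j A B D : i != j -> <<s Fu i >> A -> <<s Fu j >> B -> G D ->
  forall p, cexp_version P G (\1_B) p -> measurable_fun setT (p : S -> R) ->
  (forall w, `|p w| <= 1) ->
  Ex (fun w => \1_A w * ((\1_B w - p w) * \1_D w)) = 0.
Proof.
move=> ij FA FB GD p pv mp p1.
have mA := sub_sigma_measurable (@Fu_measurable i) FA.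
have mB := sub_sigma_measurable (@Fu_measurable j) FB.
have mD := sub_sigma_measurable hgen GD.
have [q [qv mq q1]] := cexp_indic_bounded mA.
have iI (E : set Om) : measurable E -> rintegrable (\1_E).
  move=> mE; apply: (@rintegrable_bounded _ _ _ _ _ 1) => // w; exact: indic_le1.
pose J : {set 'I_N} := [set i; j]%SET.
pose A_ k := if k == i then A else B.
pose p_ k := if k == i then q else p.
have ji : (j == i) = false by rewrite eq_sym (negbTE ij).
have := e_indep (J := J) (A := A_) (p := p_).
have -> : \bigcap_(k in [set k | k \in J]) A_ k = A `&` B.
  apply/seteqP; split => [w H|w [Aw Bw] k /=].
    split; [have := H i|have := H j]; rewrite /= !inE eqxx ?orbT /A_ ?eqxx ?ji;
    exact.
  by rewrite /A_; case: eqP.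
have -> : (fun w => \prod_(k in J) p_ k w) = (fun w => q w * p w).
  apply/funext => w; rewrite big_setU1 ?inE ?(negbTE ij)//= big_set1.
  by rewrite /p_ eqxx ji.
case.
- move=> k; rewrite !inE => /orP[/eqP->|/eqP->]; rewrite /A_ ?eqxx ?ji//.
- move=> k; rewrite !inE => /orP[/eqP->|/eqP->]; rewrite /A_ /p_ ?eqxx ?ji//.
move=> mqp iqp ABv.
have v : cexp_version P G (\1_(A `&` B)) (fun w => q w * p w) by split.
have mD' : measurable_fun setT (\1_D : Om -> R) by exact: measurable_indic.
have mDS : measurable_fun setT (\1_D : S -> R) by exact: (@measurable_indic _ S).
have H1 : Ex (fun w => \1_A w * (\1_B w * \1_D w)) =
    Ex (fun w => \1_D w * (q w * p w)).
  rewrite -(cexp_version_Ex hgen (iI _ (measurableI _ _ mA mB)) v GD).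
  congr Ex; apply/funext => w; rewrite indicI /=; ring.
have H2 : Ex (fun w => \1_A w * (p w * \1_D w)) =
    Ex (fun w => \1_D w * (q w * p w)).
  have -> : (fun w => \1_A w * (p w * \1_D w)) = (fun w => (p w * \1_D w) * \1_A w).
    by apply/funext => w; rewrite mulrC.
  rewrite (@cexp_pullout _ _ _ P _ hgen _ _ _ 1 (iI _ mA) qv).
  - by congr Ex; apply/funext => w; ring.
  - exact: (@measurable_funM _ S).
  - by move=> w; rewrite normrM mulr_ile1// indic_le1.
have -> : (fun w => \1_A w * ((\1_B w - p w) * \1_D w)) =
   (fun w => \1_A w * (\1_B w * \1_D w) - \1_A w * (p w * \1_D w)).
  by apply/funext => w; ring.
rewrite ExB ?H1 ?H2 ?subrr//.
  apply: (@rintegrable_bounded _ _ _ _ _ 1) => [|w].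
    by do 2! apply: measurable_funM => //.
  by rewrite !normrM !mulr_ile1// ?mulr_ge0// indic_le1.
apply: (@rintegrable_bounded _ _ _ _ _ 1) => [|w].
  do 2! apply: measurable_funM => //.
  exact: (sub_sigma_measurable_fun hgen).
by rewrite !normrM !mulr_ile1// ?mulr_ge0// indic_le1.
Qed.

(* [cond_indep] only speaks of events; the two factors [e i t] and [e j s] are
   reached one at a time, by orthogonality on the corresponding sigma-field. *)
Lemma indep_cross i j t s (h : Om -> R) M : i != j ->
  measurable_fun setT (h : S -> R) -> (forall w, `|h w| <= M) ->
  Ex (fun w => h w * (e i t w * e j s w)) = 0.
Proof.
move=> ij mh hM; apply: (sub_sigma_orthogonal hgen) => //.
- exact: rintegrable_ee.
- apply: rintegrableMb hM _; last exact: rintegrable_ee.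
  exact: (sub_sigma_measurable_fun hgen).
move=> D GD; have mD := sub_sigma_measurable hgen GD.
have iD (f : Om -> R) : rintegrable f -> rintegrable (fun w => \1_D w * f w).
  by move=> iF; apply: (@rintegrableMb _ _ _ _ _ _ 1) => // w; exact: indic_le1.
have -> : (fun w => \1_D w * (e i t w * e j s w)) =
   (fun w => e j s w * (\1_D w * e i t w)) by apply/funext => w; ring.
apply: (sub_sigma_orthogonal (@Fu_measurable j)); first exact: e_Fu_measurable.
- exact: iD.
- have -> : (fun w => e j s w * (\1_D w * e i t w)) =
     (fun w => \1_D w * (e i t w * e j s w)) by apply/funext => w; ring.
  by apply: iD; exact: rintegrable_ee.
move=> B FB; have mB := sub_sigma_measurable (@Fu_measurable j) FB.
(* [\1_B] is split into [\1_B - p], which after multiplication by [\1_D] is orthogonal to the field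
   of unit [i], and [p], which is measurable for the conditioning field and meets the zero
   conditional mean of [e i t]. *)
have [p [pv mp p1]] := cexp_indic_bounded mB.
have mp' := sub_sigma_measurable_fun hgen mp.
have iB : rintegrable (fun w => (\1_B w - p w) * \1_D w).
  apply: (@rintegrable_bounded _ _ _ _ _ 2) => [|w].
    by apply: measurable_funM => //; apply: measurable_funB => //; exact: mp'.
  rewrite normrM; apply: le_trans (_ : `|\1_B w - p w| * 1 <= _).
    by rewrite ler_wpM2l// indic_le1.
  rewrite mulr1; apply: le_trans (ler_normB _ _) _.
  by rewrite (natrD _ 1 1) lerD// indic_le1.
have mBD : measurable_fun setT (fun w => (\1_B w - p w) * \1_D w).
  exact: rintegrable_measurable iB.
have part1 : Ex (fun w => e i t w * ((\1_B w - p w) * \1_D w)) = 0.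
  apply: (sub_sigma_orthogonal (@Fu_measurable i)); first exact: e_Fu_measurable.
  - exact: iB.
  - have -> : (fun w => e i t w * ((\1_B w - p w) * \1_D w)) =
      (fun w => ((\1_B w - p w) * \1_D w) * e i t w).
      by apply/funext => w; rewrite mulrC.
    apply: (@rintegrableMb _ _ _ _ _ _ 2) => // w.
    rewrite normrM; apply: le_trans (_ : `|\1_B w - p w| * 1 <= _).
      by rewrite ler_wpM2l// indic_le1.
    rewrite mulr1; apply: le_trans (ler_normB _ _) _.
    by rewrite (natrD _ 1 1) lerD// indic_le1.
  - by move=> A FA; exact: (indep_indic ij FA FB GD pv mp p1).
have pD1 w : `|p w * \1_D w| <= 1 by rewrite normrM mulr_ile1// indic_le1.
have mpD : measurable_fun setT ((fun w => p w * \1_D w) : S -> R).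
  by apply: (@measurable_funM _ S) => //; exact: (@measurable_indic _ S).
have part2 : Ex (fun w => (p w * \1_D w) * e i t w) = 0.
  rewrite (cexp_pullout hgen (ie i t) (e_mean0 i t) mpD pD1).
  by under eq_fun do rewrite mulr0; rewrite Ex_cst.
have -> : (fun w => \1_B w * (\1_D w * e i t w)) =
  (fun w => e i t w * ((\1_B w - p w) * \1_D w) + (p w * \1_D w) * e i t w).
  by apply/funext => w; ring.
rewrite ExD ?part1 ?part2 ?addr0//.
  have -> : (fun w => e i t w * ((\1_B w - p w) * \1_D w)) =
      (fun w => ((\1_B w - p w) * \1_D w) * e i t w).
      by apply/funext => w; rewrite mulrC.
  apply: (@rintegrableMb _ _ _ _ _ _ 2) => // w.
  rewrite normrM; apply: le_trans (_ : `|\1_B w - p w| * 1 <= _).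
    by rewrite ler_wpM2l// indic_le1.
  rewrite mulr1; apply: le_trans (ler_normB _ _) _.
  by rewrite (natrD _ 1 1) lerD// indic_le1.
by apply: rintegrableMb pD1 _ => //; exact: (sub_sigma_measurable_fun hgen).
Qed.

Variables (u : 'I_N -> 'I_T -> Om -> R) (M : R).
Hypothesis mu : forall i t, measurable_fun setT (u i t : S -> R).
Hypothesis uM : forall i t w, `|u i t w| <= M.

Lemma weighted_unit_sum i :
  Ex (fun w => (\sum_t u i t w * e i t w) ^+ 2) <=
  C * Ex (fun w => \sum_t u i t w ^+ 2).
Proof.
have mu' t : measurable_fun setT (u i t) by exact: (sub_sigma_measurable_fun hgen).
have c_ex s t : exists c, cexp_version P G (fun w => e i s w * e i t w) c.
  by apply: (cexp_exists hgen); exact: rintegrable_ee.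
have [c cv] := choice (fun st : 'I_T * 'I_T => c_ex st.1 st.2).
(* Versions for [(s, t)] and [(t, s)] are chosen separately and may differ on a null set; taking one
   of them for both orders makes the kernel symmetric at every point. *)
pose c' (s t : 'I_T) : Om -> R := if (s <= t)%N then c (s, t) else c (t, s).
have c'v s t : cexp_version P G (fun w => e i s w * e i t w) (c' s t).
  rewrite /c'; case: ifP => _; first exact: (cv (s, t)).
  have -> : (fun w => e i s w * e i t w) = (fun w => e i t w * e i s w).
    by apply/funext => w; rewrite mulrC.
  exact: (cv (t, s)).
have c'C s t : c' s t = c' t s.
  rewrite /c'; case: ltngtP => // st; congr (c (_, _)); apply: val_inj => //.
have ic' s t : rintegrable (c' s t) by have [] := c'v s t.
have uu1 s t w : `|u i s w * u i t w| <= M * M by rewrite normrM ler_pM.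
have muu s t : measurable_fun setT ((fun w => u i s w * u i t w) : S -> R).
  by apply: (@measurable_funM _ S); exact: mu.
have muu' s t : measurable_fun setT (fun w => u i s w * u i t w).
  exact: measurable_funM.
have iuuee s t : rintegrable (fun w => (u i s w * u i t w) * (e i s w * e i t w)).
  by apply: rintegrableMb (uu1 s t) _ => //; exact: rintegrable_ee.
have iuuc s t : rintegrable (fun w => (u i s w * u i t w) * c' s t w).
  by apply: rintegrableMb (uu1 s t) _.
have -> : (fun w => (\sum_t u i t w * e i t w) ^+ 2) =
    (fun w => \sum_s \sum_t (u i s w * u i t w) * (e i s w * e i t w)).
  apply/funext => w; rewrite expr2 mulr_suml; apply: eq_bigr => s _.
  by rewrite mulr_sumr; apply: eq_bigr => t _; ring.
have -> : Ex (fun w => \sum_s \sum_t (u i s w * u i t w) * (e i s w * e i t w)) =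
    Ex (fun w => \sum_s \sum_t (u i s w * u i t w) * c' s t w).
  rewrite Ex_sum => [|s]; last exact: rintegrable_sum.
  rewrite Ex_sum => [|s]; last exact: rintegrable_sum.
  apply: eq_bigr => s _; rewrite !Ex_sum//; apply: eq_bigr => t _.
  by rewrite (cexp_pullout hgen (rintegrable_ee i s i t) (c'v s t) (muu s t) (uu1 s t)).
have u2M t w : `|u i t w ^+ 2| <= M * M by rewrite expr2 uu1.
have mu2 t : measurable_fun setT (fun w => u i t w ^+ 2) by exact: measurable_funX.
have iu2 t : rintegrable (fun w => u i t w ^+ 2).
  by apply: rintegrable_bounded (u2M t).
rewrite -ExZ; last exact: rintegrable_sum.
apply: Ex_ae_le.
- by apply: rintegrable_sum => s; exact: rintegrable_sum.
- by apply: rintegrableZ; exact: rintegrable_sum.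
have ae_s : {ae P, forall w, forall s : 'I_T, \sum_t `|c' s t w| <= C}.
  apply: filter_forall => s; exact: (e_cov (c'v s)).
apply: filterS ae_s => w ws.
(* Schur's test: [|u_s u_t| <= (u_s^2 + u_t^2) / 2], then sum the symmetric
   kernel [|c' s t|] along rows. *)
apply: le_trans (_ : \sum_s \sum_t (u i s w ^+ 2 + u i t w ^+ 2) / 2 * `|c' s t w| <= _).
  apply: ler_sum => s _; apply: ler_sum => t _.
  apply: le_trans (ler_norm _) _; rewrite normrM ler_wpM2r// ler_norml.
  apply/andP; split; rewrite -subr_ge0.
    have -> : u i s w * u i t w - - ((u i s w ^+ 2 + u i t w ^+ 2) / 2) =
      (u i s w + u i t w) ^+ 2 / 2 by field.
    by rewrite divr_ge0// sqr_ge0.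
  have -> : (u i s w ^+ 2 + u i t w ^+ 2) / 2 - u i s w * u i t w =
      (u i s w - u i t w) ^+ 2 / 2 by field.
  by rewrite divr_ge0// sqr_ge0.
have -> : \sum_s \sum_t (u i s w ^+ 2 + u i t w ^+ 2) / 2 * `|c' s t w| =
    \sum_s \sum_t u i s w ^+ 2 / 2 * `|c' s t w| +
    \sum_s \sum_t u i t w ^+ 2 / 2 * `|c' s t w|.
  rewrite -big_split; apply: eq_bigr => s _ /=; rewrite -big_split.
  by apply: eq_bigr => t _ /=; rewrite !mulrDl.
rewrite [X in _ + X]exchange_big /=.
have -> : \sum_j \sum_i0 u i j w ^+ 2 / 2 * `|c' i0 j w| =
    \sum_s \sum_t u i s w ^+ 2 / 2 * `|c' s t w|.
  by apply: eq_bigr => s _; apply: eq_bigr => t _; rewrite c'C.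
have bound : \sum_s \sum_t u i s w ^+ 2 / 2 * `|c' s t w| <=
    C * (\sum_t u i t w ^+ 2) / 2.
  rewrite mulr_sumr mulr_suml; apply: ler_sum => s _; rewrite -mulr_sumr.
  by rewrite -(mulrA C) (mulrC C) ler_wpM2l// divr_ge0// sqr_ge0.
apply: le_trans (lerD bound bound) _.
by rewrite -splitr.
Qed.

Lemma weighted_sum_integrable :
  rintegrable (fun w => (\sum_i \sum_t u i t w * e i t w) ^+ 2).
Proof.
have mu' i t : measurable_fun setT (u i t) by exact: (sub_sigma_measurable_fun hgen).
rewrite (_ : (fun w => _) = fun w => \sum_i \sum_t \sum_j \sum_s
    (u i t w * u j s w) * (e i t w * e j s w)).
  do 4! (apply: rintegrable_sum => ?).
  apply: (@rintegrableMb _ _ _ _ _ _ (M * M)) => [|w|].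
  - exact: measurable_funM.
  - by rewrite normrM ler_pM.
  - exact: rintegrable_ee.
apply/funext => w; rewrite expr2 mulr_suml; apply: eq_bigr => i _.
rewrite mulr_suml; apply: eq_bigr => t _; rewrite mulr_sumr.
apply: eq_bigr => j _; rewrite mulr_sumr; apply: eq_bigr => s _; ring.
Qed.

(** Products from different units have mean zero by [indep_cross], so only the diagonal of the
    double sum over units survives, and each unit obeys [weighted_unit_sum]. *)
Lemma weighted_sum_second_moment :
  Ex (fun w => (\sum_i \sum_t u i t w * e i t w) ^+ 2) <=
  C * Ex (fun w => \sum_i \sum_t u i t w ^+ 2).
Proof.
have mu' i t : measurable_fun setT (u i t) by exact: (sub_sigma_measurable_fun hgen).
have iterm i t j s : rintegrable (fun w => (u i t w * u j s w) * (e i t w * e j s w)).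
  apply: (@rintegrableMb _ _ _ _ _ _ (M * M)) => [|w|].
  - exact: measurable_funM.
  - by rewrite normrM ler_pM.
  - exact: rintegrable_ee.
have iu2 i t : rintegrable (fun w => u i t w ^+ 2).
  apply: (@rintegrable_bounded _ _ _ _ _ (M * M)) => [|w].
    exact: measurable_funX.
  by rewrite expr2 normrM ler_pM.
pose Z i w := \sum_t u i t w * e i t w.
have ZZ i j w : Z i w * Z j w =
    \sum_t \sum_s (u i t w * u j s w) * (e i t w * e j s w).
  rewrite /Z mulr_suml; apply: eq_bigr => t _; rewrite mulr_sumr.
  by apply: eq_bigr => s _; ring.
have iZZ i j : rintegrable (fun w => Z i w * Z j w).
  rewrite (_ : (fun w => _) = fun w => \sum_t \sum_s
    (u i t w * u j s w) * (e i t w * e j s w)); last exact/funext.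
  by do 2! (apply: rintegrable_sum => ?).
have -> : (fun w => (\sum_i \sum_t u i t w * e i t w) ^+ 2) =
    (fun w => \sum_i \sum_j Z i w * Z j w).
  apply/funext => w; rewrite expr2 mulr_suml; apply: eq_bigr => i _.
  by rewrite mulr_sumr.
rewrite Ex_sum => [|i]; last exact: rintegrable_sum.
rewrite Ex_sum => [|i]; last exact: rintegrable_sum.
rewrite mulr_sumr; apply: ler_sum => i _; rewrite Ex_sum//.
rewrite (bigD1 i)//= [X in _ + X]big1 ?addr0 => [|j ji].
  apply: le_trans (weighted_unit_sum i).
  by under eq_fun do rewrite -expr2.
rewrite (_ : (fun w => _) = fun w => \sum_t \sum_s
    (u i t w * u j s w) * (e i t w * e j s w)); last exact/funext.
rewrite Ex_sum => [|t]; last exact: rintegrable_sum.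
rewrite big1// => t _; rewrite Ex_sum// big1// => s _.
apply: (@indep_cross _ _ _ _ _ (M * M)); first by rewrite eq_sym.
  by apply: (@measurable_funM _ S); exact: mu.
by move=> w; rewrite normrM ler_pM.
Qed.

End WeightedSums.

(** * Perturbation of the top singular vectors *)

Section TopSingularVectors.
Variables (R : realType) (L T K : nat).

Lemma sqnormE_mx (m n : nat) (A : 'M[R]_(m, n)) (v : 'cV[R]_m) :
  sqnorm (A^T *m v) = qform (A *m A^T) v.
Proof. by rewrite sqnorm_mx /qform trmx_mul trmxK !mulmxA. Qed.

Lemma frob2_ortho (G : 'M[R]_(L, K)) : G^T *m G = 1%:M -> frob2 G = K%:R.
Proof.
move=> GG; have := mxdot_trace G G; rewrite GG mxtrace1 => <-.
by apply: eq_bigr => i _; apply: eq_bigr => j _; rewrite expr2.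
Qed.

Variables (Z : 'M[R]_(L, T)) (G : 'M[R]_(L, K)).
Hypotheses (KL : (K <= L)%N) (GZ : topk_left_sv Z G).

Lemma selmx_ortho : (selmx R L K)^T *m selmx R L K = 1%:M.
Proof.
apply/matrixP => i j; rewrite !mxE (bigD1 (widen_ord KL i))//= !mxE eqxx mul1r.
rewrite big1 ?addr0 // => k ki.
rewrite !mxE; have -> : ((k : nat) == i) = false.
  by apply/negbTE; apply: contraNneq ki => ki; apply/eqP/val_inj.
by rewrite mul0r.
Qed.

Lemma selmxT_mul k (y : 'cV[R]_L) (i : 'I_L) (ik : (i < k)%N) :
  ((selmx R L k)^T *m y) (Ordinal ik) 0 = y i 0.
Proof.
rewrite mxE (bigD1 i)//= !mxE eqxx mul1r big1 ?addr0// => i' ii'.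
rewrite !mxE; have -> : ((i' : nat) == i) = false.
  by apply/negbTE; apply: contraNneq ii' => ii'; apply/eqP/val_inj.
by rewrite mul0r.
Qed.

Lemma topk_ortho : G^T *m G = 1%:M.
Proof.
case: GZ => U [V [S [[UU _ _] [_ _ _ ->]]]].
by rewrite trmx_mul mulmxA -(mulmxA _ U^T) UU mulmx1 selmx_ortho.
Qed.

(** The bound is the min-max principle with the range of [A] as test space. The true loadings [Gam]
    will take the place of [A], so a lower bound on the signal alone keeps [D] away from zero. *)
Lemma topk_eigen : exists D : 'rV[R]_K,
  Z *m Z^T *m G = G *m diag_mx D /\
  forall (A : 'M[R]_(L, K)) kap, (forall u : 'cV[R]_K, u != 0 -> A *m u != 0) ->
    (forall u : 'cV[R]_K, kap * sqnorm (A *m u) <= sqnorm (Z^T *m (A *m u))) ->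
    forall j, kap <= D 0 j.
Proof.
case: GZ => U [V [S [[UU VV ZE] [Sd S0 Sle GE]]]].
have UU' : U *m U^T = 1%:M by exact: mulmx1C.
(* Summing the whole row covers every shape of [S]: the sum is the squared diagonal entry when
   [i < T], and 0 otherwise. *)
pose lam (i : 'I_L) : R := \sum_t S i t ^+ 2.
have SSE : S *m S^T = diag_mx (\row_i lam i).
  apply/matrixP => i i'; rewrite !mxE.
  have [<-|ii'] := eqVneq i i'.
    by rewrite mulr1n /lam; apply: eq_bigr => t _; rewrite !mxE expr2.
  rewrite mulr0n big1// => t _; rewrite mxE.
  have [it|it] := eqVneq (i : nat) t; last by rewrite (Sd _ _ it) mul0r.
  rewrite [S i' t]Sd ?mulr0// -it; apply: contraNneq ii' => ii'.
  by apply/eqP/val_inj.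
have ZZE : Z *m Z^T = U *m diag_mx (\row_i lam i) *m U^T.
  rewrite ZE !trmx_mul trmxK mulmxA -SSE.
  by rewrite -!mulmxA (mulmxA V^T) VV mul1mx !mulmxA.
have lam_le (j i : 'I_L) : (j <= i)%N -> lam i <= lam j.
  move=> ji; rewrite /lam; have [iT|Ti] := ltnP i T; last first.
    rewrite big1 => [|t _]; first by apply: sumr_ge0 => t _; exact: sqr_ge0.
    by rewrite Sd ?expr0n// neq_ltn (leq_trans (ltn_ord t) Ti) orbT.
  have jT := leq_ltn_trans ji iT.
  rewrite (bigD1 (Ordinal iT))//= big1 ?addr0 => [|t ti]; last first.
    rewrite Sd ?expr0n//; apply: contraNneq ti => ti; exact/eqP/val_inj.
  rewrite (bigD1 (Ordinal jT))//=; apply: le_trans (_ : S j (Ordinal jT) ^+ 2 <= _).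
    by rewrite ler_pXn2r ?nnegrE ?S0//; exact: Sle.
  by rewrite lerDl; apply: sumr_ge0 => t _; exact: sqr_ge0.
pose wj j := widen_ord KL j.
exists (\row_j lam (wj j)); split.
  rewrite ZZE GE -!mulmxA; congr (U *m _); rewrite (mulmxA U^T) UU mul1mx.
  apply/matrixP => i j; rewrite mul_diag_mx mul_mx_diag !mxE.
  have [ij|ij] := eqVneq (i : nat) j; last by rewrite mulr0 mul0r.
  by rewrite mulr1 mul1r; congr lam; apply: val_inj.
move=> A kap Ainj AZ j; rewrite mxE.
(* Courant-Fischer: some [A *m u] is orthogonal to the first [j] left singular
   vectors. *)
pose M := (selmx R L j)^T *m U^T *m A.
have [u u0 Mu0] : exists2 u : 'cV[R]_K, u != 0 & M *m u = 0.
  have : kermx M^T != 0.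
    rewrite kermx_eq0 -row_leq_rank -ltnNge mxrank_tr.
    exact: leq_ltn_trans (rank_leq_row _) (ltn_ord j).
  case/rowV0Pn => v /sub_kermxP vM v0; exists v^T.
    by apply: contraNneq v0 => v0; rewrite -[v]trmxK v0 trmx0.
  by apply: trmx_inj; rewrite trmx_mul trmxK vM trmx0.
pose y := U^T *m (A *m u).
have y0 (i : 'I_L) : (i < j)%N -> y i 0 = 0.
  move=> ij; rewrite -(selmxT_mul y ij) /y.
  by have -> : (selmx R L j)^T *m (U^T *m (A *m u)) = 0; rewrite ?mxE// !mulmxA.
have yn : sqnorm y = sqnorm (A *m u).
  by rewrite !sqnorm_mx /y trmx_mul trmxK -mulmxA (mulmxA U) UU' mul1mx.
have := AZ u; rewrite sqnormE_mx ZZE.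
have -> : qform (U *m diag_mx (\row_i lam i) *m U^T) (A *m u) =
    \sum_i lam i * y i 0 ^+ 2.
  rewrite /qform !mulmxA.
  have -> : (A *m u)^T *m U = y^T by rewrite /y [RHS]trmx_mul trmxK.
  rewrite -mulmxA -[y^T *m _ *m U^T *m _]mulmxA -/y.
  rewrite mul_mx_diag mxE; apply: eq_bigr => i _; rewrite !mxE; ring.
have y2 : \sum_i lam i * y i 0 ^+ 2 <= lam (wj j) * sqnorm y.
  rewrite /sqnorm mulr_sumr; apply: ler_sum => i _.
  have [ij|ji] := ltnP i j; first by rewrite y0// expr0n /= !mulr0.
  by rewrite ler_wpM2r ?sqr_ge0// lam_le.
move=> H; have := le_trans H y2; rewrite yn ler_pM2r//.
by rewrite sqnorm_gt0; exact: Ainj.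
Qed.

End TopSingularVectors.

(** * Deterministic error bounds for the estimated loadings *)

Section Perturbation.
Variables (R : realType) (L T K : nat).
Variables (Gam : 'M[R]_(L, K)) (Fd : 'M[R]_(K, T)) (Ed : 'M[R]_(L, T))
  (G : 'M[R]_(L, K)).
Let Z := Gam *m Fd + Ed.
Hypotheses (KL : (K <= L)%N) (GZ : topk_left_sv Z G).
Let tF := invmx (G^T *m G) *m G^T *m Z.
Let HG := Fd *m tF^T *m invmx (tF *m tF^T).

Variables (c1 lam q : R) (Sf : 'M[R]_K).
Hypotheses (c10 : 0 < c1) (lam0 : 0 < lam) (q0 : 0 < q).
Hypothesis Gam_low : forall u, c1 * sqnorm u <= qform (Gam^T *m Gam) u.
Hypothesis Sf_low : forall u, lam * sqnorm u <= qform Sf u.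
Hypothesis Ff_close : frob (q^-1 *: (Fd *m Fd^T) - Sf) <= lam / 2.
Hypothesis Ed_small : frob2 Ed <= c1 * lam / 16 * q.
Let kap := c1 * lam / 8.

Let kap0 : 0 < kap. Proof. by rewrite /kap divr_gt0// mulr_gt0. Qed.
Let kq0 : 0 < kap * q. Proof. exact: mulr_gt0. Qed.

Lemma Gam_injective (u : 'cV[R]_K) : u != 0 -> Gam *m u != 0.
Proof.
move=> u0; apply: contraTneq (Gam_low u) => Gu.
have -> : qform (Gam^T *m Gam) u = sqnorm (Gam *m u).
  by rewrite sqnorm_mx /qform trmx_mul !mulmxA.
rewrite Gu -ltNge sqnorm_frob -sqr_frob frob0 expr0n /=.
by rewrite mulr_gt0// sqnorm_gt0.
Qed.

(** Origin of [kap], in units of [q * sqnorm v]: by [|x + y|^2 >= |x|^2 / 2 - |y|^2], the signal, at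
    least [c1 * lam / 2] since [Sf] is approximated within [lam / 2], counts for half, and the noise
    takes away at most [c1 * lam / 16]. The [3 / 16] left over exceeds [1 / 8]. *)
Lemma signal_low (u : 'cV[R]_K) :
  kap * q * sqnorm (Gam *m u) <= sqnorm (Z^T *m (Gam *m u)).
Proof.
set v := Gam *m u.
have v2 : qform (Gam^T *m Gam) u = sqnorm v.
  by rewrite sqnorm_mx /qform trmx_mul !mulmxA.
have Gv : c1 * sqnorm v <= sqnorm (Gam^T *m v).
  have [v0|vn0] := eqVneq (sqnorm v) 0; first by rewrite v0 mulr0 sqnorm_ge0.
  have vp : 0 < sqnorm v by rewrite lt_neqAle eq_sym vn0 sqnorm_ge0.
  (* Cauchy-Schwarz for [|v|^2 = <u, Gam^T v>], together with
     [c1 |u|^2 <= |v|^2]. *)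
  have cs : sqnorm v ^+ 2 <= sqnorm u * sqnorm (Gam^T *m v).
    have -> : sqnorm v = \sum_i u i 0 * (Gam^T *m v) i 0.
      rewrite sqnorm_mx /v trmx_mul -!mulmxA mxE.
      by apply: eq_bigr => i _; rewrite mxE.
    exact: cauchy_schwarz.
  have uv : c1 * sqnorm u <= sqnorm v by rewrite -v2.
  rewrite -(ler_pM2r vp); apply: le_trans (_ : c1 * (sqnorm u * sqnorm (Gam^T *m v)) <= _).
    by rewrite -mulrA -expr2 ler_wpM2l// ltW.
  by rewrite mulrA [X in _ <= X]mulrC ler_wpM2r ?sqnorm_ge0.
have -> : Z^T *m v = Fd^T *m (Gam^T *m v) + Ed^T *m v.
  by rewrite /Z linearD /= trmx_mul mulmxDl mulmxA.
set x := Fd^T *m _; set y := Ed^T *m v.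
have xy : sqnorm x / 2 - sqnorm y <= sqnorm (x + y).
  rewrite -subr_ge0.
  have -> : sqnorm (x + y) - (sqnorm x / 2 - sqnorm y) =
      \sum_i (x i 0 + y i 0 *+ 2) ^+ 2 / 2.
    rewrite /sqnorm mulr_suml -!sumrB; apply: eq_bigr => i _.
    by rewrite [(x + y) i 0]mxE mulr2n; field.
  by apply: sumr_ge0 => i _; rewrite divr_ge0// sqr_ge0.
have yle : sqnorm y <= c1 * lam / 16 * q * sqnorm v.
  rewrite sqnorm_frob; apply: le_trans (frob2M _ _) _; rewrite frob2T -sqnorm_frob.
  by rewrite ler_wpM2r ?sqnorm_ge0.
have xge : lam / 2 * q * (c1 * sqnorm v) <= sqnorm x.
  apply: le_trans (_ : lam / 2 * q * sqnorm (Gam^T *m v) <= _).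
    by rewrite ler_wpM2l// mulr_ge0 ?divr_ge0// ltW.
  rewrite /x (sqnormE_mx Fd); set z := Gam^T *m v.
  have -> : Fd *m Fd^T = q *: (q^-1 *: (Fd *m Fd^T)).
    by rewrite scalerA mulfV ?scale1r// gt_eqF.
  set W := q^-1 *: _; have Wc : frob (W - Sf) <= lam / 2 by exact: Ff_close.
  have -> : qform (q *: W) z = q * qform W z.
    by rewrite /qform -scalemxAr -scalemxAl mxE.
  rewrite mulrAC [X in _ <= X]mulrC ler_pM2r//.
  have -> : W = (W - Sf) + Sf by rewrite subrK.
  have -> : qform (W - Sf + Sf) z = qform (W - Sf) z + qform Sf z.
    by rewrite qformB subrK /qform subrK.
  have h1 : - (lam / 2 * sqnorm z) <= qform (W - Sf) z.
    rewrite lerNl; apply: le_trans (ler_norm _) _; rewrite normrN.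
    apply: le_trans (qform_le_frob _ _) _; rewrite ler_wpM2r ?sqnorm_ge0//.
  have h2 := Sf_low z.
  by move: h1 h2; set s := sqnorm z; lra.
apply: le_trans xy; move: xge yle; rewrite /kap.
set s := sqnorm v; set sx := sqnorm x; set sy := sqnorm y => xge yle.
have s0 : 0 <= c1 * lam * q * s by rewrite !mulr_ge0 ?sqnorm_ge0// ltW.
by lra.
Qed.

Lemma perturbation_diag : exists D : 'rV[R]_K,
  [/\ forall j, kap * q <= D 0 j, tF = G^T *m Z,
      tF *m tF^T = diag_mx D & Z *m tF^T = G *m diag_mx D].
Proof.
have [D [DE Dlow]] := topk_eigen KL GZ.
have GG := topk_ortho KL GZ.
have tFE : tF = G^T *m Z by rewrite /tF GG invmx1 mul1mx.
have ZtF : Z *m tF^T = G *m diag_mx D by rewrite tFE trmx_mul trmxK mulmxA.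
exists D; split => //.
  by move=> j; apply: (Dlow Gam) => [u /Gam_injective|u] //; exact: signal_low.
by rewrite {1}tFE -mulmxA ZtF mulmxA GG mul1mx.
Qed.

Let Dinv := invmx (tF *m tF^T).

Lemma Dinv_spec : exists2 r : 'rV[R]_K, Dinv = diag_mx r &
  forall j, 0 <= r 0 j <= (kap * q)^-1.
Proof.
have [D [Dlow _ DE _]] := perturbation_diag.
have Dp j : 0 < D 0 j by exact: lt_le_trans (Dlow j).
exists (\row_j (D 0 j)^-1); last first.
  move=> j; rewrite mxE invr_ge0 ltW//= lef_pV2 ?posrE//.
have H : diag_mx (\row_j (D 0 j)^-1) *m diag_mx D = 1%:M.
  apply/matrixP => i j; rewrite mul_diag_mx !mxE.
  by case: eqP => [->|]; rewrite ?mulr1n ?mulr0n ?mulr0// mulVf// gt_eqF.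
rewrite /Dinv DE.
have [_ Du] := mulmx1_unit H.
by rewrite -[LHS]mul1mx -H -mulmxA mulmxV// mulmx1.
Qed.

Lemma frob_Dinv_mul p (A : 'M[R]_(K, p)) :
  frob (Dinv *m A) <= frob A / (kap * q).
Proof.
have [r -> rle] := Dinv_spec.
rewrite -(@ler_pXn2r _ 2)// ?nnegrE ?divr_ge0 ?frob_ge0 ?(ltW kq0)//.
rewrite exprMn !sqr_frob /frob2 mulr_suml; apply: ler_sum => i _.
rewrite mulr_suml; apply: ler_sum => j _.
rewrite mul_diag_mx mxE exprMn mulrC ler_wpM2l ?sqr_ge0//.
by have /andP[? ?] := rle i; rewrite ler_pXn2r// nnegrE// invr_ge0 ltW.
Qed.

Lemma Dinv_sym : Dinv^T = Dinv.
Proof. by have [r -> _] := Dinv_spec; rewrite tr_diag_mx. Qed.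

Lemma frob_mul_Dinv p (A : 'M[R]_(p, K)) :
  frob (A *m Dinv) <= frob A / (kap * q).
Proof. by rewrite -frobT trmx_mul Dinv_sym -(frobT A) frob_Dinv_mul. Qed.

Let Del := G - Gam *m HG.

Lemma tFT : tF^T = Fd^T *m (Gam^T *m G) + Ed^T *m G.
Proof.
have [D [_ -> _ _]] := perturbation_diag.
by rewrite trmx_mul trmxK /Z linearD /= trmx_mul mulmxDl mulmxA.
Qed.

(** [G] and [HG] are regression coefficients on the same estimate [tF], the former of [Z], the
    latter of [Fd]; hence [Del] is the regression coefficient of the noise alone. *)
Lemma DelE : Del = Ed *m tF^T *m Dinv.
Proof.
have [D [Dlow tFE DE ZtF]] := perturbation_diag.
have Du : tF *m tF^T \in unitmx.
  rewrite DE unitmxE det_diag unitfE; apply/prodf_neq0 => j _.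
  by rewrite gt_eqF//; exact: lt_le_trans (Dlow j).
have GE : G = Z *m tF^T *m Dinv by rewrite ZtF -DE mulmxK.
have HGE : HG = Fd *m tF^T *m Dinv by [].
rewrite /Del {1}GE HGE /Z [(_ + Ed) *m _]mulmxDl mulmxDl !mulmxA.
by rewrite addrAC subrr add0r.
Qed.

Lemma loading_error (e : 'cV[R]_L) : G^T *m e - HG^T *m (Gam^T *m e) =
  q *: (Dinv *m G^T *m Gam) *m (q^-1 *: (Fd *m Ed^T *m e)) +
  Dinv *m (G^T *m (Ed *m (Ed^T *m e))).
Proof.
have -> : G^T *m e - HG^T *m (Gam^T *m e) = Del^T *m e.
  by rewrite /Del [in RHS]linearB /= mulmxBl (trmx_mul Gam HG) mulmxA.
rewrite DelE (trmx_mul (Ed *m tF^T) Dinv) (trmx_mul Ed tF^T) trmxK Dinv_sym.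
have [D [_ tFE _ _]] := perturbation_diag.
rewrite -scalemxAl -scalemxAr scalerA mulfV ?scale1r ?gt_eqF//.
by rewrite tFE /Z mulmxDr mulmxDl mulmxDr mulmxDl !mulmxA.
Qed.

(** Inserting [tF = G^T *m Z] into [HG^T = Dinv *m (tF *m Fd^T)] makes the slope appear against
    [Fd *m Fd^T]. This identifies its limit from those of [HG] and of the factor moments, without
    separate limits for [Dinv] and [G^T *m Gam]. *)
Lemma slope_equation : q *: (Dinv *m G^T *m Gam) *m Sf =
  HG^T - Dinv *m (G^T *m (Ed *m Fd^T)) -
  q *: (Dinv *m G^T *m Gam) *m (q^-1 *: (Fd *m Fd^T) - Sf).
Proof.
have -> : HG^T = Dinv *m (tF *m Fd^T) 
  by rewrite (trmx_mul (Fd *m tF^T) Dinv) (trmx_mul Fd tF^T) trmxK Dinv_sym.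
have [D [_ tFE _ _]] := perturbation_diag.
have -> : q *: (Dinv *m G^T *m Gam) *m (q^-1 *: (Fd *m Fd^T) - Sf) =
    Dinv *m G^T *m Gam *m (Fd *m Fd^T) - q *: (Dinv *m G^T *m Gam) *m Sf.
  rewrite mulmxBr; congr (_ - _).
  by rewrite -scalemxAl -scalemxAr scalerA mulfV ?scale1r// gt_eqF.
rewrite tFE /Z [G^T *m (_ + _)]mulmxDr [(_ + _) *m Fd^T]mulmxDl mulmxDr !mulmxA.
by rewrite addrK opprB addrC subrK.
Qed.

Variables (e : 'cV[R]_L) (ga k2 h a b c dd : R).
Hypotheses (ga_ge : frob Gam <= ga) (h_ge : frob HG <= h)
  (k2_ge : frob G <= k2)
  (a_ge : frob Ed <= a) (b_ge : frob (Gam^T *m Ed) <= b)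
  (c_ge : frob (Ed^T *m e) <= c) (dd_ge : frob (Ed *m Fd^T) <= dd).

(** Writing [G = Gam *m HG + Del] inside [DelE] leaves a term [Ed *m Ed^T *m Del]. The constant
    [1 / 16] in [Ed_small] makes [frob Ed ^+ 2] at most [kap * q / 2], so this term is at most half
    of [frob Del]; absorbing it costs the factor 2. *)
Lemma Del_bound : frob Del <= (dd * ga * k2 + a * b * h) / (kap * q) *+ 2.
Proof.
have Ed_sq : frob Ed ^+ 2 <= kap * q / 2.
  by rewrite sqr_frob; apply: le_trans Ed_small _; rewrite /kap; lra.
have GE : G = Gam *m HG + Del by rewrite /Del addrC subrK.
have main : frob Del <= (dd * ga * k2 + a * b * h + kap * q / 2 * frob Del) / (kap * q).
  rewrite {1}DelE; apply: le_trans (frob_mul_Dinv _) _.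
  rewrite ler_pM2r ?invr_gt0// tFT mulmxDr.
  have -> : Ed *m (Ed^T *m G) = Ed *m (Ed^T *m Gam) *m HG + Ed *m (Ed^T *m Del).
    by rewrite {1}GE mulmxDr mulmxDr !mulmxA.
  rewrite addrA; apply: le_trans (frobD _ _) _; apply: lerD.
    apply: le_trans (frobD _ _) _; apply: lerD.
      rewrite !mulmxA; apply: le_trans (frobM _ _) _.
      apply: ler_pM; rewrite ?frob_ge0//.
      apply: le_trans (frobM _ _) _; rewrite frobT.
      by apply: ler_pM; rewrite ?frob_ge0.
    apply: le_trans (frobM _ _) _; apply: ler_pM; rewrite ?frob_ge0//.
    apply: le_trans (frobM _ _) _; apply: ler_pM; rewrite ?frob_ge0//.
    by rewrite -frobT trmx_mul trmxK.
  rewrite mulmxA; apply: le_trans (frobM _ _) _; rewrite ler_wpM2r ?frob_ge0//.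
  by apply: le_trans (frobM _ _) _; rewrite frobT -expr2.
move: main; rewrite ler_pdivlMr// => main.
rewrite -mulr_natr mulrAC ler_pdivlMr//.
by move: main; set x := frob Del; set y := kap * q; lra.
Qed.

(** Splitting [G] as [Gam *m HG + Del] brings in the small product [Gam^T *m Ed], bounded by [b];
    the full noise [Ed], bounded by [a], is met only by the small factor [Del]. *)
Lemma remainder_bound : frob (Dinv *m (G^T *m (Ed *m (Ed^T *m e)))) <=
  (h * b * c + (dd * ga * k2 + a * b * h) / (kap * q) *+ 2 * a * c) / (kap * q).
Proof.
apply: le_trans (frob_Dinv_mul _) _; rewrite ler_pM2r ?invr_gt0//.
have -> : G = Gam *m HG + Del by rewrite /Del addrC subrK.
rewrite linearD /= trmx_mul mulmxDl; apply: le_trans (frobD _ _) _; apply: lerD.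
  rewrite !mulmxA -!mulmxA.
  apply: le_trans (frobM _ _) _; rewrite frobT -mulrA.
  apply: ler_pM; rewrite ?frob_ge0//.
  rewrite mulmxA; apply: le_trans (frobM _ _) _.
  by apply: ler_pM; rewrite ?frob_ge0.
apply: le_trans (frobM _ _) _; rewrite frobT -mulrA.
apply: ler_pM; rewrite ?frob_ge0//; first exact: Del_bound.
by apply: le_trans (frobM _ _) _; apply: ler_pM; rewrite ?frob_ge0.
Qed.

Lemma slope_bound : frob (q *: (Dinv *m G^T *m Gam)) <= k2 * ga / kap.
Proof.
rewrite frobZ (gtr0_norm q0) -mulmxA.
apply: le_trans (_ : q * (frob (G^T *m Gam) / (kap * q)) <= _).
  by rewrite ler_pM2l// frob_Dinv_mul.
have -> : q * (frob (G^T *m Gam) / (kap * q)) = frob (G^T *m Gam) / kap.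
  by field; rewrite !gt_eqF.
rewrite ler_pM2r ?invr_gt0//; apply: le_trans (frobM _ _) _; rewrite frobT.
by apply: ler_pM; rewrite ?frob_ge0.
Qed.

Lemma slope_limit_bound (H : 'M[R]_K) : Sf \in unitmx ->
  frob (q *: (Dinv *m G^T *m Gam) - H^T *m invmx Sf) <=
  (frob (HG - H) + k2 * dd / (kap * q) +
   k2 * ga / kap * frob (q^-1 *: (Fd *m Fd^T) - Sf)) * frob (invmx Sf).
Proof.
move=> Sfu; set M := q *: _.
have -> : M - H^T *m invmx Sf = (M *m Sf - H^T) *m invmx Sf.
  by rewrite mulmxBl mulmxK.
apply: le_trans (frobM _ _) _; rewrite ler_wpM2r ?frob_ge0//.
rewrite /M slope_equation -/M.
set A := Dinv *m _; set B := M *m _.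
have -> : HG^T - A - B - H^T = (HG - H)^T - A - B.
  by rewrite [(HG - H)^T]linearB /=; apply/matrixP => i j; rewrite !mxE; ring.
apply: le_trans (frobB _ _) _; apply: lerD.
  apply: le_trans (frobB _ _) _; rewrite frobT; apply: lerD => //.
  apply: le_trans (frob_Dinv_mul _) _; rewrite ler_pM2r ?invr_gt0//.
  apply: le_trans (frobM _ _) _; rewrite frobT.
  by apply: ler_pM; rewrite ?frob_ge0.
apply: le_trans (frobM _ _) _; rewrite ler_wpM2r ?frob_ge0//.
exact: slope_bound.
Qed.

End Perturbation.

(** * Algebra of the factor model *)

Section ModelAlgebra.
Variables (R : realType) (N L T K : nat).
Variables (X : 'I_T -> 'M[R]_(N, L)) (Gam : 'M[R]_(L, K)) (eta : 'cV[R]_L)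
  (Om : 'M[R]_(N, N - L)) (zeta : 'cV[R]_(N - L)) (xi : 'I_T -> 'cV[R]_(N - L))
  (f : 'I_T -> 'cV[R]_K) (E : 'I_T -> 'cV[R]_N).

Definition gram t : 'M[R]_L := (X t)^T *m X t.
Definition ols t : 'M[R]_(L, N) := invmx (gram t) *m (X t)^T.
Definition olsnoise : 'M[R]_(L, T) := \matrix_(i, t) (ols t *m E t) i 0.
(** Right multiplication by it subtracts the time average; for [T > 0] it is an orthogonal
    projection. *)
Definition centering : 'M[R]_T := 1%:M - (T%:R)^-1 *: const_mx 1.
(** The index is a natural number because [L] varies along the sequence while [l] stays fixed. The
    vector is zero when [l] is out of range, in agreement with [rowv]. *)
Definition unitcol (l : nat) : 'cV[R]_L := \col_i ((i : nat) == l)%:R.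

Local Notation Rd := (ddotRd X Gam eta Om zeta xi f E).
Local Notation Fd := (Fdmx X Gam eta f).
Local Notation Ed := (olsnoise *m centering).

Hypothesis T0 : (0 < T)%N.

Lemma mul_centering m (Y : 'M[R]_(m, T)) i t :
  (Y *m centering) i t = Y i t - (T%:R)^-1 * \sum_s Y i s.
Proof.
rewrite /centering mulmxBr mulmx1 -scalemxAr !mxE; congr (_ - _ * _).
by apply: eq_bigr => s _; rewrite mxE mulr1.
Qed.

Lemma centering_sym : centering^T = centering.
Proof. by rewrite /centering linearB /= tr_scalar_mx linearZ /= trmx_const. Qed.

Lemma const_centering m (v : 'cV[R]_m) :
  v *m (const_mx 1 : 'rV[R]_T) *m centering = 0.
Proof.
apply/matrixP => i t; rewrite mul_centering !mxE big_ord1 mxE mulr1.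
under eq_bigr do rewrite mxE big_ord1 mxE mulr1.
rewrite sumr_const card_ord -[v i _ *+ T]mulr_natl mulrA mulVf ?mul1r ?subrr//.
by rewrite pnatr_eq0 -lt0n.
Qed.

Lemma centering_idem : centering *m centering = centering.
Proof.
have -> : centering *m centering =
    centering - (T%:R)^-1 *: (const_mx 1 : 'cV[R]_T) *m (const_mx 1 : 'rV[R]_T) *m centering.
  rewrite {1}/centering mulmxBl mul1mx; congr (_ - _ *m _).
  by apply/matrixP => i j; rewrite !mxE big_ord1 !mxE !mulr1.
by rewrite const_centering subr0.
Qed.

Lemma frob_centering m (Y : 'M[R]_(m, T)) : frob (Y *m centering) <= frob Y.
Proof.
have H : frob2 (Y *m centering) <= frob Y * frob (Y *m centering).
  have -> : frob2 (Y *m centering) = mxdot Y (Y *m centering).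
    have -> : frob2 (Y *m centering) = mxdot (Y *m centering) (Y *m centering).
      by apply: eq_bigr => i _; apply: eq_bigr => j _; rewrite expr2.
    rewrite !mxdot_trace trmx_mul centering_sym -mulmxA mxtrace_mulC.
    by rewrite -!mulmxA centering_idem.
  exact: mxdot_le.
have [->|yn] := eqVneq (frob (Y *m centering)) 0; first exact: frob_ge0.
have yp : 0 < frob (Y *m centering) by rewrite lt_neqAle eq_sym yn frob_ge0.
by rewrite -(ler_pM2r yp) -expr2 sqr_frob.
Qed.

Lemma Fdmx_centering : Fd = (\matrix_(k, t) brevef X Gam eta f t k 0) *m centering.
Proof.
apply/matrixP => k t; rewrite mul_centering !mxE summxE; congr (_ - _ * _).
by apply: eq_bigr => s _; rewrite mxE.
Qed.

Lemma Fdmx_mul_centering : Fd *m centering = Fd.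
Proof. by rewrite Fdmx_centering -mulmxA centering_idem. Qed.

(** The factors are already demeaned, so demeaning the noise does not change its product with
    them. *)
Lemma olsnoise_Fd : Ed *m Fd^T = olsnoise *m Fd^T.
Proof. by rewrite -mulmxA -{1}centering_sym -trmx_mul Fdmx_mul_centering. Qed.

Hypothesis Xu : forall t, gram t \in unitmx.

Lemma ols_mul t : ols t *m X t = 1%:M.
Proof. by rewrite /ols -mulmxA mulVmx. Qed.

Lemma ols_proj t : ols t *m projmx (X t) = ols t.
Proof. by rewrite /projmx !mulmxA ols_mul mul1mx. Qed.

(** [ols t] is a left inverse of [X t], so it annihilates the range of [1%:M - projmx (X t)], which
    contains the outside alpha whatever square root enters it. The projected part of the inside
    alpha becomes [Gam] times the shift that turns [f] into [brevef]. *)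
Lemma ddotR_decomp t : ddotR X Gam eta Om zeta xi f E t =
  eta + Gam *m brevef X Gam eta f t + ols t *m E t.
Proof.
rewrite /ddotR -/(gram t) -/(ols t) /Ret mulmxDr; congr (_ + _).
rewrite !mulmxDr.
have -> : ols t *m alphaO X Om zeta xi t = 0.
  rewrite /alphaO /Bomx /Xomx !mulmxA mulmxBr mulmx1 ols_proj subrr.
  by rewrite !mul0mx.
rewrite add0r /alphaI /Bmx (mulmxA (ols t)) (mulmxA (ols t)) mulmxBr mulmx1.
rewrite mulmxBl ols_mul mulmxBl mul1mx -addrA; congr (_ + _).
rewrite !mulmxA ols_mul mul1mx mulmxN addrC; congr (_ - _).
by rewrite /projmx !trmx_mul !mulmxA.
Qed.

Lemma ddotRd_decomp : Rd = Gam *m Fd + Ed.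
Proof.
have -> : Rd = (\matrix_(i, t) ddotR X Gam eta Om zeta xi f E t i 0) *m centering.
  apply/matrixP => k t; rewrite mul_centering !mxE summxE; congr (_ - _ * _).
  by apply: eq_bigr => s _; rewrite mxE.
have -> : (\matrix_(i, t) ddotR X Gam eta Om zeta xi f E t i 0) =
    eta *m (const_mx 1 : 'rV[R]_T) + Gam *m (\matrix_(k, t) brevef X Gam eta f t k 0)
    + olsnoise.
  apply/matrixP => i t; rewrite mxE ddotR_decomp !mxE big_ord1 mxE mulr1.
  by congr (_ + _); congr (_ + _); apply: eq_bigr => k _; rewrite [in RHS]mxE.
by rewrite !mulmxDl const_centering add0r Fdmx_centering mulmxA.
Qed.

Lemma rowv_unitcol m (A : 'M[R]_(L, m)) l : rowv A l = A^T *m unitcol l.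
Proof.
apply/matrixP => j j'; rewrite !mxE big_mkcond; apply: eq_bigr => i _.
by rewrite !mxE; case: eqP => _; rewrite ?mulr1 ?mulr0.
Qed.

Lemma coordv_unitcol (v : 'cV[R]_L) l : coordv v l = (v^T *m unitcol l) 0 0.
Proof.
rewrite /coordv mxE big_mkcond; apply: eq_bigr => i _.
by rewrite !mxE; case: eqP => _; rewrite ?mulr1 ?mulr0.
Qed.

Lemma frob_unitcol l : frob2 (unitcol l) <= 1.
Proof.
rewrite /frob2; under eq_bigr do rewrite big_ord1 mxE.
have [lL|Ll] := ltnP l L; last first.
  rewrite big1// => i _; rewrite (ltn_eqF (leq_trans (ltn_ord i) Ll)) expr0n//.
rewrite (bigD1 (Ordinal lL))//= eqxx expr1n big1 ?addr0// => i il.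
have -> : ((i : nat) == l) = false.
  by apply/negbTE; apply: contraNneq il => il; apply/eqP/val_inj.
by rewrite expr0n.
Qed.

Hypothesis N0 : (0 < N)%N.

(** The factor [N%:R] appears because [Qmx] is the Gram matrix divided by [N], while [ols] inverts
    the Gram matrix itself. *)
Lemma xf_statE l : xf_stat X Gam eta f E l =
  (Num.sqrt (N * T)%:R)^-1 *: (N%:R *: (Fd *m olsnoise^T *m unitcol l)).
Proof.
rewrite /xf_stat; congr (_ *: _); apply/matrixP => k k'.
rewrite summxE mxE -mulmxA mxE mulr_sumr ord1.
under eq_bigr do rewrite summxE.
rewrite exchange_big /=; apply: eq_bigr => t _.
have NR : (N%:R : R) != 0 by rewrite pnatr_eq0 -lt0n.
have QE : invmx (Qmx X t) = N%:R *: invmx (gram t).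
  rewrite /Qmx -/(gram t).
  have U : (N%:R)^-1 *: gram t \in unitmx.
    by rewrite unitmxZ ?Xu// unitfE invr_eq0.
  rewrite -[RHS]mulmx1 -(mulmxV U) mulmxA -scalemxAl -scalemxAr scalerA.
  by rewrite mulfV// scale1r mulVmx// mul1mx.
have HH c : (c *: col t Fd) k 0 = c * Fd k t by rewrite [LHS]mxE [col _ _ _ _]mxE.
under eq_bigr do rewrite HH.
rewrite -mulr_suml mulrC mulrCA; congr (_ * _).
have -> : (olsnoise^T *m unitcol l) t 0 = coordv (ols t *m E t) l.
  rewrite coordv_unitcol !mxE; apply: eq_bigr => i _; rewrite !mxE.
  by congr (_ * _); apply: eq_bigr => j _; rewrite !mxE.
rewrite QE /coordv mulr_sumr.
under eq_bigr do rewrite mulr_suml.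
rewrite exchange_big /=; apply: eq_bigr => i _.
rewrite [in RHS]mxE mulr_sumr; apply: eq_bigr => j _.
by rewrite -scalemxAl /ols !mxE -!mulrA; congr (_ * (_ * _)); apply: eq_bigr => ? _; rewrite !mxE.
Qed.

End ModelAlgebra.

(** * Expansion of the scaled loading error with explicit rates *)

Section Expansion.
Variables (R : realType) (N L T K : nat).
Variables (X : 'I_T -> 'M[R]_(N, L)) (Gam : 'M[R]_(L, K)) (eta : 'cV[R]_L)
  (Om : 'M[R]_(N, N - L)) (zeta : 'cV[R]_(N - L)) (xi : 'I_T -> 'cV[R]_(N - L))
  (f : 'I_T -> 'cV[R]_K) (E : 'I_T -> 'cV[R]_N) (G : 'M[R]_(L, K)) (l : nat).
Local Notation Rd := (ddotRd X Gam eta Om zeta xi f E).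
Local Notation Fd := (Fdmx X Gam eta f).
Local Notation Ec := (olsnoise X E).
Local Notation HG := (HGam X Gam eta Om zeta xi f E G).

Variables (c1 lam m h ga : R) (Sf H : 'M[R]_K).
Let kap := c1 * lam / 8.
Let rho := Num.sqrt (L%:R / N%:R : R).
Let nu := (Num.sqrt (N%:R : R))^-1.
Let tau := Num.sqrt (T%:R : R).

Hypotheses (T0 : (0 < T)%N) (N0 : (0 < N)%N) (KL : (K <= L)%N).
Hypotheses (c10 : 0 < c1) (lam0 : 0 < lam) (m0 : 0 <= m).
Hypothesis Xu : forall t, gram X t \in unitmx.
Hypothesis GZ : topk_left_sv Rd G.
Hypothesis Gam_low : forall u, c1 * sqnorm u <= qform (Gam^T *m Gam) u.
Hypothesis Sf_low : forall u, lam * sqnorm u <= qform Sf u.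
Hypothesis Ff_close : frob ((T%:R)^-1 *: (Fd *m Fd^T) - Sf) <= lam / 2.
Hypothesis m_small : m ^+ 2 * rho ^+ 2 <= c1 * lam / 16.
Hypothesis ga_ge : frob Gam <= ga.
Hypothesis h_ge : frob HG <= h.
Hypothesis Ec_bound : frob Ec <= m * tau * rho.
Hypothesis GamEc_bound : frob (Gam^T *m Ec) <= m * tau * nu.
Hypothesis lEc_bound : frob ((unitcol R L l)^T *m Ec) <= m * tau * nu.
Hypothesis EcFd_bound : frob (Ec *m Fd^T) <= m * tau * rho.

Let k2 := Num.sqrt (K%:R : R).

(** The scaling is [tau / nu], so the part [Gam *m HG] of [G] leaves [sqrt (T / N)], while the two
    terms in the bound for [Del] leave [L / N] and [sqrt (T / N) * (L / N)]. In the slope, noise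
    against factors leaves [rho / tau], which is at most [rho] since [1 <= tau]. *)
Lemma gamma_stat_expansion : exists (M : 'M[R]_K) (r : 'cV[R]_K),
  [/\ gamma_stat X Gam eta Om zeta xi f E G l =
        M *m xf_stat X Gam eta f E l + r,
      frob r <= h * m ^+ 2 / kap * (tau * nu) +
        2 * k2 * ga * m ^+ 3 / kap ^+ 2 * rho ^+ 2 +
        2 * h * m ^+ 4 / kap ^+ 2 * (tau * nu * rho ^+ 2) &
      frob (M - H^T *m invmx Sf) <=
        (frob (HG - H) + k2 * m * rho / kap +
         k2 * ga / kap * frob ((T%:R)^-1 *: (Fd *m Fd^T) - Sf)) *
        frob (invmx Sf)].
Proof.
have kap0 : 0 < kap by rewrite /kap divr_gt0// mulr_gt0.
have TR : (0 : R) < T%:R by rewrite ltr0n.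
have NR : (0 : R) < N%:R by rewrite ltr0n.
have tau2 : tau ^+ 2 = T%:R by rewrite sqr_sqrtr// ltW.
have tau0 : 0 < tau by rewrite sqrtr_gt0.
have nu0 : 0 < nu by rewrite invr_gt0 sqrtr_gt0.
have rho0 : 0 <= rho by rewrite sqrtr_ge0.
have tau1 : 1 <= tau by rewrite -(sqrtr1 R) ler_wsqrtr// ler1n.
pose J : 'M[R]_T := centering R T; pose Ed := Ec *m J.
have ZE : Rd = Gam *m Fd + Ed by exact: ddotRd_decomp.
have GZ' : topk_left_sv (Gam *m Fd + Ed) G by rewrite -ZE.
have Sfu : Sf \in unitmx.
  apply: qform_unitmx => v v0; rewrite gt_eqF//; apply: lt_le_trans (Sf_low v).
  by rewrite mulr_gt0// sqnorm_gt0.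
have Ed_a : frob Ed <= m * tau * rho by apply: le_trans (frob_centering T0 _) _.
have Ed_b : frob (Gam^T *m Ed) <= m * tau * nu.
  by rewrite /Ed mulmxA; apply: le_trans (frob_centering T0 _) _.
have Ed_c : frob (Ed^T *m unitcol R L l) <= m * tau * nu.
  rewrite -frobT trmx_mul trmxK /Ed mulmxA.
  by apply: le_trans (frob_centering T0 _) _.
have EdFd : Ed *m Fd^T = Ec *m Fd^T by exact: olsnoise_Fd.
have Ed_d : frob (Ed *m Fd^T) <= m * tau * rho by rewrite EdFd.
have Ed_small : frob2 Ed <= c1 * lam / 16 * T%:R.
  rewrite -sqr_frob; apply: le_trans (_ : (m * tau * rho) ^+ 2 <= _).
    by rewrite ler_pXn2r ?nnegrE ?frob_ge0 ?mulr_ge0// ltW.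
  rewrite !exprMn tau2 mulrAC; apply: ler_wpM2r => //; exact: ltW.
have k2G : frob G <= k2 by rewrite /frob (frob2_ortho (topk_ortho KL GZ)).
have HGE : HG = let tF := invmx (G^T *m G) *m G^T *m (Gam *m Fd + Ed) in
    Fd *m tF^T *m invmx (tF *m tF^T) by rewrite /HGam /tFdmx ZE.
set tF := invmx (G^T *m G) *m G^T *m (Gam *m Fd + Ed) in HGE.
have h_ge' := h_ge; rewrite HGE /= in h_ge'.
have le := loading_error KL GZ' c10 lam0 TR Gam_low Sf_low Ff_close Ed_small
  (unitcol R L l).
have rb := remainder_bound KL GZ' c10 lam0 TR Gam_low Sf_low Ff_close Ed_small
  ga_ge h_ge' k2G Ed_a Ed_b Ed_c Ed_d.
have sb := slope_limit_bound KL GZ' c10 lam0 TR Gam_low Sf_low Ff_close Ed_small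
  ga_ge k2G Ed_d H Sfu.
rewrite -/tF in le rb sb; set Di := invmx (tF *m tF^T) in le rb sb.
pose s := Num.sqrt ((N * T)%:R : R).
have sE : s = tau / nu by rewrite /s natrM sqrtrM ?ler0n// invrK mulrC.
have s0 : 0 < s by rewrite sE divr_gt0.
exists (T%:R *: (Di *m G^T *m Gam)).
exists (s *: (Di *m (G^T *m (Ed *m (Ed^T *m unitcol R L l))))); split.
- rewrite /gamma_stat !rowv_unitcol HGE /= -/tF -/Di -/s le scalerDr; congr (_ + _).
  rewrite scalemxAr; congr (_ *m _); rewrite xf_statE// -/s !scalerA.
  have -> : Fd *m Ed^T *m unitcol R L l = Fd *m Ec^T *m unitcol R L l.
    by congr (_ *m _); apply: trmx_inj; rewrite !trmx_mul !trmxK EdFd.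
  congr (_ *: _).
  have s2 : s ^+ 2 = N%:R * T%:R by rewrite sqr_sqrtr ?ler0n// natrM.
  apply: (mulfI (lt0r_neq0 s0)); apply: (mulIf (lt0r_neq0 TR)).
  by rewrite mulrA -expr2 s2 mulrA mulfV ?gt_eqF// mul1r mulfVK ?gt_eqF.
- rewrite frobZ gtr0_norm//; apply: le_trans (ler_wpM2l (ltW s0) rb) _.
  rewrite -/kap sE -tau2 le_eqVlt; apply/orP; left; apply/eqP.
  by rewrite mulr2n; field; rewrite !gt_eqF.
- rewrite HGE /= -/tF; apply: le_trans sb _; rewrite -/kap.
  rewrite ler_wpM2r ?frob_ge0// lerD2r lerD2l -tau2.
  have -> : k2 * (m * tau * rho) / (kap * tau ^+ 2) = k2 * m * rho / kap / tau.
    by field; rewrite !gt_eqF.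
  by rewrite ler_pdivrMr// ler_peMr// divr_ge0 ?(ltW kap0)// !mulr_ge0// sqrtr_ge0.
Qed.

(** Collects the coefficients once every vanishing quantity is replaced by one [e1 <= 1]. It does
    not involve the sample sizes, which allows [e1] to be chosen before them. *)
Definition expansion_constant : R :=
  (1 + k2 * m / kap + k2 * ga / kap) * frob (invmx Sf) * m +
  (h * m ^+ 2 / kap + 2 * k2 * ga * m ^+ 3 / kap ^+ 2 +
   2 * h * m ^+ 4 / kap ^+ 2).

Lemma gamma_stat_approx e1 : e1 <= 1 -> rho <= e1 -> tau * nu <= e1 ->
  frob (HG - H) <= e1 ->
  frob ((T%:R)^-1 *: (Fd *m Fd^T) - Sf) <= e1 ->
  frob (xf_stat X Gam eta f E l) <= m ->
  frob (H^T *m invmx Sf *m xf_stat X Gam eta f E l -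
        gamma_stat X Gam eta Om zeta xi f E G l) <= expansion_constant * e1.
Proof.
move=> e11 re tne He Fe xm.
have [M [r [-> rle Mle]]] := gamma_stat_expansion.
have kap0 : 0 < kap by rewrite /kap divr_gt0// mulr_gt0.
have rho0 : 0 <= rho by rewrite sqrtr_ge0.
have e10 : 0 <= e1 := le_trans rho0 re.
have tn0 : 0 <= tau * nu by rewrite mulr_ge0 ?invr_ge0 ?sqrtr_ge0.
have rho2 : rho ^+ 2 <= e1.
  by rewrite expr2; apply: le_trans (ler_pM rho0 rho0 re re) _; rewrite ler_piMr.
have tnr : tau * nu * rho ^+ 2 <= e1.
  apply: le_trans (ler_pM tn0 (sqr_ge0 _) tne rho2) _; by rewrite ler_piMr.
have h0 : 0 <= h := le_trans (frob_ge0 _) h_ge.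
have ga0 : 0 <= ga := le_trans (frob_ge0 _) ga_ge.
have k20 : 0 <= k2 by rewrite sqrtr_ge0.
set x := xf_stat _ _ _ _ _ _ in xm *.
have -> : H^T *m invmx Sf *m x - (M *m x + r) = - ((M - H^T *m invmx Sf) *m x + r).
  by rewrite mulmxBl [in RHS]opprD opprB [in LHS]opprD addrA.
rewrite frobN; apply: le_trans (frobD _ _) _.
rewrite /expansion_constant mulrDl; apply: lerD.
  apply: le_trans (frobM _ _) _.
  rewrite mulrAC; apply: ler_pM; rewrite ?frob_ge0//.
  apply: le_trans Mle _; rewrite [X in _ <= X]mulrAC ler_wpM2r ?frob_ge0//.
  rewrite !mulrDl mul1r; apply: lerD.
    apply: lerD => //.
    have -> : k2 * m * rho / kap = k2 * m / kap * rho by ring.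
    by apply: ler_wpM2l => //; rewrite divr_ge0 ?mulr_ge0// ltW.
  by apply: ler_wpM2l => //; rewrite divr_ge0 ?mulr_ge0// ltW.
apply: le_trans rle _; rewrite [X in _ <= X]mulrDl [X in _ <= X + _]mulrDl.
apply: lerD; first apply: lerD.
- by apply: ler_wpM2l => //; rewrite divr_ge0 ?mulr_ge0 ?exprn_ge0// ltW.
- by apply: ler_wpM2l => //; rewrite divr_ge0 ?exprn_ge0 ?(ltW kap0)// !mulr_ge0 ?exprn_ge0.
- by apply: ler_wpM2l => //; rewrite divr_ge0 ?exprn_ge0 ?(ltW kap0)// !mulr_ge0 ?exprn_ge0.
Qed.

End Expansion.

(** * Moment bounds for the projected errors *)

Section EigenvalueEvents.
Variable R : realType.

Lemma qform_eigs_in n (M : 'M[R]_n) a b : M^T = M ->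
  eigs_in M a b <->
  (forall v, v != 0 -> a * sqnorm v < qform M v < b * sqnorm v).
Proof.
move=> Ms; split => [ev v v0|H x /eigenvalueP[u uM u0]].
  exact: eigs_in_qform.
have u0' : u^T != 0 by apply: contraNneq u0 => u0; rewrite -[u]trmxK u0 trmx0.
have := H _ u0'; have -> : qform M u^T = x * sqnorm u^T.
  by rewrite sqnorm_mx trmxK /qform trmxK uM -scalemxAl mxE.
by rewrite !ltr_pM2r ?sqnorm_gt0.
Qed.

(** By compactness of the sphere the strict bounds hold with margins [c] and [c'], and a
    perturbation smaller than both in Frobenius norm preserves them. Openness yields measurability
    of the eigenvalue event, whose definition quantifies over uncountably many reals. *)
Lemma qform_gt_open n (a b : R) : open [set M : 'M[R]_n |
  forall v, v != 0 -> a * sqnorm v < qform M v < b * sqnorm v].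
Proof.
case: n => [|n].
  rewrite (_ : [set _ | _] = setT); first exact: openT.
  by apply/seteqP; split => // M _ v; case/eqP; apply/matrixP => -[].
have gap (M : 'M[R]_n.+1) : (forall v, v != 0 -> 0 < qform M v) ->
    exists2 c, 0 < c & forall v, c * sqnorm v <= qform M v.
  move=> Mp; have [v0 [v01 vmin]] := qform_min M.
  by exists (qform M v0) => //; apply: Mp; rewrite -sqnorm_eq0 v01 oner_eq0.
apply: open_frobP => M HM.
have [|c c0 Hc] := gap (M - a%:M).
  by move=> v v0; rewrite qformB qform_scalar subr_gt0; have /andP[] := HM v v0.
have [|c' c'0 Hc'] := gap (b%:M - M).
  by move=> v v0; rewrite qformB qform_scalar subr_gt0; have /andP[] := HM v v0.
exists (Num.min c c'); first by rewrite lt_min c0.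
move=> B; rewrite lt_min => /andP[Bc Bc'] v v0.
have vp : 0 < sqnorm v by rewrite sqnorm_gt0.
have := qform_le_frob (B - M) v; rewrite ler_norml qformB => /andP[h1 h2].
have := Hc v; rewrite qformB qform_scalar => h3.
have := Hc' v; rewrite qformB qform_scalar => h4.
have h5 : frob (B - M) * sqnorm v < c * sqnorm v by rewrite ltr_pM2r.
have h6 : frob (B - M) * sqnorm v < c' * sqnorm v by rewrite ltr_pM2r.
move: h1 h2 h3 h4 h5 h6; set s := sqnorm v; set F := frob _ * s.
by move=> *; apply/andP; split; lra.
Qed.

Lemma eigs_in_measurable (d : measure_display) (T : measurableType d) n
    (M : T -> 'M[R]_n) a b : mfmx M -> (forall w, (M w)^T = M w) ->
  measurable [set w | eigs_in (M w) a b].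
Proof.
move=> mM Ms; have := mfmx_open mM (@qform_gt_open n a b).
congr (measurable _); apply/seteqP; split => w /=.
  by move=> H; apply/qform_eigs_in.
by move=> H; apply/qform_eigs_in.
Qed.

End EigenvalueEvents.

Section OlsBound.
Variables (R : realType) (N L T : nat) (X : 'I_T -> 'M[R]_(N, L)).
Variables (c1 c2 : R).
Hypotheses (c10 : 0 < c1) (N0 : (0 < N)%N).

Lemma gram_sym t : (gram X t)^T = gram X t.
Proof. by rewrite /gram trmx_mul trmxK. Qed.

Lemma Qmx_sym t : (Qmx X t)^T = Qmx X t.
Proof. by rewrite /Qmx -/(gram X t) linearZ /= gram_sym. Qed.

Lemma gram_low t u : eigs_in (Qmx X t) c1 c2 ->
  N%:R * c1 * sqnorm u <= qform (gram X t) u.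
Proof.
move=> ev; have NR : (0 : R) < N%:R by rewrite ltr0n.
have /andP[+ _] := eigs_in_qform_le u (Qmx_sym t) ev.
rewrite /Qmx -/(gram X t) /qform -scalemxAr -scalemxAl mxE => H.
by rewrite -mulrA -ler_pdivlMl.
Qed.

Lemma gram_unit t : eigs_in (Qmx X t) c1 c2 -> gram X t \in unitmx.
Proof.
move=> ev; apply: qform_unitmx => v v0; rewrite gt_eqF//.
apply: lt_le_trans (gram_low v ev).
by rewrite !mulr_gt0 ?ltr0n// sqnorm_gt0.
Qed.

(** For a row [a] of [A] and [u = gram^-1 a], the squared norm [s] of [X u] is both the Gram form at
    [u] and the inner product of [u] and [a]. From [N c1 |u|^2 <= s] and [s^2 <= |u|^2 |a|^2]
    follows [s <= |a|^2 / (N c1)]. *)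
Lemma frob2_ols p (A : 'M[R]_(p, L)) t : eigs_in (Qmx X t) c1 c2 ->
  frob2 (A *m ols X t) <= frob2 A / (N%:R * c1).
Proof.
move=> ev; have Nc : 0 < N%:R * c1 by rewrite mulr_gt0 ?ltr0n.
rewrite /frob2 mulr_suml; apply: ler_sum => k _.
pose a : 'cV[R]_L := (row k A)^T; pose u := invmx (gram X t) *m a.
have -> : \sum_j (A *m ols X t) k j ^+ 2 = sqnorm (X t *m u).
  have -> : X t *m u = (row k A *m ols X t)^T.
    rewrite /u /a /ols !trmx_mul trmxK trmx_inv gram_sym mulmxA.
    by [].
  by rewrite -row_mul; apply: eq_bigr => j _; rewrite !mxE.
have -> : \sum_j A k j ^+ 2 = sqnorm a.
  by apply: eq_bigr => j _; rewrite !mxE.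
set s := sqnorm (X t *m u).
have sE : s = qform (gram X t) u.
  by rewrite /s sqnorm_mx /qform /gram trmx_mul !mulmxA.
have sE' : s = \sum_i u i 0 * a i 0.
  rewrite sE /qform /u -mulmxA (mulmxA (gram X t)) mulmxV ?gram_unit// mul1mx.
  by rewrite -/u mxE; apply: eq_bigr => i _; rewrite mxE.
have [s0|sn0] := eqVneq s 0; first by rewrite s0 divr_ge0 ?sqnorm_ge0// ltW.
have sp : 0 < s by rewrite lt_neqAle eq_sym sn0 sqnorm_ge0.
have us : N%:R * c1 * sqnorm u <= s by rewrite sE; exact: gram_low.
have cs : s ^+ 2 <= sqnorm u * sqnorm a by rewrite sE'; exact: cauchy_schwarz.
rewrite ler_pdivlMr// -(ler_pM2r sp) mulrAC -expr2.
apply: le_trans (ler_wpM2r (ltW Nc) cs) _.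
have -> : sqnorm u * sqnorm a * (N%:R * c1) = sqnorm a * (N%:R * c1 * sqnorm u).
  by ring.
by rewrite ler_wpM2l ?sqnorm_ge0.
Qed.

End OlsBound.

Section NoiseMoments.
Variables (R : realType) (d : measure_display) (Om : measurableType d)
  (P : probability Om R) (gen : set (set Om)).
Hypothesis hgen : gen `<=` measurable.
Local Notation G := (<<s gen >>).
Local Notation S := (g_sigma_algebraType gen).
Variables (N T L : nat) (eps : 'I_T -> Om -> 'cV[R]_N)
  (X : 'I_T -> Om -> 'M[R]_(N, L)) (C c1 c2 : R).
Local Notation Fu i :=
  [set A | exists t (a : R), A = [set w | eps t w i 0 <= a]].
Hypothesis C0 : 0 < C.
Hypothesis me : forall t i, measurable_fun setT (fun w => eps t w i 0).
Hypothesis ie : forall t i, P.-integrable setT (fun w => (eps t w i 0)%:E).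
Hypothesis ie2 : forall t i, P.-integrable setT (fun w => (eps t w i 0 ^+ 2)%:E).
Hypothesis e_mean0 : forall t i,
  cexp_version P G (fun w => eps t w i 0) (fun _ => 0).
Hypothesis e_indep : cond_indep P G (fun i => <<s Fu i >>).
Hypothesis e_cov : forall i t (c : 'I_T -> Om -> R),
  (forall s, cexp_version P G (fun w => eps t w i 0 * eps s w i 0) (c s)) ->
  {ae P, forall w, \sum_s `|c s w| <= C}.
Hypothesis mX : forall t, mfmx (fun w : S => X t w).
Hypotheses (c10 : 0 < c1) (N0 : (0 < N)%N).

Lemma weighted_sum_tail (I : finType) (u : I -> 'I_N -> 'I_T -> Om -> R) B M :
  (forall k i t, measurable_fun setT (u k i t : S -> R)) ->
  (forall w, \sum_k \sum_i \sum_t u k i t w ^+ 2 <= B) -> 0 < M ->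
  (P [set w | (M < \sum_k (\sum_i \sum_t u k i t w * eps t w i 0) ^+ 2)%R] <=
    (C * B / M)%:E)%E.
Proof.
move=> mu uB M0; pose e i t w := eps t w i 0.
have B0 : 0 <= B.
  apply: le_trans (uB point); do 3! (apply: sumr_ge0 => ? _); exact: sqr_ge0.
have u2B k i t w : u k i t w ^+ 2 <= B.
  apply: le_trans (uB w); rewrite (bigD1 k)//= (bigD1 i)//= (bigD1 t)//=.
  rewrite -!addrA lerDl !addr_ge0//; do ?(apply: sumr_ge0 => ? _); exact: sqr_ge0.
have uM k i t w : `|u k i t w| <= Num.sqrt B.
  by rewrite -sqrtr_sqr ler_wsqrtr.
pose Y k w := (\sum_i \sum_t u k i t w * e i t w) ^+ 2.
have iY k : rintegrable P (Y k).
  apply: (weighted_sum_integrable hgen) (mu k) (uM k) => //.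
  - by move=> i t; exact: me.
  - by move=> i t; exact: ie2.
have iYs : rintegrable P (fun w => \sum_k Y k w) by exact: rintegrable_sum.
apply: le_trans (markov_le (rintegrable_measurable iYs) _ iYs M0) _.
  by move=> w; apply: sumr_ge0 => k _; exact: sqr_ge0.
rewrite lee_fin ler_pM2r ?invr_gt0// Ex_sum//.
have iu2 k i t : rintegrable P (fun w => u k i t w ^+ 2).
  apply: (@rintegrable_bounded _ _ _ _ _ B) => [|w].
    by apply: measurable_funX; exact: (sub_sigma_measurable_fun hgen).
  by rewrite ger0_norm ?sqr_ge0.
apply: le_trans (_ : \sum_k C * Ex P (fun w => \sum_i \sum_t u k i t w ^+ 2) <= _).
  apply: ler_sum => k _.
  apply: (weighted_sum_second_moment hgen) (mu k) (uM k) => //.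
  - by move=> i t; exact: me.
  - by move=> i t; exact: ie.
  - by move=> i t; exact: ie2.
  - by move=> i t; exact: e_mean0.
rewrite -mulr_sumr ler_pM2l// -Ex_sum => [|k]; last first.
  by do 2! (apply: rintegrable_sum => ?).
rewrite -[X in _ <= X](Ex_cst P); apply: Ex_le => //.
- by do 3! (apply: rintegrable_sum => ?).
- exact: rintegrable_cst.
Qed.

Lemma mfmx_ols t : mfmx (fun w : S => ols (X^~ w) t).
Proof.
have mXT : mfmx (fun w : S => (X t w)^T) := mfmx_tr (mX t).
exact: (mfmx_mul (mfmx_inv (mfmx_mul mXT (mX t))) mXT).
Qed.

Lemma olsnoise_tail p q (A : 'M[R]_(p, L)) (V : Om -> 'M[R]_(q, T))
    (D : set Om) B M : G D -> mfmx (V : S -> _) ->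
  (forall w, D w -> forall t, eigs_in (Qmx (X^~ w) t) c1 c2) ->
  (forall w, D w -> frob2 (V w) <= B) -> 0 <= B -> 0 < M ->
  exists F, [/\ measurable F,
    (P (~` F) <= (C * (frob2 A / (N%:R * c1) * B) / M)%:E)%E &
    forall w, D w -> F w ->
      frob2 (A *m olsnoise (X^~ w) (eps^~ w) *m (V w)^T) <= M].
Proof.
move=> GD mV Dev DV B0 M0.
have Nc : 0 < N%:R * c1 by rewrite mulr_gt0 ?ltr0n.
(* The indicator of [D] makes the weights bounded everywhere, as the second moment inequality
   requires, and keeps them measurable for the conditioning field; on [D] nothing changes. *)
pose u (kj : 'I_p * 'I_q) i t w : R :=
  \1_D w * ((A *m ols (X^~ w) t) kj.1 i * V w kj.2 t).
have mu kj i t : measurable_fun setT (u kj i t : S -> R).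
  apply: measurable_funM; first exact: (@measurable_indic _ S).
  apply: measurable_funM; last exact: mV.
  exact: (mfmx_mul (@mfmx_cst R _ S _ _ A) (mfmx_ols t)).
have usum w : \sum_kj \sum_i \sum_t u kj i t w ^+ 2 =
    \1_D w * \sum_t frob2 (A *m ols (X^~ w) t) * \sum_j V w j t ^+ 2.
  rewrite (eq_bigr (fun kj : 'I_p * 'I_q => \sum_t \sum_i u kj i t w ^+ 2)); last first.
    by move=> kj _; rewrite exchange_big.
  rewrite exchange_big mulr_sumr; apply: eq_bigr => t _ /=.
  rewrite -(pair_bigA _ (fun k j => \sum_i u (k, j) i t w ^+ 2)) /=.
  rewrite [frob2 _ * _]mulr_suml mulr_sumr; apply: eq_bigr => k _.
  rewrite mulr_sumr mulr_sumr; apply: eq_bigr => j _.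
  rewrite mulr_suml mulr_sumr; apply: eq_bigr => i _.
  rewrite /u indicE /=; case: (w \in D); last by rewrite !mul0r expr0n.
  by rewrite !mul1r exprMn.
have uB w : \sum_kj \sum_i \sum_t u kj i t w ^+ 2 <= frob2 A / (N%:R * c1) * B.
  have A0 : 0 <= frob2 A / (N%:R * c1) by rewrite divr_ge0 ?frob2_ge0// ltW.
  rewrite usum indicE; case: (boolP (w \in D)) => [/set_mem Dw|_]; last first.
    by rewrite mul0r mulr_ge0.
  rewrite mul1r; apply: le_trans (_ : frob2 A / (N%:R * c1) * frob2 (V w) <= _).
    rewrite -[frob2 (V w)]frob2T /frob2 [X in _ <= _ * X]/= mulr_sumr.
    apply: ler_sum => t _.
    have -> : \sum_j (V w)^T t j ^+ 2 = \sum_j V w j t ^+ 2.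
      by apply: eq_bigr => j _; rewrite mxE.
    apply: ler_wpM2r; first by apply: sumr_ge0 => ? _; exact: sqr_ge0.
    by apply: (frob2_ols _ _ _ (Dev w Dw t)).
  by rewrite ler_wpM2l// DV.
have := weighted_sum_tail mu uB M0; set F' := [set w | _] => PF.
have mu' kj i t : measurable_fun setT (u kj i t).
  exact: (sub_sigma_measurable_fun hgen).
have mF : measurable (~` F').
  rewrite (_ : ~` F' = [set w | \sum_kj (\sum_i \sum_t u kj i t w * eps t w i 0) ^+ 2 <= M]).
    apply: measurable_le_cst; apply: measurable_sum => kj; apply: measurable_funX.
    by do 2! (apply: measurable_sum => ?); apply: measurable_funM.
  apply/seteqP; split => w /=; first by move/negP; rewrite -leNgt.
  by move=> ?; apply/negP; rewrite -leNgt.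
exists (~` F'); split => //; first by rewrite setCK.
move=> w Dw /= /negP; rewrite -leNgt; apply: le_trans.
rewrite le_eqVlt; apply/orP; left; apply/eqP.
rewrite frob2_pair; apply: eq_bigr => -[k j] _ /=; congr (_ ^+ 2).
rewrite mxE exchange_big; apply: eq_bigr => t _ /=.
rewrite [(V w)^T t j]mxE mxE mulr_suml.
have -> : \sum_i (A k i * (olsnoise (X^~ w) (eps^~ w)) i t * V w j t) =
    (A *m ols (X^~ w) t *m eps t w) k 0 * V w j t.
  rewrite -mulmxA mxE mulr_suml; apply: eq_bigr => i _.
  by rewrite [olsnoise _ _ i t]mxE.
rewrite mxE mulr_suml; apply: eq_bigr => i _.
by rewrite /u /= indicE mem_set// mul1r; ring.
Qed.

End NoiseMoments.

(** * Weak convergence *)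

Section FrobeniusContinuity.
Variable R : realType.

Lemma frob_continuousP m n (g : 'M[R]_(m, n) -> R) : continuous g <->
  forall x e, 0 < e -> exists2 r, 0 < r &
    forall y, frob (y - x) < r -> `|g x - g y| < e.
Proof.
split => [cg x e e0|H x].
  have /nbhs_ballP[r r0 Hr] : \forall y \near x, `|g x - g y| < e.
    by have /cvgrPdist_lt := cg x; exact.
  exists r => // y yx; apply: Hr; split => // i j.
  rewrite /ball /= distrC; apply: le_lt_trans yx.
  by have := entry_le_frob (y - x) i j; rewrite !mxE.
apply/(@cvgrPdist_lt _ _ _ (nbhs x)) => e e0; have [r r0 Hr] := H x e e0.
apply/nbhs_ballP; exists (r / (m * n).+1%:R) => /=; first by rewrite divr_gt0.
move=> y [_ xy]; apply: Hr; apply: frob_lt_entries => // i j.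
by rewrite !mxE distrC ltW//; exact: xy.
Qed.

Lemma continuous_mulmx_comp m n p (A : 'M[R]_(m, n)) (g : 'M[R]_(m, p) -> R) :
  continuous g -> continuous (fun x => g (A *m x)).
Proof.
move=> /frob_continuousP cg; apply/frob_continuousP => x e e0.
have [r r0 Hr] := cg (A *m x) e e0.
have A1 : 0 < frob A + 1 by rewrite ltr_wpDl ?frob_ge0.
exists (r / (frob A + 1)); first by rewrite divr_gt0.
move=> y yx; apply: Hr; rewrite -mulmxBr; apply: le_lt_trans (frobM _ _) _.
apply: le_lt_trans (_ : (frob A + 1) * frob (y - x) < _).
  by rewrite ler_wpM2r ?frob_ge0// lerDl.
by rewrite mulrC -ltr_pdivlMr.
Qed.

Lemma rV_frob_compact n (r : R) : compact [set v : 'rV[R]_n | frob v <= r].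
Proof.
apply: bounded_closed_compact.
  exists r; split; first exact: num_real.
  move=> x rx v /= vr; apply: le_trans _ (ltW rx); rewrite /Num.norm/= mx_normrE.
  have r0 : 0 <= r := le_trans (frob_ge0 v) vr.
  apply: bigmax_le => // -[i j] _ /=; exact: le_trans (entry_le_frob _ _ _) vr.
apply: (@closed_comp _ _ (@frob R 1 n) [set x | x <= r]); last exact: closed_le.
move=> v _; apply/frob_continuousP : v => x e e0; exists e => // y yx.
rewrite ltr_distl; apply/andP; split.
  rewrite ltrBlDr; apply: le_lt_trans (_ : frob (y - x) + frob x < _); last first.
    by rewrite addrC ltrD2l.
  by have := frobD (y - x) x; rewrite subrK.
have := frobB y (y - x); rewrite opprB addrC subrK => H.
by apply: le_lt_trans H _; rewrite ltrD2l.
Qed.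

(** Compactness makes the local radii uniform. Only [x] is confined to the ball, so later a bound on
    one of the two sequences is enough. *)
Lemma cV_uniform_continuity n (g : 'cV[R]_n -> R) (r e : R) :
  continuous g -> 0 < e -> exists2 dl, 0 < dl &
  forall x y, frob x <= r -> frob (x - y) <= dl -> `|g x - g y| <= e.
Proof.
move=> /frob_continuousP cg e0.
have /compact_near_coveringP cov := @rV_frob_compact n r.
have := cov R (0 : R)^'+ (fun dl (v : 'rV[R]_n) => forall y : 'cV[R]_n,
  frob (v^T - y) <= dl -> `|g v^T - g y| <= e) _.
case=> [v _|k /= k0 Hk].
- have [s s0 Hs] := cg v^T (e / 2) (divr_gt0 e0 (ltr0n _ 2)).
  pose s' := s / 2; have s'0 : 0 < s' by rewrite divr_gt0.
  exists ([set v' : 'rV[R]_n | frob (v'^T - v^T) < s'], [set dl : R | dl < s']).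
    split => /=; last exact: nbhs_right_lt.
    apply/nbhs_ballP; exists (s' / (n * 1).+1%:R) => /=; first by rewrite divr_gt0.
    move=> v' [_ vv']; apply: frob_lt_entries => // i j.
    by rewrite !mxE distrC ltW//; exact: vv'.
  move=> [v' dl] /= [v'v dls] y v'y.
  have h1 : `|g v^T - g v'^T| < e / 2.
    by apply: Hs; apply: lt_trans v'v _; rewrite /s'; lra.
  have h2 : `|g v^T - g y| < e / 2.
    apply: Hs; have -> : y - v^T = (v'^T - v^T) - (v'^T - y).
      by apply/matrixP => i j; rewrite !mxE; ring.
    apply: le_lt_trans (frobB _ _) _; rewrite (splitr s).
    by apply: ltrD => //; exact: le_lt_trans v'y dls.
  apply: ltW; rewrite -(subrKA (g v^T)) (splitr e).
  by apply: le_lt_trans (ler_normD _ _) _; apply: ltrD => //; rewrite distrC.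
- exists (k / 2); first by rewrite divr_gt0.
  move=> x y xr xy; have := Hk (k / 2) _ _ x^T _ y; rewrite trmxK; apply => //.
  + rewrite /= sub0r normrN gtr0_norm ?divr_gt0//; lra.
  + by rewrite divr_gt0.
  + by rewrite /= frobT.
Qed.

End FrobeniusContinuity.

Section WeakConvergence.
Variables (R : realType) (d : measure_display) (Om : measurableType d)
  (P : probability Om R).

(* An outer probability bound: [Q] itself need not be measurable. *)
Definition likely (dl : R) (Q : set Om) : Prop :=
  exists F, [/\ measurable F, (P (~` F) <= dl%:E)%E & F `<=` Q].

Lemma likelyW dl dl' Q Q' : dl <= dl' -> Q `<=` Q' -> likely dl Q ->
  likely dl' Q'.
Proof.
move=> dd QQ [F [mF PF FQ]]; exists F; split => //; last exact: subset_trans FQ QQ.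
by apply: le_trans PF _; rewrite lee_fin.
Qed.

Lemma likelyI dl dl' Q Q' : likely dl Q -> likely dl' Q' ->
  likely (dl + dl') (Q `&` Q').
Proof.
move=> [F [mF PF FQ]] [F' [mF' PF' FQ']]; exists (F `&` F'); split.
- exact: measurableI.
- rewrite setCI; apply: (le_trans (measureU2 _ _ _)); try exact: measurableC.
  by rewrite EFinD leeD.
- by move=> w [Fw F'w]; split; [exact: FQ|exact: FQ'].
Qed.

Lemma cvge0_near_le (u : nat -> \bar R) : u @ \oo --> 0%E ->
  forall dl, 0 < dl -> \forall n \near \oo, (u n <= dl%:E)%E.
Proof.
move=> /fine_cvgP[fu /cvgrPdist_le cu] dl dl0.
have := cu _ dl0; apply: filter_app; apply: filterS fu => n fn /=.
rewrite sub0r normrN => h; rewrite -(fineK fn) lee_fin.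
exact: le_trans (ler_norm _) h.
Qed.

Lemma conv_prob_likely (Y : nat -> Om -> R) c :
  (forall n, measurable_fun setT (Y n)) -> conv_prob P Y c ->
  forall e dl, 0 < e -> 0 < dl ->
    \forall n \near \oo, likely dl [set w | `|Y n w - c| <= e].
Proof.
move=> mY cY e dl e0 dl0; have := cvge0_near_le (cY e e0) dl0.
apply: filterS => n Pn; exists [set w | `|Y n w - c| <= e]; split => //.
  apply: measurable_le_cst; apply: measurableT_comp => //.
  exact: measurable_funB.
rewrite (_ : ~` _ = [set w | e < `|Y n w - c|])//.
by apply/seteqP; split => w /=; [move/negP; rewrite -ltNge|move=> ?; apply/negP; rewrite -ltNge].
Qed.

Lemma likely_forall (I : finType) (dl : R) (Q : I -> set Om) : 0 <= dl ->
  (forall i, likely (dl / #|I|.+1%:R) (Q i)) -> likely dl [set w | forall i, Q i w].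
Proof.
move=> dl0 HQ.
have {}HQ (s : seq I) : likely (dl / #|I|.+1%:R * (size s)%:R)
    [set w | forall i, i \in s -> Q i w].
  elim: s => [|i s IH].
    by exists setT; split; rewrite ?setCT ?measure0 ?mulr0.
  apply: likelyW (likelyI (HQ i) IH); first by rewrite /= -[(size s).+1%:R]natr1 mulrDr mulr1 addrC.
  by move=> w [Qi Qs] j; rewrite inE => /predU1P[->//|]; exact: Qs.
apply: likelyW (HQ (enum I)) => [|w H i]; last by apply: H; rewrite mem_enum.
rewrite -cardE -mulrA ler_piMr// mulrC ler_pdivrMr// mul1r ler_nat//.
Qed.

Lemma conv_prob_mx_likely m p (Y : nat -> Om -> 'M[R]_(m, p)) C :
  (forall n, mfmx (Y n)) -> conv_prob_mx P Y C ->
  forall e dl, 0 < e -> 0 < dl ->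
    \forall n \near \oo, likely dl [set w | frob (Y n w - C) <= e].
Proof.
move=> mY cY e dl e0 dl0; pose I : finType := ('I_m * 'I_p)%type.
pose e' := e / (m * p).+1%:R; have e'0 : 0 < e' by rewrite divr_gt0.
pose dl' := dl / #|I|.+1%:R; have dl'0 : 0 < dl' by rewrite divr_gt0.
have H (ij : I) : \forall n \near \oo,
    likely dl' [set w | `|Y n w ij.1 ij.2 - C ij.1 ij.2| <= e'].
  apply: (conv_prob_likely (Y := fun n w => Y n w ij.1 ij.2)) => // n.
  exact: mY.
have {}H : \forall n \near \oo, forall ij : I,
    likely dl' [set w | `|Y n w ij.1 ij.2 - C ij.1 ij.2| <= e'].
  exact: filter_forall.
apply: filterS H => n Hn.
apply: likelyW (likely_forall (ltW dl0) Hn) => // w /= Hw.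
apply: ltW; apply: frob_lt_entries => // i j.
by have := Hw (i, j); rewrite !mxE.
Qed.

Lemma Ex_diff_le (f g : Om -> R) (B e dl : R) F :
  measurable_fun setT f -> measurable_fun setT g -> 0 <= e ->
  (forall w, `|f w| <= B) -> (forall w, `|g w| <= B) ->
  measurable F -> (P (~` F) <= dl%:E)%E ->
  (forall w, F w -> `|f w - g w| <= e) ->
  `|Ex P f - Ex P g| <= e + 2 * B * dl.
Proof.
move=> mf mg e0 fB gB mF PF Fe.
have B0 : 0 <= B by exact: le_trans (fB point).
have iF := rintegrable_bounded P mf fB; have ig := rintegrable_bounded P mg gB.
have iFc : rintegrable P (\1_(~` F)).
  apply: (@rintegrable_bounded _ _ _ _ _ 1) => [|w]; last exact: indic_le1.
  by apply: measurable_indic; exact: measurableC.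
rewrite -ExB//; apply: le_trans (Ex_norm _) _; first exact: rintegrableB.
apply: le_trans (_ : Ex P (fun w => e + 2 * B * \1_(~` F) w) <= _).
  apply: Ex_le.
  - by apply: integrable_norm; exact: rintegrableB.
  - by apply: rintegrableD; [exact: rintegrable_cst|exact: rintegrableZ].
  move=> w; have [Fw|Fw] := pselect (F w).
    by apply: le_trans (Fe w Fw) _; rewrite lerDl mulr_ge0 ?mulr_ge0// indicE ler0n.
  rewrite indicE mem_set// mulr1; apply: le_trans (ler_normB _ _) _.
  by rewrite mulr_natl mulr2n; apply: le_trans (lerD (fB w) (gB w)) _; rewrite lerDr.
rewrite ExD ?Ex_cst ?ExZ//; [|exact: rintegrable_cst|exact: rintegrableZ].
rewrite lerD2l ler_wpM2l ?mulr_ge0//.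
by rewrite -lee_fin Ex_indic//; exact: measurableC.
Qed.

(** The bound [m] precedes [e]: it expresses tightness of [Y], and [g] is uniformly continuous near
    the ball of radius [m]. Of the error, [e / 4] goes to the modulus of continuity, [e / 4] to the
    exceptional event, where the difference is at most [2 * B], and [e / 2] to the limit of [Y]. *)
Lemma slutsky K (S Y : nat -> Om -> 'cV[R]_K) (g : 'cV[R]_K -> R) (c : R) :
  (forall n, mfmx (S n)) -> (forall n, mfmx (Y n)) -> bounded_cont g ->
  (forall dl, 0 < dl -> exists m, forall e, 0 < e -> \forall n \near \oo,
     likely dl [set w | frob (Y n w) <= m /\ frob (Y n w - S n w) <= e]) ->
  Ex P (fun w => g (Y n w)) @[n --> \oo] --> c ->
  Ex P (fun w => g (S n w)) @[n --> \oo] --> c.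
Proof.
move=> mS mY [cg [B gB]] close cY; apply/cvgrPdist_le => e e0.
have B0 : 0 <= B by exact: le_trans (gB 0).
pose dl := e / 4 / (2 * B + 1).
have B1 : 0 < 2 * B + 1 by rewrite ltr_wpDl ?mulr_ge0.
have dl0 : 0 < dl by rewrite !divr_gt0.
have [m Hm] := close dl dl0.
have e4 : 0 < e / 4 by rewrite divr_gt0.
have [r r0 Hr] := cV_uniform_continuity m cg e4.
have e2 : 0 < e / 2 by rewrite divr_gt0.
have /cvgrPdist_le/(_ _ e2) := cY; apply: filter_app.
apply: filterS (Hm r r0) => n [F [mF PF FH]] cn.
have mg (Z : nat -> Om -> 'cV[R]_K) : (forall n, mfmx (Z n)) ->
    measurable_fun setT (fun w => g (Z n w)).
  by move=> mZ; exact: (mfmx_continuous (mZ n) cg).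
have := Ex_diff_le (mg Y mY) (mg S mS) (ltW e4) (fun w => gB _) (fun w => gB _) mF PF _.
move=> /(_ _)/wrap[w Fw|D].
  by have [Yw YS] := FH w Fw; exact: Hr.
have Bd : 2 * B * dl <= e / 4.
  by rewrite /dl mulrCA ler_piMr ?(ltW e4)// ler_pdivrMr// mul1r lerDl.
rewrite -(subrKA (Ex P (fun w => g (Y n w)))).
apply: le_trans (ler_normD _ _) _.
have -> : e = e / 2 + (e / 4 + e / 4) by field.
apply: lerD => //; apply: le_trans D _; exact: lerD.
Qed.

(** Total expectation: [g (S n)] and its conditional expectation [Y n] have the same mean, and [Y n]
    tends in probability to a constant. *)
Lemma cond_conv_unconditional K (gen : nat -> set (set Om))
    (S : nat -> Om -> 'cV[R]_K) Sigma :
  (forall n, gen n `<=` measurable) -> (forall n, mfmx (S n)) ->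
  cond_conv_dist_normal P (fun n => <<s gen n >>) S Sigma ->
  exists A : 'M[R]_K, A *m A^T = Sigma /\ forall g, bounded_cont g ->
    Ex P (fun w => g (S n w)) @[n --> \oo] --> gaussE A g.
Proof.
move=> hgen mS [A [AS cS]]; exists A; split => // g bg; have [cg [B gB]] := bg.
have B0 : 0 <= B by exact: le_trans (gB 0).
have mg n : measurable_fun setT (fun w => g (S n w)).
  exact: (mfmx_continuous (mS n) cg).
have ig n : rintegrable P (fun w => g (S n w)).
  exact: rintegrable_bounded (mg n) (fun w => gB _).
have [Y HY] := choice (fun n => cexp_exists (hgen n) (ig n)).
have := cS g bg Y HY; set c := gaussE A g => cY.
apply/cvgrPdist_le => e e0.
pose dl := e / 2 / (B + `|c| + 1).
have B1 : 0 < B + `|c| + 1 by rewrite ltr_wpDl ?addr_ge0.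
have e2 : 0 < e / 2 by rewrite divr_gt0.
have dl0 : 0 < dl by rewrite divr_gt0.
apply: filterS (cvge0_near_le (cY (e / 2) e2) dl0) => n.
set D := [set w | _] => PD.
have [GY iY _] := HY n.
have mYS : measurable_fun setT (Y n : g_sigma_algebraType (gen n) -> R) by exact/gmeasurableP.
have mY := sub_sigma_measurable_fun (hgen n) mYS.
have GD : <<s gen n >> D.
  have m1 : measurable_fun setT ((fun w => `|Y n w - c|) : g_sigma_algebraType (gen n) -> R).
    by apply: measurableT_comp => //; exact: measurable_funB.
  have := @measurable_le_cst R _ (g_sigma_algebraType (gen n)) _ (e / 2) m1.
  move/(@measurableC _ (g_sigma_algebraType (gen n))).
  rewrite (_ : ~` _ = D)//; apply/seteqP; split => w /=.
    by move/negP; rewrite -ltNge.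
  by move=> ?; apply/negP; rewrite -ltNge.
have mD := sub_sigma_measurable (hgen n) GD.
have ET : Ex P (fun w => g (S n w)) = Ex P (Y n).
  have GT : <<s gen n >> setT by exact: (@measurableT _ (g_sigma_algebraType (gen n))).
  have := cexp_version_Ex (hgen n) (ig n) (HY n) GT.
  by under eq_fun do rewrite indicT mul1r; under [X in _ = Ex _ X -> _]eq_fun do rewrite indicT mul1r.
have iI (f : Om -> R) : rintegrable P f -> rintegrable P (fun w => \1_D w * f w).
  by move=> iF; apply: (@rintegrableMb _ _ _ _ _ _ 1) => // w; exact: indic_le1.
have i1 : rintegrable P (\1_D).
  by apply: (@rintegrable_bounded _ _ _ _ _ 1) => [|w]; [exact: measurable_indic|exact: indic_le1].
have iYc : rintegrable P (fun w => Y n w - c).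
  by apply: rintegrableB => //; exact: rintegrable_cst.
(* The version [Y n] carries no pointwise bound. On [D], which lies in the conditioning field, its
   integral is exchanged for that of [g (S n)], which is bounded by [B]. *)
have split_ : Ex P (Y n) - c =
    Ex P (fun w => (Y n w - c) - \1_D w * (Y n w - c)) +
    (Ex P (fun w => \1_D w * g (S n w)) - c * Ex P (\1_D)).
  rewrite (cexp_version_Ex (hgen n) (ig n) (HY n) GD) ExB//; last exact: iI.
  rewrite ExB ?Ex_cst//; last exact: rintegrable_cst.
  have -> : (fun w => \1_D w * (Y n w - c)) =
      (fun w => \1_D w * Y n w - c * \1_D w) by apply/funext => w; ring.
  by rewrite ExB ?ExZ ?subrK//; [exact: iI|exact: rintegrableZ].
rewrite ET distrC split_.
have small : `|Ex P (fun w => (Y n w - c) - \1_D w * (Y n w - c))| <= e / 2.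
  apply: le_trans (Ex_norm _) _; first by apply: rintegrableB => //; exact: iI.
  rewrite -[X in _ <= X](Ex_cst P); apply: Ex_le; last 1 first.
  - move=> w; rewrite indicE; case: (boolP (w \in D)) => [_|/negP Dw].
      by rewrite mul1r subrr normr0 ltW.
    rewrite mul0r subr0 leNgt; apply/negP => h; apply: Dw; exact: mem_set.
  - by apply: integrable_norm; apply: rintegrableB => //; exact: iI.
  - exact: rintegrable_cst.
have ED : Ex P (\1_D) <= dl by rewrite -lee_fin Ex_indic.
have ED0 : 0 <= Ex P (\1_D) by apply: Ex_ge0 => w; rewrite indicE.
have big : `|Ex P (fun w => \1_D w * g (S n w)) - c * Ex P (\1_D)| <= e / 2.
  apply: le_trans (ler_normB _ _) _.
  apply: le_trans (_ : (B + `|c|) * Ex P (\1_D) <= _).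
    rewrite mulrDl normrM (ger0_norm ED0) lerD2r.
    apply: le_trans (Ex_norm _) _; first exact: iI.
    rewrite -ExZ//; apply: Ex_le.
    - by apply: integrable_norm; exact: iI.
    - exact: rintegrableZ.
    - by move=> w; rewrite normrM mulrC indicE normr_nat ler_wpM2r.
  apply: le_trans (ler_wpM2l _ ED) _; first by rewrite addr_ge0.
  by rewrite /dl mulrCA ler_piMr ?(ltW e2)// ler_pdivrMr// mul1r lerDl.
by apply: le_trans (ler_normD _ _) _; rewrite (splitr e) lerD.
Qed.

(** A normal law is encoded by a factor of its covariance, so a linear map acts on the limit by
    multiplying that factor. *)
Lemma gaussE_mul K (M A : 'M[R]_K) (g : 'cV[R]_K -> R) :
  gaussE A (fun v => g (M *m v)) = gaussE (M *m A) g.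
Proof.
rewrite /gaussE; congr iter_gauss; apply/funext => z.
by rewrite mulmxA.
Qed.

End WeakConvergence.

(** * Measurability of the statistics *)

Section StatisticMeasurability.
Variables (R : realType) (d : measure_display) (W : measurableType d).
Variables (N L T K : nat).
Variables (X : 'I_T -> W -> 'M[R]_(N, L)) (Gam : 'M[R]_(L, K)) (eta : 'cV[R]_L)
  (Om : 'M[R]_(N, N - L)) (zeta : 'cV[R]_(N - L)) (xi : 'I_T -> 'cV[R]_(N - L))
  (f : 'I_T -> W -> 'cV[R]_K) (E : 'I_T -> W -> 'cV[R]_N)
  (G : W -> 'M[R]_(L, K)).
Hypotheses (mX : forall t, mfmx (X t)) (mf : forall t, mfmx (f t)).

Lemma mfmx_brevef t : mfmx (fun w => brevef (X^~ w) Gam eta (f^~ w) t).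
Proof.
have mXt := mfmx_tr (mX t).
apply: mfmx_sub; first exact: mf.
apply: mfmx_mul; last exact: mfmx_cst.
apply: mfmx_mul; last exact: mX.
apply: mfmx_mul; last exact: mXt.
apply: mfmx_mul; last exact: mfmx_cst.
apply: mfmx_inv; apply: mfmx_mul; last exact: mfmx_cst.
apply: mfmx_mul; last exact: mX.
by apply: mfmx_mul; [exact: mfmx_cst|exact: mXt].
Qed.

(** The sigma-field on [W] is arbitrary: the lemma is used for the whole space and for the
    conditioning field, where characteristics and factors are measurable but the errors need not
    be. *)
Lemma mfmx_Fdmx : mfmx (fun w => Fdmx (X^~ w) Gam eta (f^~ w)).
Proof.
have mbar : mfmx (fun w => brevefbar (X^~ w) Gam eta (f^~ w)).
  apply: mfmx_scale; first exact: measurable_cst.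
  by apply: mfmx_sum => t; exact: mfmx_brevef.
apply: mfmx_entries => k t.
exact: (mfmx_sub (mfmx_brevef t) mbar k 0).
Qed.

Hypothesis mE : forall t, mfmx (E t).

Lemma mfmx_projmx p q (A : W -> 'M[R]_(p, q)) : mfmx A ->
  mfmx (fun w => projmx (A w)).
Proof.
move=> mA; have mAT := mfmx_tr mA.
apply: mfmx_mul; last exact: mAT.
by apply: mfmx_mul => //; apply: mfmx_inv; exact: mfmx_mul.
Qed.

Lemma mfmx_ddotR t :
  mfmx (fun w => ddotR (X^~ w) Gam eta Om zeta xi (f^~ w) (E^~ w) t).
Proof.
have mXT := mfmx_tr (mX t).
have mXo : mfmx (fun w => Xomx (X^~ w) Om t).
  apply: mfmx_mul; last exact: mfmx_cst.
  by apply: mfmx_sub; [exact: mfmx_cst|exact: mfmx_projmx].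
have mXoT := mfmx_tr mXo.
have mB : mfmx (fun w => Bmx (X^~ w) Gam t).
  by apply: mfmx_mul; [exact: mX|exact: mfmx_cst].
apply: mfmx_mul.
  apply: mfmx_mul; last exact: mXT.
  by apply: mfmx_inv; apply: mfmx_mul; [exact: mXT|exact: mX].
apply: mfmx_add; last exact: mE.
apply: mfmx_add; last by apply: mfmx_mul; [exact: mB|exact: mf].
apply: mfmx_add.
  apply: mfmx_mul; last exact: mfmx_cst.
  apply: mfmx_mul; first exact: mXo.
  apply: mfmx_isqrtmx; apply: mfmx_scale; first exact: measurable_cst.
  by apply: mfmx_mul; [exact: mXoT|exact: mXo].
apply: mfmx_mul; last exact: mfmx_cst.
apply: mfmx_mul; last exact: mX.
by apply: mfmx_sub; [exact: mfmx_cst|exact: mfmx_projmx].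
Qed.

Lemma mfmx_ddotRd :
  mfmx (fun w => ddotRd (X^~ w) Gam eta Om zeta xi (f^~ w) (E^~ w)).
Proof.
have mbar : mfmx (fun w => ddotRbar (X^~ w) Gam eta Om zeta xi (f^~ w) (E^~ w)).
  apply: mfmx_scale; first exact: measurable_cst.
  by apply: mfmx_sum => t; exact: mfmx_ddotR.
apply: mfmx_entries => k t.
exact: (mfmx_sub (mfmx_ddotR t) mbar k 0).
Qed.

Hypothesis mG : mfmx G.

Lemma mfmx_HGam :
  mfmx (fun w => HGam (X^~ w) Gam eta Om zeta xi (f^~ w) (E^~ w) (G w)).
Proof.
have mGT := mfmx_tr mG.
have mtF : mfmx (fun w =>
    tFdmx (X^~ w) Gam eta Om zeta xi (f^~ w) (E^~ w) (G w)).
  apply: mfmx_mul; last exact: mfmx_ddotRd.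
  by apply: mfmx_mul; [apply: mfmx_inv; exact: mfmx_mul|exact: mGT].
have mtFT := mfmx_tr mtF.
apply: mfmx_mul; first by apply: mfmx_mul; [exact: mfmx_Fdmx|exact: mtFT].
by apply: mfmx_inv; apply: mfmx_mul; [exact: mtF|exact: mtFT].
Qed.

Lemma mfmx_gamma_stat l :
  mfmx (fun w => gamma_stat (X^~ w) Gam eta Om zeta xi (f^~ w) (E^~ w) (G w) l).
Proof.
apply: mfmx_scale; first exact: measurable_cst.
apply: mfmx_sub.
  under eq_fun do rewrite rowv_unitcol.
  by apply: mfmx_mul; [exact: mfmx_tr|exact: mfmx_cst].
by apply: mfmx_mul; [apply: mfmx_tr; exact: mfmx_HGam|exact: mfmx_cst].
Qed.

Lemma mfmx_xf_stat l :
  mfmx (fun w => xf_stat (X^~ w) Gam eta (f^~ w) (E^~ w) l).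
Proof.
apply: mfmx_scale; first exact: measurable_cst.
apply: mfmx_sum => i; apply: mfmx_sum => t; apply: mfmx_scale.
  apply: measurable_funM; last exact: mE.
  under eq_fun do rewrite coordv_unitcol.
  have mXr : mfmx (fun w => (row i (X t w))^T).
    by move=> j k; under eq_fun do rewrite !mxE; exact: mX.
  have mQ : mfmx (fun w => Qmx (X^~ w) t).
    apply: mfmx_scale; first exact: measurable_cst.
    by apply: mfmx_mul; [exact: mfmx_tr|exact: mX].
  exact: (mfmx_mul (mfmx_tr (mfmx_mul (mfmx_inv mQ) mXr)) (@mfmx_cst R _ W _ _ (unitcol R L l))).
move=> k k'; under eq_fun do rewrite mxE; exact: mfmx_Fdmx.
Qed.

End StatisticMeasurability.

(** * Size of the loadings and probability of the noise events *)

Section LoadingFacts.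
Variables (R : realType) (L K : nat) (Gam : 'M[R]_(L, K)) (c1 c2 : R).
Hypotheses (c10 : 0 < c1) (Gev : eigs_in (Gam^T *m Gam) c1 c2).

Let Gsym : (Gam^T *m Gam)^T = Gam^T *m Gam.
Proof. by rewrite trmx_mul trmxK. Qed.

Lemma loading_low u : c1 * sqnorm u <= qform (Gam^T *m Gam) u.
Proof. by have /andP[] := eigs_in_qform_le u Gsym Gev. Qed.

(** The squared norm is the trace of a [K] by [K] matrix, so it stays bounded as [L] grows. *)
Lemma loading_frob2 : frob2 Gam <= c2 * K%:R.
Proof.
have -> : frob2 Gam = \tr (Gam^T *m Gam).
  rewrite -mxdot_trace; apply: eq_bigr => i _; apply: eq_bigr => j _.
  by rewrite expr2.
have H v : - c2 * sqnorm v <= qform (- (Gam^T *m Gam)) v.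
  have /andP[_ +] := eigs_in_qform_le v Gsym Gev.
  have q0 : qform (0 : 'M[R]_K) v = 0 by rewrite /qform mulmx0 mul0mx mxE.
  by rewrite -[- (_ *m _)]sub0r qformB q0 sub0r mulNr lerN2.
have := trace_qform (1%:M : 'M[R]_K) H.
rewrite trmx1 mul1mx mulmx1 linearN /= mulNr lerN2.
rewrite (_ : frob2 1%:M = K%:R) => [|]; last first.
  by apply: frob2_ortho; rewrite trmx1 mul1mx.
by [].
Qed.

(** A positive definite [Gam^T *m Gam] has no kernel, whereas more columns than rows would produce
    one. The inequality makes the columns of [selmx], and hence those of the estimated loadings,
    orthonormal. *)
Lemma loading_dim : (K <= L)%N.
Proof.
rewrite leqNgt; apply/negP => LK.
have : kermx Gam^T != 0.
  rewrite kermx_eq0 -row_leq_rank -ltnNge mxrank_tr.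
  exact: leq_ltn_trans (rank_leq_row _) LK.
case/rowV0Pn => v /sub_kermxP vG v0.
have v0' : v^T != 0 by apply: contraNneq v0 => v0; rewrite -[v]trmxK v0 trmx0.
have := loading_low v^T; rewrite leNgt => /negP[].
rewrite /qform trmxK mulmxA vG !mul0mx mxE mulr_gt0//.
by rewrite sqnorm_gt0.
Qed.

End LoadingFacts.

Lemma frob2_gram_le (R : realType) K T (F : 'M[R]_(K, T)) (S : 'M[R]_K) q e :
  0 < q -> frob (q^-1 *: (F *m F^T) - S) <= e ->
  frob2 F <= K%:R * (frob S + e) * q.
Proof.
move=> q0 He.
have -> : frob2 F = q * \tr (q^-1 *: (F *m F^T)).
  rewrite linearZ /= mulrA mulfV ?gt_eqF// mul1r -frob2T.
  have := mxdot_trace F^T F^T; rewrite trmxK => <-.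
  by apply: eq_bigr => i _; apply: eq_bigr => j _; rewrite expr2.
rewrite mulrC ler_pM2r//; set A := q^-1 *: _ in He *.
have Ale : frob A <= frob S + e.
  have -> : A = S + (A - S) by rewrite addrC subrK.
  by apply: le_trans (frobD _ _) _; rewrite lerD2l.
rewrite /mxtrace; apply: le_trans (_ : \sum_(i < K) (frob S + e) <= _).
  apply: ler_sum => i _; apply: le_trans (ler_norm _) _.
  exact: le_trans (entry_le_frob _ _ _) Ale.
by rewrite sumr_const card_ord mulr_natl.
Qed.

Section NoiseBounds.
Variables (R : realType) (d : measure_display) (Om : measurableType d)
  (P : probability Om R) (gen : set (set Om)).
Hypothesis hgen : gen `<=` measurable.
Local Notation G := (<<s gen >>).
Local Notation S := (g_sigma_algebraType gen).
Variables (N T L K : nat) (eps : 'I_T -> Om -> 'cV[R]_N)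
  (X : 'I_T -> Om -> 'M[R]_(N, L)) (C c1 c2 : R).
Hypothesis C0 : 0 < C.
Hypothesis me : forall t i, measurable_fun setT (fun w => eps t w i 0).
Hypothesis ie : forall t i, P.-integrable setT (fun w => (eps t w i 0)%:E).
Hypothesis ie2 : forall t i, P.-integrable setT (fun w => (eps t w i 0 ^+ 2)%:E).
Hypothesis e_mean0 : forall t i,
  cexp_version P G (fun w => eps t w i 0) (fun _ => 0).
Hypothesis e_indep : cond_indep P G (fun i =>
  <<s [set A | exists t (a : R), A = [set w | eps t w i 0 <= a]] >>).
Hypothesis e_cov : forall i t (c : 'I_T -> Om -> R),
  (forall s, cexp_version P G (fun w => eps t w i 0 * eps s w i 0) (c s)) ->
  {ae P, forall w, \sum_s `|c s w| <= C}.
Hypothesis mX : forall t, mfmx (fun w : S => X t w).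
Hypotheses (c10 : 0 < c1) (N0 : (0 < N)%N) (T0 : (0 < T)%N) (L0 : (0 < L)%N).

Variables (Fd : Om -> 'M[R]_(K, T)) (D : set Om) (Gam : 'M[R]_(L, K)) (l : nat).
Variables (B g2 k m dl : R).
Hypotheses (mFd : mfmx (Fd : S -> 'M[R]_(K, T))) (GD : G D).
Hypothesis Dev : forall w, D w -> forall t, eigs_in (Qmx (X^~ w) t) c1 c2.
Hypothesis DFd : forall w, D w -> frob2 (Fd w) <= B * T%:R.
Hypotheses (B0 : 0 <= B) (Bk : B <= k) (g2k : g2 <= k) (k1 : 1 <= k) (m0 : 0 < m).
Hypothesis Gam2 : frob2 Gam <= g2.
Hypothesis mdl : C * k / c1 / m ^+ 2 <= dl.

Let rho := Num.sqrt (L%:R / N%:R : R).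
Let nu := (Num.sqrt (N%:R : R))^-1.
Let tau := Num.sqrt (T%:R : R).
Local Notation Ec w := (olsnoise (X^~ w) (eps^~ w)).

Let NR : (0 : R) < N%:R. Proof. by rewrite ltr0n. Qed.
Let TR : (0 : R) < T%:R. Proof. by rewrite ltr0n. Qed.
Let LR : (0 : R) < L%:R. Proof. by rewrite ltr0n. Qed.

Lemma olsnoise_likely p q (A : 'M[R]_(p, L)) (V : Om -> 'M[R]_(q, T)) b y :
  mfmx (V : S -> 'M[R]_(q, T)) -> (forall w, D w -> frob2 (V w) <= b) ->
  0 <= b -> 0 < y -> frob2 A * b / N%:R <= k * y ^+ 2 ->
  likely P dl [set w | D w -> frob (A *m Ec w *m (V w)^T) <= m * y].
Proof.
move=> mV DV b0 y0 Aby.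
have my0 : 0 < (m * y) ^+ 2 by rewrite exprn_gt0// mulr_gt0.
have [F [mF PF DF]] := olsnoise_tail hgen C0 me ie ie2 e_mean0 e_indep e_cov mX
  c10 N0 A GD mV Dev DV b0 my0.
exists F; split => //.
  apply: le_trans PF _; rewrite lee_fin; apply: le_trans mdl.
  have -> : C * (frob2 A / (N%:R * c1) * b) / (m * y) ^+ 2 =
     (C / c1 / m ^+ 2) * ((frob2 A * b / N%:R) / y ^+ 2).
    by field; rewrite !gt_eqF.
  have -> : C * k / c1 / m ^+ 2 = (C / c1 / m ^+ 2) * k.
    by field; rewrite !gt_eqF.
  rewrite ler_wpM2l ?divr_ge0 ?sqr_ge0 ?(ltW c10) ?(ltW C0)//.
  by rewrite ler_pdivrMr// exprn_gt0.
move=> w Fw Dw; rewrite -(@ler_pXn2r _ 2) ?nnegrE ?frob_ge0 ?mulr_ge0 ?(ltW m0) ?(ltW y0)//.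
by rewrite sqr_frob; exact: DF.
Qed.

(** The left factor sets the rate: the identity has squared norm [L] and gives [rho], while [Gam^T]
    and a unit row have bounded norm and give [nu]. The right factor, the identity or [Fd], has
    squared norm of order [T]. The fifth bound controls the statistic of the central limit
    theorem. *)
Lemma noise_bounds_likely : likely P (dl + (dl + (dl + (dl + dl))))
  [set w | D w -> [/\ frob (Ec w) <= m * tau * rho,
    frob (Gam^T *m Ec w) <= m * tau * nu,
    frob ((unitcol R L l)^T *m Ec w) <= m * tau * nu,
    frob (Ec w *m (Fd w)^T) <= m * tau * rho &
    frob ((unitcol R L l)^T *m Ec w *m (Fd w)^T) <= m * tau * nu]].
Proof.
have tau2 : tau ^+ 2 = T%:R by rewrite sqr_sqrtr// ltW.
have rho2 : rho ^+ 2 = L%:R / N%:R by rewrite sqr_sqrtr// divr_ge0// ltW.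
have nu2 : nu ^+ 2 = N%:R^-1 by rewrite exprVn sqr_sqrtr// ltW.
have tau0 : 0 < tau by rewrite sqrtr_gt0.
have nu0 : 0 < nu by rewrite invr_gt0 sqrtr_gt0.
have rho0 : 0 < rho by rewrite sqrtr_gt0 divr_gt0.
have frob1 n : frob2 (1%:M : 'M[R]_n) = n%:R.
  by apply: frob2_ortho; rewrite trmx1 mul1mx.
have m1 : mfmx ((fun _ => 1%:M) : S -> 'M[R]_T) by exact: mfmx_cst.
have D1 w : D w -> frob2 (1%:M : 'M[R]_T) <= T%:R by rewrite frob1.
have k0 : 0 <= k := le_trans ler01 k1.
have u2 : frob2 (unitcol R L l)^T <= 1 by rewrite frob2T frob_unitcol.
have TB : 0 <= B * T%:R by rewrite mulr_ge0// ltW.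
have tr0 : 0 < tau * rho by rewrite mulr_gt0.
have tn0 : 0 < tau * nu by rewrite mulr_gt0.
have tr2 : (tau * rho) ^+ 2 = T%:R * (L%:R / N%:R) by rewrite exprMn tau2 rho2.
have tn2 : (tau * nu) ^+ 2 = T%:R / N%:R by rewrite exprMn tau2 nu2.
have TN0 : 0 <= T%:R / N%:R :> R by rewrite divr_ge0// ltW.
have TL0 : 0 <= T%:R * (L%:R / N%:R) :> R by rewrite mulr_ge0 ?divr_ge0// ltW.
have e1 := olsnoise_likely (A := 1%:M) m1 D1 (ltW TR) tr0 _.
have e2 := olsnoise_likely (A := Gam^T) m1 D1 (ltW TR) tn0 _.
have e3 := olsnoise_likely (A := (unitcol R L l)^T) m1 D1 (ltW TR) tn0 _.
have e4 := olsnoise_likely (A := 1%:M) mFd DFd TB tr0 _.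
have e5 := olsnoise_likely (A := (unitcol R L l)^T) mFd DFd TB tn0 _.
apply: likelyW (likelyI (e1 _) (likelyI (e2 _) (likelyI (e3 _) (likelyI (e4 _) (e5 _))))) => //.
- move=> w [h1 [h2 [h3 [h4 h5]]]] Dw; split.
  + by have := h1 Dw; rewrite trmx1 mulmx1 mul1mx mulrA.
  + by have := h2 Dw; rewrite trmx1 mulmx1 mulrA.
  + by have := h3 Dw; rewrite trmx1 mulmx1 mulrA.
  + by have := h4 Dw; rewrite mul1mx mulrA.
  + by have := h5 Dw; rewrite mulrA.
- rewrite frob1 tr2.
  have -> : L%:R * T%:R / N%:R = T%:R * (L%:R / N%:R) :> R by ring.
  by rewrite ler_peMl.
- rewrite tn2 frob2T -mulrA ler_wpM2r//; exact: le_trans Gam2 g2k.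
- by rewrite tn2 -mulrA ler_wpM2r//; exact: le_trans u2 k1.
- rewrite frob1 tr2.
  have -> : L%:R * (B * T%:R) / N%:R = B * (T%:R * (L%:R / N%:R)) by ring.
  by rewrite ler_wpM2r.
- rewrite tn2; have -> : frob2 (unitcol R L l)^T * (B * T%:R) / N%:R =
    frob2 (unitcol R L l)^T * B * (T%:R / N%:R) by ring.
  rewrite ler_wpM2r//; apply: le_trans Bk.
  by rewrite ler_piMl.
Qed.

End NoiseBounds.

(** Supplies the tightness that [slutsky] asks for, on the same event as the other noise bounds. *)
Lemma frob_xf_stat (R : realType) N L T K (X : 'I_T -> 'M[R]_(N, L))
    (Gam : 'M[R]_(L, K)) eta f E l m :
  (0 < T)%N -> (0 < N)%N -> (forall t, gram X t \in unitmx) ->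
  frob ((unitcol R L l)^T *m olsnoise X E *m (Fdmx X Gam eta f)^T) <=
    m * Num.sqrt (T%:R : R) * (Num.sqrt (N%:R : R))^-1 ->
  frob (xf_stat X Gam eta f E l) <= m.
Proof.
move=> T0 N0 Xu H; rewrite xf_statE// !frobZ.
have -> : frob (Fdmx X Gam eta f *m (olsnoise X E)^T *m unitcol R L l) =
    frob ((unitcol R L l)^T *m olsnoise X E *m (Fdmx X Gam eta f)^T).
  by rewrite -frobT !trmx_mul trmxK mulmxA.
have sT : 0 < Num.sqrt (T%:R : R) by rewrite sqrtr_gt0 ltr0n.
have sN : 0 < Num.sqrt (N%:R : R) by rewrite sqrtr_gt0 ltr0n.
have NE : (N%:R : R) = Num.sqrt (N%:R : R) ^+ 2 by rewrite sqr_sqrtr// ler0n.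
rewrite natrM sqrtrM ?ler0n// !ger0_norm ?invr_ge0 ?mulr_ge0 ?sqrtr_ge0 ?ler0n//.
apply: le_trans (_ : (Num.sqrt (N%:R : R) * Num.sqrt (T%:R : R))^-1 * (N%:R *
  (m * Num.sqrt (T%:R : R) * (Num.sqrt (N%:R : R))^-1)) <= _).
  by rewrite ler_wpM2l ?invr_ge0 ?mulr_ge0 ?sqrtr_ge0// ler_wpM2l// ler0n.
rewrite {2}NE le_eqVlt; apply/orP; left; apply/eqP.
by field; rewrite !gt_eqF.
Qed.

(** * Convergence in distribution of the scaled loading error *)

Theorem theorem1
  (R : realType) (d : measure_display) (Om : measurableType d)
  (P : probability Om R)
  (K : nat) (c1 c2 C : R)
  (N T L : nat -> nat)
  (X : forall n, 'I_(T n) -> Om -> 'M[R]_(N n, L n))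
  (Gam : forall n, 'M[R]_(L n, K))
  (f : forall n, 'I_(T n) -> Om -> 'cV[R]_K)
  (eps : forall n, 'I_(T n) -> Om -> 'cV[R]_(N n))
  (sigma : forall n, 'I_(T n) -> R)
  (eta : forall n, 'cV[R]_(L n))
  (Omg : forall n, 'M[R]_(N n, N n - L n))
  (zeta : forall n, 'cV[R]_(N n - L n))
  (xi : forall n, 'I_(T n) -> 'cV[R]_(N n - L n))
  (Sf : 'M[R]_K) (Sxf : nat -> 'M[R]_K)
  (tG : forall n, Om -> 'M[R]_(L n, K))
  (H : 'M[R]_K) (l : nat) :
  let Qt n t w := Qmx (X n ^~ w) t in
  let Rd n w := ddotRd (X n ^~ w) (Gam n) (eta n) (Omg n) (zeta n) (xi n)
                       (f n ^~ w) (eps n ^~ w) in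
  let Fd n w := Fdmx (X n ^~ w) (Gam n) (eta n) (f n ^~ w) in
  let HG n w := HGam (X n ^~ w) (Gam n) (eta n) (Omg n) (zeta n) (xi n)
                     (f n ^~ w) (eps n ^~ w) (tG n w) in
  (* sigma-field generated by (x_it, f_{t+1})_{i <= N, t <= T} *)
  let G n := <<s [set A | (exists t i j (a : R), A = [set w | X n t w i j <= a])
                       \/ (exists t k (a : R), A = [set w | f n t w k 0 <= a])] >> in
  (* sigma-field generated by the errors of unit i *)
  let Fu n (i : 'I_(N n)) :=
    <<s [set A | exists t (a : R), A = [set w | eps n t w i 0 <= a]] >> in
  let lnNT n := ln ((N n * T n)%:R : R) in
  (* --- sampling scheme --- *)
  0 < c1 -> 0 < c2 -> 0 < C ->
  (forall n, (L n < N n)%N) ->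
  (forall M, \forall n \near \oo, (M <= N n)%N /\ (M <= T n)%N) ->
  (* --- the model: random variables, Omega of full column rank --- *)
  (forall n t i j, measurable_fun setT (fun w => X n t w i j)) ->
  (forall n t k, measurable_fun setT (fun w => f n t w k 0)) ->
  (forall n t i, measurable_fun setT (fun w => eps n t w i 0)) ->
  (forall n, full_col_rank (Omg n)) ->
  (forall n t w, full_col_rank (Xomx (X n ^~ w) (Omg n) t)) ->
  (* --- A1 --- *)
  (forall n t i j, (\int[P]_w ((X n t w i j) ^+ 2)%:E <= C%:E)%E) ->
  ((fun n => P [set w | forall t, eigs_in (Qt n t w) c1 c2]) @ \oo --> 1%E) ->
  (* --- A2 --- *)
  (forall n, eigs_in ((Gam n)^T *m Gam n) c1 c2) ->
  (forall n t, (\int[P]_w ((sqnorm (f n t w)) ^+ 2)%:E <= C%:E)%E) ->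
  conv_prob_mx P (fun n w => ((T n)%:R)^-1 *: (Fd n w *m (Fd n w)^T)) Sf ->
  posdef Sf ->
  (forall n, distinct_eigs ((Gam n)^T *m Gam n *m Sf)) ->
  (forall n t i,
     (\int[P]_w (sqnorm (row i (Bmx (X n ^~ w) (Gam n) t))^T)%:E <= C%:E)%E) ->
  (forall n, (eta n)^T *m Gam n = 0) ->
  (forall n, Num.sqrt (sqnorm (eta n)) <= C) ->
  (* --- A3 (conditional on G n) --- *)
  (forall n t, c1 <= sigma n t <= c2) ->
  (forall n t i,
     P.-integrable setT (fun w => (eps n t w i 0)%:E) /\
     cexp_version P (G n) (fun w => eps n t w i 0) (fun _ => 0)) ->
  (forall n t i,
     P.-integrable setT (fun w => ((eps n t w i 0) ^+ 2)%:E) /\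
     cexp_version P (G n) (fun w => (eps n t w i 0) ^+ 2)
                  (fun _ => sigma n t ^+ 2)) ->
  (forall n t i (s : R),
     P.-integrable setT (fun w => (expR (s * eps n t w i 0))%:E) /\
     forall Y, cexp_version P (G n) (fun w => expR (s * eps n t w i 0)) Y ->
       {ae P, forall w, Y w <= expR (C * s ^+ 2 * sigma n t ^+ 2)}) ->
  (forall n, cond_indep P (G n) (Fu n)) ->
  (forall n i t (c : 'I_(T n) -> Om -> R),
     (forall s, cexp_version P (G n) (fun w => eps n t w i 0 * eps n s w i 0) (c s)) ->
     {ae P, forall w, \sum_s `|c s w| <= C}) ->
  (* --- A4 --- *)
  ((fun n => \big[Num.max/0]_(t < T n) \big[Num.max/0]_(q < N n - L n)
       (((T n)%:R^-1 * \sum_(s < T n) `|xi n s q 0|) /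
        (sigma n t * Num.sqrt (lnNT n) / Num.sqrt (N n)%:R))) @ \oo --> 0) ->
  ((fun n => \big[Num.max/0]_(t < T n)
       \big[Num.max/0]_(q < N n - L n | xi n t q 0 != 0)
       (sigma n t * Num.sqrt (lnNT n) / (`|xi n t q 0| * Num.sqrt (N n)%:R)))
     @ \oo --> 0) ->
  ((fun n => \big[Num.max/0]_(t < T n)
       (ln ((N n)%:R : R) / (N n)%:R *
        (#|[set q : 'I_(N n - L n) | xi n t q 0 != 0]|)%:R)) @ \oo --> 0) ->
  (* --- A5(i), for every fixed characteristic index l' (with l' < L) --- *)
  (forall l' : nat, (forall n, (l' < L n)%N) ->
     posdef (Sxf l') /\
     cond_conv_dist_normal P G
       (fun n w => xf_stat (X n ^~ w) (Gam n) (eta n) (f n ^~ w) (eps n ^~ w) l')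
       (Sxf l')) ->
  (* --- rates --- *)
  ((fun n => (L n)%:R / (N n)%:R : R) @ \oo --> 0) ->
  ((fun n => (T n)%:R / (N n)%:R : R) @ \oo --> 0) ->
  ((fun n => (T n)%:R / ((N n)%:R / (L n)%:R) ^+ 20 : R) @ \oo --> 0) ->
  (* --- tilde Gamma: a (measurable) matrix of top-K left singular vectors of ddot R^d --- *)
  (forall n i k, measurable_fun setT (fun w => tG n w i k)) ->
  (forall n w, topk_left_sv (Rd n w) (tG n w)) ->
  (* --- H is the probability limit of H_Gamma --- *)
  conv_prob_mx P HG H ->
  (* --- the characteristic index: 1 <= l+1 <= L --- *)
  (forall n, (l < L n)%N) ->
  conv_dist_normal P
    (fun n w => gamma_stat (X n ^~ w) (Gam n) (eta n) (Omg n) (zeta n) (xi n)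
                           (f n ^~ w) (eps n ^~ w) (tG n w) l)
    (H^T *m invmx Sf *m Sxf l *m invmx Sf *m H).
Proof.
move=> Qt Rd Fd HG G Fu lnNT c10 c20 C0 LN NT mX mf me _ _ _ Qev Gev _ cFf Sfp _ _ _ _ _
  emean evar _ eindep ecov _ _ _ A5 LNr TNr _ mtG tGsv cHG lL.
have [Sxfp cxf] := A5 l lL.
pose gen n : set (set Om) := [set A |
  (exists t i j (a : R), A = [set w | X n t w i j <= a])
  \/ (exists t k (a : R), A = [set w | f n t w k 0 <= a])].
(* The sample space with the conditioning field, on which measurability in the sense of [G n]
   becomes ordinary measurability. *)
pose S n : measurableType _ := g_sigma_algebraType (gen n).
have hgen n : gen n `<=` measurable.
  move=> A [[t [i [j [a ->]]]]|[t [k [a ->]]]].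
    exact/measurable_le_cst/mX.
  exact/measurable_le_cst/mf.
have mXS n t : mfmx (X n t : S n -> _).
  move=> i j; apply: (@measurable_fun_le_cst R _ (S n)) => a.
  by apply: sub_sigma_algebra; left; exists t, i, j, a.
have mfS n t : mfmx (f n t : S n -> _).
  move=> i j; apply: (@measurable_fun_le_cst R _ (S n)) => a.
  by apply: sub_sigma_algebra; right; exists t, i, a; rewrite ord1.
have mXO n t : mfmx (X n t) by move=> i j; exact: mX.
have mfO n t : mfmx (f n t) by move=> i j; rewrite ord1; exact: mf.
have mEO n t : mfmx (eps n t) by move=> i j; rewrite ord1; exact: me.
have mtGO n : mfmx (tG n) by move=> i j; exact: mtG.
pose xf n w := xf_stat (X n ^~ w) (Gam n) (eta n) (f n ^~ w) (eps n ^~ w) l.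
have mxf n : mfmx (xf n) by exact: mfmx_xf_stat.
have [A [AS cA]] := cond_conv_unconditional hgen mxf cxf.
have [Sfs _] := Sfp; pose M0 := H^T *m invmx Sf.
exists (M0 *m A); split.
  by rewrite trmx_mul -mulmxA (mulmxA A) AS /M0 trmx_mul trmxK trmx_inv Sfs !mulmxA.
move=> g bg; rewrite -gaussE_mul.
have bg' : bounded_cont (fun v => g (M0 *m v)).
  by have [cg [B gB]] := bg; split; [exact: continuous_mulmx_comp|exists B].
apply: (slutsky (Y := fun n w => M0 *m xf n w)) (cA _ bg') => //.
- by move=> n; exact: mfmx_gamma_stat.
- by move=> n; apply: mfmx_mul; [exact: mfmx_cst|exact: mxf].
move=> dl dl0.
have [lam lam0 Sfl] := posdef_lower_bound Sfp.
(* The summands 1 in [h] and in [B] below leave room for the deviations of [HG] from [H] and of the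
   factor moments from [Sf], which are at most [e1 <= 1]. *)
pose g2 := c2 * K%:R; pose ga := Num.sqrt g2; pose h := frob H + 1.
have g20 : 0 <= g2 by rewrite mulr_ge0 ?ler0n// ltW.
pose B := K%:R * (frob Sf + 1).
have B0 : 0 <= B by rewrite mulr_ge0 ?ler0n ?addr_ge0 ?frob_ge0.
pose k := 1 + g2 + B.
have k1 : 1 <= k by rewrite /k -addrA lerDl addr_ge0.
have k0 : 0 < k := lt_le_trans ltr01 k1.
(* Eight events share [dl]: the eigenvalue bounds, the closeness of the factor moments to [Sf] and
   of [HG] to [H], and five noise bounds. The constant [m] makes the Markov bound of each noise
   event equal to [dl / 8]. *)
have dl8 : 0 < dl / 8 by rewrite divr_gt0.
pose m := Num.sqrt (C * k / c1 / (dl / 8)).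
have Ck0 : 0 < C * k / c1 / (dl / 8) by rewrite !divr_gt0// mulr_gt0.
have m0 : 0 < m by rewrite sqrtr_gt0.
have mdl : C * k / c1 / m ^+ 2 <= dl / 8.
  rewrite sqr_sqrtr ?(ltW Ck0)// le_eqVlt; apply/orP; left; apply/eqP.
  by field; rewrite !gt_eqF.
(* The tightness bound depends on [dl] only and is fixed before [e]. *)
exists (frob M0 * m) => e e0.
pose cst := `|@expansion_constant R K c1 lam m h ga Sf| + 1.
have cst0 : 0 < cst by rewrite ltr_wpDl.
(* The four bounds serve, in order, to drop powers of small quantities, to give [Ff_close], to give
   [m_small], and to bring the final error below [e]. *)
pose e1 := Num.min (Num.min 1 (lam / 2)) (Num.min (c1 * lam / 16 / m ^+ 2) (e / cst)).
have e10 : 0 < e1.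
  by rewrite !lt_min ltr01 !divr_gt0 ?exprn_gt0 ?mulr_gt0.
have e11 : e1 <= 1 by rewrite /e1 !ge_min lexx.
have e1l : e1 <= lam / 2 by rewrite /e1 !ge_min lexx orbT.
have e1m : e1 <= c1 * lam / 16 / m ^+ 2 by rewrite /e1 !ge_min lexx !orbT.
have e1e : e1 <= e / cst by rewrite /e1 !ge_min lexx !orbT.
have e12 : 0 < e1 ^+ 2 by rewrite exprn_gt0.
(* The square appears because [rho] and [tau * nu] are the square roots of these ratios. *)
have nLN : \forall n \near \oo, ((L n)%:R / (N n)%:R : R) <= e1 ^+ 2.
  have /cvgrPdist_le/(_ _ e12) := LNr; apply: filterS => n.
  by rewrite sub0r normrN; exact: le_trans (ler_norm _).
have nTN : \forall n \near \oo, ((T n)%:R / (N n)%:R : R) <= e1 ^+ 2.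
  have /cvgrPdist_le/(_ _ e12) := TNr; apply: filterS => n.
  by rewrite sub0r normrN; exact: le_trans (ler_norm _).
have mev n : measurable [set w | forall t, eigs_in (Qt n t w) c1 c2] /\
    <<s gen n >> [set w | forall t, eigs_in (Qt n t w) c1 c2].
  have -> : [set w | forall t, eigs_in (Qt n t w) c1 c2] =
      \bigcap_(t in [set: 'I_(T n)]) [set w | eigs_in (Qt n t w) c1 c2].
    by apply/seteqP; split => [w H0 t _|w H0 t]; exact: H0.
  have HS : <<s gen n >> (\bigcap_(t in [set: 'I_(T n)]) [set w | eigs_in (Qt n t w) c1 c2]).
    apply: (@fin_bigcap_measurable _ (S n)) => // t _.
    apply: (@eigs_in_measurable R _ (S n)) => [|w]; last exact: Qmx_sym.
    apply: mfmx_scale; first exact: measurable_cst.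
    by apply: mfmx_mul; [apply: mfmx_tr; exact: mXS|exact: mXS].
  by split => //; exact: (sub_sigma_measurable (hgen n)).
have nQ : \forall n \near \oo,
    likely P (dl / 8) [set w | forall t, eigs_in (Qt n t w) c1 c2].
  have cQ : (fun n => P (~` [set w | forall t, eigs_in (Qt n t w) c1 c2])) @ \oo --> 0%E.
    have -> : (fun n => P (~` [set w | forall t, eigs_in (Qt n t w) c1 c2])) =
        (fun n => 1 - P [set w | forall t, eigs_in (Qt n t w) c1 c2])%E.
      by apply/funext => n; rewrite probability_setC//; have [] := mev n.
    rewrite -(@subee R 1%E)//; apply: cvgeB => //; exact: cvg_cst.
  apply: filterS (cvge0_near_le cQ dl8) => n Pn.
  by exists [set w | forall t, eigs_in (Qt n t w) c1 c2]; split => //; have [] := mev n.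
have mFdS n : mfmx (Fd n : S n -> _) by exact: mfmx_Fdmx.
have mFdO n : mfmx (Fd n) by exact: mfmx_Fdmx.
have nF : \forall n \near \oo, likely P (dl / 8)
    [set w | frob (((T n)%:R)^-1 *: (Fd n w *m (Fd n w)^T) - Sf) <= e1].
  apply: conv_prob_mx_likely cFf _ _ e10 dl8 => n.
  apply: mfmx_scale; first exact: measurable_cst.
  by apply: mfmx_mul; [exact: mFdO|exact: mfmx_tr].
have nH : \forall n \near \oo, likely P (dl / 8) [set w | frob (HG n w - H) <= e1].
  by apply: conv_prob_mx_likely cHG _ _ e10 dl8 => n; exact: mfmx_HGam.
near=> n.
have [N0 T0] : (0 < N n)%N /\ (0 < T n)%N by near: n; exact: NT.
have L0 : (0 < L n)%N := leq_ltn_trans (leq0n l) (lL n).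
have TR : (0 : R) < (T n)%:R by rewrite ltr0n.
have NR : (0 : R) < (N n)%:R by rewrite ltr0n.
(* [D] must lie in the conditioning field, since the weights are truncated to it. Its second clause
   will follow from the closeness of the factor moments to [Sf]. *)
pose D := [set w | forall t, eigs_in (Qt n t w) c1 c2] `&`
  [set w | frob2 (Fd n w) <= B * (T n)%:R].
have GD : <<s gen n >> D.
  apply: (@measurableI _ (S n)); first by have [] := mev n.
  exact: (@measurable_le_cst R _ (S n) _ _ (mfmx_frob (mFdS n))).
have me' t i : measurable_fun setT (fun w => eps n t w i 0) := me n t i.
have Bk : B <= k by rewrite /k lerDr addr_ge0.
have g2k : g2 <= k by rewrite /k addrAC lerDr addr_ge0.
have noise := noise_bounds_likely (hgen n) C0 me'
  (fun t i => (emean n t i).1) (fun t i => (evar n t i).1)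
  (fun t i => (emean n t i).2) (eindep n) (ecov n) (mXS n) c10 N0 T0 L0 l (mFdS n) GD
  (fun w Dw => Dw.1) (fun w Dw => Dw.2) B0 Bk g2k k1 m0
  (loading_frob2 (Gev n)) mdl.
have Q1 : likely P (dl / 8) [set w | forall t, eigs_in (Qt n t w) c1 c2].
  by near: n; exact: nQ.
have F1 : likely P (dl / 8)
    [set w | frob (((T n)%:R)^-1 *: (Fd n w *m (Fd n w)^T) - Sf) <= e1].
  by near: n; exact: nF.
have H1 : likely P (dl / 8) [set w | frob (HG n w - H) <= e1].
  by near: n; exact: nH.
have LN1 : ((L n)%:R / (N n)%:R : R) <= e1 ^+ 2 by near: n; exact: nLN.
have TN1 : ((T n)%:R / (N n)%:R : R) <= e1 ^+ 2 by near: n; exact: nTN.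
apply: likelyW (likelyI Q1 (likelyI F1 (likelyI H1 noise))).
  by rewrite le_eqVlt; apply/orP; left; apply/eqP; field.
move=> w [Qw [Fw [Hw Nw]]].
have Dw : D w.
  split => //=; apply: le_trans (frob2_gram_le TR Fw) _.
  by rewrite ler_wpM2r ?(ltW TR)// ler_wpM2l ?ler0n// lerD2l.
have [n1 n2 n3 n4 n5] := Nw Dw.
have Xu t : gram (X n ^~ w) t \in unitmx by exact: (gram_unit c10 N0 (Qw t)).
have xm : frob (xf n w) <= m by exact: frob_xf_stat n5.
split; first by apply: le_trans (frobM _ _) _; rewrite ler_wpM2l ?frob_ge0.
have rle : Num.sqrt ((L n)%:R / (N n)%:R : R) <= e1.
  by rewrite -(ger0_norm (ltW e10)) -sqrtr_sqr ler_wsqrtr.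
have tnle : Num.sqrt ((T n)%:R : R) * (Num.sqrt ((N n)%:R : R))^-1 <= e1.
  rewrite -sqrtrV ?ler0n// -sqrtrM ?ler0n//.
  by rewrite -(ger0_norm (ltW e10)) -sqrtr_sqr ler_wsqrtr.
have msmall : m ^+ 2 * Num.sqrt ((L n)%:R / (N n)%:R : R) ^+ 2 <= c1 * lam / 16.
  rewrite sqr_sqrtr ?divr_ge0 ?ler0n// mulrC -ler_pdivlMr ?exprn_gt0//.
  apply: le_trans LN1 _; apply: le_trans e1m.
  by rewrite expr2 ler_piMr// ltW.
have gaG : frob (Gam n) <= ga by rewrite ler_wsqrtr// (loading_frob2 (Gev n)).
have hH : frob (HG n w) <= h.
  have -> : HG n w = H + (HG n w - H) by rewrite addrC subrK.
  by apply: le_trans (frobD _ _) _; rewrite lerD2l; exact: le_trans Hw e11.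
apply: le_trans (gamma_stat_approx T0 N0 (loading_dim c10 (Gev n)) c10 lam0 (ltW m0) Xu
  (tGsv n w) (loading_low (Gev n)) Sfl (le_trans Fw e1l) msmall gaG hH n1 n2 n3 n4
  e11 rle tnle Hw Fw xm) _.
apply: le_trans (_ : cst * e1 <= _).
  rewrite ler_wpM2r ?(ltW e10)//; apply: le_trans (ler_norm _) _.
  by rewrite lerDl.
by rewrite mulrC -ler_pdivlMr.
Unshelve. all: by end_near. Qed.
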